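(* Let $m\ge 3$ be an integer. Let $\alpha_1,\dots,\alpha_m>1$ be pairwise distinct real numbers and let $\beta_1,\dots,\beta_m\in\mathbb R$. Suppose that the sets $S(\alpha_i,\beta_i)$, $1\le i\le m$, partition $\mathbb Z$. Then $$\max_{1\le i\le m}\frac1{\alpha_i}\ge\frac13.$$
   Context: For real $\alpha>1$ and $\beta\in\mathbb R$, $S(\alpha,\beta)=\{\lfloor n\alpha+\beta\rfloor:n\in\mathbb Z\}\subset\mathbb Z$. ''Partition $\mathbb Z$'' means that every integer lies in exactly one of the sets. *)

(* Defs.v *)
From mathcomp Require Import all_boot all_order all_algebra.
From mathcomp Require Import classical_sets reals.
Set Implicit Arguments.
Unset Strict Implicit.
Unset Printing Implicit Defensive.
Import Order.TTheory GRing.Theory Num.Theory.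
Local Open Scope classical_set_scope.
Local Open Scope ring_scope.

Definition beatty (R : realType) (alpha beta : R) : set int :=
  [set Num.floor (n%:~R * alpha + beta) | n in [set: int]].

(* Blocks are counted by index: each integer is in A i for exactly one i. *)
Definition partitions_int (m : nat) (A : 'I_m -> set int) : Prop :=
  forall k : int, exists! i : 'I_m, A i k.

(* Main.v *)
(** Suppose that every density [1 / alpha i] is less than [1 / 3].

If all the moduli are rational, [alpha i = p i / q i] in lowest terms, let [p] be the largest [p i]
and [I] the set of the [q i] with [p i = p]. The k-th integer belongs to the i-th class when
[(k q + d) mod p < q], and at the frequency [l / p], [l] in [I], only the classes of modulus
[p / q], [q] in [I], have a nonzero Fourier coefficient, proportional to
[1 / sin (pi (l / q) / p)] with [l / q] computed modulo [p]. These coefficients add up to 0, whence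
[1 <= sum over q <> l of sin (pi / p) / sin (pi J / p)], [J] being the distance of [l / q] to [p Z].
This system of inequalities has no solution with distinct [q < p / 3] of sum at most [p]: writing
[J q = n p +- l], a term is at most about [q / (n p)], so the inequality for the least [a] in [I] is
nearly tight only when most winding numbers [n] are 1; but for the least [l] that is not a multiple
of [a] (not a power of 2 if [a = 1]) the winding numbers are then large, with at most a few
exceptional [q] close to [l]. Small [p] are excluded by an exhaustive search.

If some modulus is irrational, Dirichlet's theorem gives [L] for which all the [x i * alpha i] are
close to [L]. Two classes with [x i * alpha i] on the same side of [L] must have the same value, so
the classes split into a set [A] and its complement, and translating by multiples of [L] moves the
points of the two parts in opposite directions at constant speeds while the floors still partition
the integers. Hence the points of the two parts cross each integer simultaneously; it follows that
the classes outside [A] cut out an exact cover of the integers by residue classes with distinct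
moduli, which is impossible unless there is only one of them. By symmetry there are at most two
classes. *)

(* A single spectral inequality is no contradiction: at about [q / p] per letter, a total mass [p]
   may just reach 1. So the inequalities of [a] and [l] are added, with weights 1 and 1, or 4 and 1
   when [a = 1], and the arithmetic of [l] leaves almost no letter expensive in both. When [a = 1]
   the obstacle is winding number 0: a divisor [q] of [l] contributes about [q / l]. With [l] the
   least numerator that is not a power of 2, its divisors among the other numerators are 1 and
   powers of 2 of total at most [2 l / k - 2], [k] being the odd part of [l]; they contribute about
   [2 / k] at most. This separates [l] odd, even [l] with [k >= 5], and even [l] with [k = 3], where
   [2 / k] is largest. Replacing sines by rational functions costs a term of order [n / q] per
   letter; as the [q] are distinct, these errors total a constant plus a small multiple of [p],
   absorbed by the assumptions [p >= 120] and [p >= 360] of the two analytic cases. *)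
From Stdlib Require Import NArith.
Require Import Defs.
From mathcomp Require Import all_boot all_order all_algebra.
From mathcomp Require Import zify ring lra.
Set Implicit Arguments.
Unset Strict Implicit.
Unset Printing Implicit Defensive.
Import Order.TTheory GRing.Theory Num.Theory.
Local Open Scope ring_scope.

(** * Residues and sine ratios *)

(* an upper bound for [sin (pi / p) / sin (pi j / p)], from [cos x >= 1 - x ^ 2 / 2] and
   [pi ^ 2 <= 10.2] *)
Definition rho (R : fieldType) (p j : nat) : R :=
  1 / (j%:R * (1 - 17%:R / 10%:R * (j%:R / p%:R) ^+ 2)).

(* [j = n p / q] up to an error of [l / q] *)
Definition winding (p l q j n : nat) : Prop :=
  (j * q = n * p + l)%N \/ (j * q + l = n * p)%N.

(* [j] is the distance to [p Z] of a representative of [l / q] modulo [p] *)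
Definition residue_dist (p l q j : nat) : Prop :=
  [/\ (0 < j)%N, (2 * j <= p)%N & exists n, winding p l q j n].

Lemma winding_uniq p l q j n n' : (2 * l < p)%N ->
  winding p l q j n -> winding p l q j n' -> n = n'.
Proof. by rewrite /winding; nia. Qed.

Lemma winding1_dvdn p l q j : winding p l q j 1 -> (q %| p + l)%N \/ (q %| p - l)%N.
Proof.
case; rewrite mul1n => jq; first by left; rewrite -jq dvdn_mull.
by right; rewrite -jq addnK dvdn_mull.
Qed.

(** Modulo [q], [p] equals [a] up to sign, so [n * p] being [l] up to sign makes [n * a] equal to
    [l] up to sign. This is how two inequalities constrain the same letter. *)
Lemma winding_dvdn p a l q j n : (a < p)%N ->
    (q %| p + a)%N \/ (q %| p - a)%N -> winding p l q j n ->
  (q %| l + n * a)%N \/ (q %| `|l%:Z - (n * a)%:Z|)%N.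
Proof.
move=> ap tight wind; rewrite -[(q %| `|_|)%N]/(q%:Z %| l%:Z - (n * a)%:Z)%Z.
rewrite -[(q %| l + _)%N]/(q%:Z %| (l + n * a)%:Z)%Z.
case: tight => /dvdnP[k kq]; case: wind => jn; [right|left|left|right]; apply/dvdzP.
- by exists (j%:Z - n%:Z * k%:Z); nia.
- by exists (n%:Z * k%:Z - j%:Z); nia.
- by exists (j%:Z - n%:Z * k%:Z); nia.
- by exists (n%:Z * k%:Z - j%:Z); nia.
Qed.

Section Rho.
Variable R : realFieldType.
Implicit Types (p j l q n : nat).

(** With [t = j / p], the product of [1 + 3 t^2] and [1 - 17/10 t^2] is at least 1 as long as
    [t^2 <= 13/51], which [t <= 1/2] just ensures. *)
Lemma rho_le p j : (0 < j)%N -> (2 * j <= p)%N ->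
  p%:R * rho R p j <= p%:R / j%:R + 3%:R * (j%:R / p%:R).
Proof.
move=> j0 jp.
have p0 : 0 < p%:R :> R by rewrite ltr0n; lia.
have J0 : 0 < j%:R :> R by rewrite ltr0n.
have t0 : 0 < j%:R / p%:R :> R by rewrite divr_gt0.
have t2 : j%:R / p%:R <= 1 / 2%:R :> R.
  by rewrite ler_pdivrMr // mul1r mulrC ler_pdivlMr ?ltr0n// -natrM ler_nat; lia.
rewrite /rho; set t := j%:R / p%:R in t0 t2 *.
have -> : p%:R / (j%:R : R) = t^-1 by rewrite /t invf_div.
have d0 : 0 < 1 - 17%:R / 10%:R * t ^+ 2 by nra.
have -> : p%:R * (1 / (j%:R * (1 - 17%:R / 10%:R * t ^+ 2))) =
    t^-1 * (1 - 17%:R / 10%:R * t ^+ 2)^-1.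
  by rewrite div1r invfM mulrA /t invf_div.
have -> : t^-1 + 3%:R * t = t^-1 * (1 + 3%:R * t ^+ 2).
  by field; rewrite gt_eqF.
rewrite ler_pM2l ?invr_gt0// -[leLHS]div1r ler_pdivrMr //.
have s2 : t ^+ 2 <= 1 / 4%:R by nra.
have s0 : 0 <= t ^+ 2 by rewrite sqr_ge0.
by nra.
Qed.

Lemma rho_ge0 p j : (0 < j)%N -> (2 * j <= p)%N -> 0 <= rho R p j.
Proof.
move=> j0 jp.
have p0 : 0 < p%:R :> R by rewrite ltr0n; lia.
have t0 : 0 <= j%:R / p%:R :> R by rewrite divr_ge0.
have t2 : j%:R / p%:R <= 1 / 2%:R :> R.
  by rewrite ler_pdivrMr // mul1r mulrC ler_pdivlMr ?ltr0n// -natrM ler_nat; lia.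
rewrite /rho; apply: divr_ge0 => //; apply: mulr_ge0 => //; nra.
Qed.

(** The bound [p / t + 3 t / p] decreases for [t <= p / 2], so [j] may be replaced by its lower
    bound [(n p - l) / q]. *)
Lemma rho_bound p l q n j : (0 < q)%N -> (0 < n)%N -> (l < p)%N ->
    (0 < j)%N -> (2 * j <= p)%N -> (n * p <= j * q + l)%N ->
  p%:R * rho R p j <= q%:R * (p%:R / (n%:R * p%:R - l%:R)) + 3%:R * n%:R / q%:R.
Proof.
move=> q0 n0 lp j0 jp njl; apply: le_trans (rho_le j0 jp) _.
have p0 : 0 < p%:R :> R by rewrite ltr0n; lia.
have J0 : 0 < j%:R :> R by rewrite ltr0n.
have Q0 : 0 < q%:R :> R by rewrite ltr0n.
have L0 : 0 <= l%:R :> R by rewrite ler0n.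
have LP : l%:R < p%:R :> R by rewrite ltr_nat.
have N1 : 1 <= n%:R :> R by rewrite ler1n.
have JP : 2%:R * j%:R <= p%:R :> R by rewrite -natrM ler_nat.
have H : n%:R * p%:R - l%:R <= j%:R * q%:R :> R.
  by rewrite lerBlDr -!natrM -natrD ler_nat.
set d := n%:R * p%:R - l%:R in H *.
have d0 : 0 < d by rewrite /d; nra.
have dn : d <= n%:R * p%:R by rewrite /d; lra.
apply: (@le_trans _ _ (q%:R * (p%:R / d) + 3%:R * (d / (q%:R * p%:R)))); last first.
  rewrite lerD2l -mulrA ler_pM2l ?ltr0n// ler_pdivrMr ?mulr_gt0//.
  by have -> : n%:R / q%:R * (q%:R * p%:R) = n%:R * p%:R :> R by field; rewrite gt_eqF.
have t0 : 0 < d / q%:R by rewrite divr_gt0.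
have tj : d / q%:R <= j%:R by rewrite ler_pdivrMr.
have -> : q%:R * (p%:R / d) = p%:R / (d / q%:R) by field; rewrite !gt_eqF.
have -> : d / (q%:R * p%:R) = (d / q%:R) / p%:R by field; rewrite !gt_eqF.
move: (d / q%:R) t0 tj => t t0 tj.
have -> : p%:R / j%:R + 3%:R * (j%:R / p%:R) =
   p%:R / t + 3%:R * (t / p%:R) - (j%:R - t) * (p%:R ^+ 2 - 3%:R * (j%:R * t)) / (j%:R * t * p%:R).
  by field; rewrite !gt_eqF.
rewrite gerBl; apply: divr_ge0; last by rewrite !mulr_ge0// ltW.
apply: mulr_ge0; first by rewrite subr_ge0.
by nra.
Qed.

(** Winding number 0: [p / j] is exactly [q p / l], and the error [3 j / p = 3 l / (p q)] is below
    [1 / q]. *)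
Lemma rho_bound0 p l q j : (0 < q)%N -> (3 * l < p)%N -> (j * q = l)%N -> (0 < j)%N ->
  p%:R * rho R p j <= q%:R * (p%:R / l%:R) + 1 / q%:R.
Proof.
move=> q0 lp jq j0.
have jp : (2 * j <= p)%N by nia.
apply: le_trans (rho_le j0 jp) _.
have p0 : 0 < p%:R :> R by rewrite ltr0n; lia.
have J0 : 0 < j%:R :> R by rewrite ltr0n.
have Q0 : 0 < q%:R :> R by rewrite ltr0n.
rewrite -jq natrM; have -> : q%:R * (p%:R / (j%:R * q%:R)) = p%:R / j%:R :> R.
  by field; rewrite !gt_eqF.
rewrite lerD2l ler_pdivlMr //.
have -> : 3%:R * (j%:R / p%:R) * q%:R = 3%:R * (j%:R * q%:R) / p%:R :> R by field; rewrite gt_eqF.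
by rewrite ler_pdivrMr // mul1r -!natrM ler_nat jq ltnW.
Qed.

End Rho.

(** * Sums of reciprocals over distinct integers *)

Section Sums.
Variable R : realFieldType.
Implicit Types (I s : seq nat) (P : pred nat) (f : nat -> R).

Lemma ler_sum_sub f P I s : uniq I -> {in I, forall q, P q -> q \in s} ->
  {in s, forall q, 0 <= f q} -> \sum_(q <- I | P q) f q <= \sum_(q <- s) f q.
Proof.
elim: I s => [|q I IH] s /=.
  by move=> _ _ f0; rewrite big_nil big_seq_cond sumr_ge0 // => i /andP[/f0].
move=> /andP[qI uI] Is f0; rewrite big_cons; case: ifP => Pq; last first.
  by apply: IH => // x xI; apply: Is; rewrite inE xI orbT.
have qs : q \in s by apply: Is; rewrite // mem_head.
rewrite (perm_big _ (perm_to_rem qs)) /= big_cons lerD2l; apply: IH => //.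
  move=> x xI Px; have := Is x; rewrite inE xI orbT => /(_ isT Px) xs.
  move: xs; rewrite (perm_mem (perm_to_rem qs)) inE => /orP[/eqP xq|//].
  by rewrite xq (negPf qI) in xI.
by move=> x /mem_rem; apply: f0.
Qed.

Lemma sum_pred1_le (c : R) P I x : uniq I -> 0 <= c ->
  \sum_(q <- I | P q) (if q == x then c else 0) <= c.
Proof.
move=> uI c0; rewrite -big_mkcondr /=.
have := @ler_sum_sub (fun=> c) (fun q => P q && (q == x)) I [:: x] uI.
rewrite big_seq1; apply => //.
by move=> q _ /andP[_ /eqP ->]; rewrite mem_head.
Qed.

(* [1 / q <= q / 625 + gap], the gap being nonzero only for [q < 25] *)
Definition tail_gap (L : nat) : R := \sum_(L.+1 <= q < 25) (1 / q%:R - q%:R / 625%:R).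

(** Distinctness of the letters enters here: the gap of each small [q] is paid once, and the rest is
    proportional to the mass. *)
Lemma sum_inv_le L P I : uniq I -> {in I, forall q, P q -> (L < q)%N} ->
  \sum_(q <- I | P q) 1 / q%:R <= tail_gap L + (\sum_(q <- I | P q) q%:R) / 625%:R.
Proof.
move=> uI PL.
have gap0 (q : nat) : (0 < q)%N -> (q < 25)%N -> 0 <= 1 / q%:R - q%:R / 625%:R :> R.
  move=> q0 q25; have Q0 : 0 < q%:R :> R by rewrite ltr0n.
  rewrite subr_ge0 ler_pdivlMr // mulrAC ler_pdivrMr ?ltr0n // mul1r -natrM ler_nat.
  nia.
apply: (@le_trans _ _ (\sum_(q <- I | P q)
    (q%:R / 625%:R + (if (q < 25)%N then 1 / q%:R - q%:R / 625%:R else 0)))).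
  rewrite big_seq_cond [leRHS]big_seq_cond; apply: ler_sum => q /andP[qI Pq].
  have q0 : (0 < q)%N by have := PL q qI Pq; lia.
  have Q0 : 0 < q%:R :> R by rewrite ltr0n.
  case: ifP => q25; first by rewrite addrC subrK.
  rewrite addr0 ler_pdivlMr ?ltr0n // mulrAC ler_pdivrMr // mul1r -natrM ler_nat.
  nia.
rewrite big_split /= addrC -mulr_suml lerD2r -big_mkcondr /=.
rewrite /tail_gap; apply: ler_sum_sub => //.
  by move=> q qI /andP[Pq q25]; rewrite mem_index_iota q25 andbT; apply: PL.
move=> q; rewrite mem_index_iota => /andP[Lq q25]; apply: gap0 => //; lia.
Qed.

Lemma tail_gap_le L L' : (L <= L')%N -> tail_gap L' <= tail_gap L.
Proof.
move=> LL; rewrite /tail_gap; apply: ler_sum_sub; rewrite ?iota_uniq //.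
  by move=> q; rewrite !mem_index_iota => /andP[? ?] _; lia.
move=> q; rewrite mem_index_iota => /andP[Lq q25].
have Q0 : 0 < q%:R :> R by rewrite ltr0n; lia.
rewrite subr_ge0 ler_pdivlMr // mulrAC ler_pdivrMr ?ltr0n // mul1r -natrM ler_nat.
nia.
Qed.

Lemma tail_gap3 : tail_gap 3 <= 1474%:R / 1000%:R.
Proof. by rewrite /tail_gap unlock /=; lra. Qed.

End Sums.

(** * The spectral inequalities when the least numerator exceeds 1 *)

(* [I] is the set of numerators of the moduli [p / q] of largest [p] *)
Definition spectral_system (R : realFieldType) (p : nat) (I : seq nat)
    (J : nat -> nat -> nat) : Prop :=
  [/\ uniq I, (\sum_(q <- I) q <= p)%N,
      {in I, forall q, [/\ (0 < q)%N, (3 * q < p)%N & coprime q p]},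
      {in I &, forall l q, l != q -> residue_dist p l q (J l q)} &
      {in I, forall l, 1 <= \sum_(q <- I | q != l) rho R p (J l q)}].

Section Basics.
Variable R : realFieldType.
Implicit Types (p l q n a : nat).

(** Any lower bound [m] of the winding number may stand for it, since only [m p <= j q + l]
    matters. *)
Lemma residue_bound m p l q j : residue_dist p l q j ->
    (0 < q)%N -> (0 < m)%N -> (l < p)%N ->
    (forall n, (j * q = n * p + l)%N \/ (j * q + l = n * p)%N -> (m <= n)%N) ->
  p%:R * rho R p j <= q%:R * (p%:R / (m%:R * p%:R - l%:R)) + 3%:R * m%:R / q%:R.
Proof.
move=> [j0 jp [n jn]] q0 m0 lp mn; apply: rho_bound => //.
by have := mn n jn; case: jn => jn; move: jn m0 lp; clear; nia.
Qed.

Lemma ex_minimal (I : seq nat) (P : pred nat) : has P I ->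
  exists2 a, (a \in I) && P a & {in I, forall q, P q -> (a <= q)%N}.
Proof.
move=> /hasP[x0 x0I Px0].
have ex : exists n, (n \in I) && P n by exists x0; rewrite x0I.
exists (ex_minn ex); first by case: ex_minnP.
by move=> q qI Pq; case: ex_minnP => m _; apply; rewrite qI.
Qed.

Lemma big_seqD1 (I : seq nat) (P : pred nat) (f : nat -> R) x : uniq I -> x \in I -> P x ->
  \sum_(q <- I | P q) f q = f x + \sum_(q <- I | P q && (q != x)) f q.
Proof.
move=> uI xI Px; rewrite big_mkcond (bigD1_seq x) //= Px; congr (_ + _).
rewrite big_mkcond [RHS]big_mkcond; apply: eq_bigr => i _.
by case: (P i); case: (i != x).
Qed.

End Basics.

Section MinNumeratorGt1.
Variables (R : realFieldType) (p : nat) (I : seq nat) (J : nat -> nat -> nat).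
Hypothesis H : spectral_system R p I J.
Variable a : nat.
Hypotheses (aI : a \in I) (amin : {in I, forall q, (a <= q)%N}) (a1 : (1 < a)%N).
Hypothesis p120 : (120 <= p)%N.

Let uI : uniq I. Proof. by case: H. Qed.
Let mI q : q \in I -> [/\ (0 < q)%N, (3 * q < p)%N & coprime q p].
Proof. by case: H => _ _ + _ _; apply. Qed.
Let rI l q : l \in I -> q \in I -> l != q -> residue_dist p l q (J l q).
Proof. by case: H => _ _ _ + _; apply. Qed.
Let sI l : l \in I -> 1 <= \sum_(q <- I | q != l) rho R p (J l q).
Proof. by case: H => _ _ _ _; apply. Qed.
Let massI : \sum_(q <- I) q%:R <= p%:R :> R.
Proof. by case: H => _ + _ _ _; rewrite -natr_sum ler_nat. Qed.

Lemma winding_min_gt0 q n : q \in I -> q != a ->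
  winding p a q (J a q) n -> (0 < n)%N.
Proof.
move=> qI qa; case: n => // ne.
have [j0 _ _] := rI aI qI ltac:(by rewrite eq_sym).
move: ne j0 (amin qI); move/eqP: qa; rewrite /winding; clear; nia.
Qed.

(** With winding number 1, [j q] is [p + a] or [p - a]; as [a] divides [q], it would divide [p],
    against coprimality and [a > 1]. *)
Lemma mult_far q n : q \in I -> q != a -> (a %| q)%N ->
  winding p a q (J a q) n -> (1 < n)%N.
Proof.
move=> qI qa aq jn; have := winding_min_gt0 qI qa jn.
case: n jn => [|[|n]] // jn _; exfalso.
have ap : (a %| p)%N.
  have aj : (a %| J a q * q)%N by apply: dvdn_mull.
  case: jn => jn; rewrite mul1n in jn.
    by move: aj; rewrite jn dvdn_addl.
  by rewrite -jn dvdn_add.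
have [_ _] := mI aI; rewrite /coprime; have /gcdn_idPl -> := ap.
by move: a1; case: (a) => [|[]].
Qed.

(** If all numerators were multiples of [a], the other letters would have winding number at least 2
    and be worth at most [39/40] of their mass, so the inequality of [a] would fail. *)
Lemma has_nonmult : has (fun q => ~~ (a %| q)%N) I.
Proof.
apply/negP => /negP; rewrite -all_predC => /allP /= am.
have P0 : 120%:R <= p%:R :> R by rewrite ler_nat.
have [_ a3 _] := mI aI.
have A3 : 3%:R * a%:R <= p%:R :> R by rewrite -natrM ler_nat ltnW.
have A0 : 0 < a%:R :> R by rewrite ltr0n; lia.
suff : \sum_(q <- I | q != a) p%:R * rho R p (J a q) <=
    \sum_(q <- I | q != a) q%:R * (39%:R / 40%:R).
  rewrite -mulr_sumr -mulr_suml => S.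
  have := sI aI; have := massI; rewrite (big_seqD1 _ uI aI) //=.
  have : 0 <= \sum_(i <- I | i != a) (i%:R : R) by apply: sumr_ge0.
  nra.
rewrite big_seq_cond [leRHS]big_seq_cond; apply: ler_sum => q /andP[qI qa].
have [q0 q3 _] := mI qI.
have aq : (a %| q)%N by have := am q qI; rewrite negbK.
(* A proper multiple of [a >= 2] is at least 4, whence [6 / q <= 3 q / 8]; with [3 q / 5] this makes
   [39 q / 40]. *)
have q4 : (4 <= q)%N.
  by move/dvdnP: aq qa q0 => [k ->]; case: k => [|[|k]] //; rewrite ?mul1n ?eqxx//; nia.
apply: le_trans (residue_bound (m := 2) R (rI aI qI _) q0 _ _ _) _ => //.
- by rewrite eq_sym.
- lia.
- by move=> n; apply: mult_far.
have Q4 : 4%:R <= q%:R :> R by rewrite ler_nat.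
have -> : 3%:R * 2%:R / q%:R = 6%:R / q%:R :> R by ring.
have h1 : p%:R / (2%:R * p%:R - a%:R) <= 3%:R / 5%:R :> R.
  by rewrite ler_pdivrMr; lra.
have h2 : 6%:R / q%:R <= q%:R * (3%:R / 8%:R) :> R.
  by rewrite ler_pdivrMr; nra.
have h3 : q%:R * (p%:R / (2%:R * p%:R - a%:R)) <= q%:R * (3%:R / 5%:R) :> R.
  by rewrite ler_pM2l //; lra.
lra.
Qed.

Let tight q j : winding p a q j 1 -> (q %| p + a)%N \/ (q %| p - a)%N.
Proof. exact: winding1_dvdn. Qed.

(** [q] divides [l + a] or [l - a] and exceeds [l > a], which leaves only [l + a]. *)
Lemma near_near l q j j' : (a < l)%N -> (2 * l < p)%N -> (l < q)%N ->
  winding p a q j 1 -> winding p l q j' 1 -> q = (l + a)%N.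
Proof.
move=> al lp lq /tight tq wl.
have ap : (a < p)%N by move: al lp; clear; lia.
have := winding_dvdn ap tq wl; rewrite !mul1n; case => /dvdnP[k]; case: k => [|[|k]].
- by move: al lq; clear; lia.
- by rewrite mul1n => ->.
- by move: al lq; clear; nia.
- by move: al lq; clear; lia.
- by move: al lq; clear; lia.
- by move: al lq; clear; nia.
Qed.

Variable l : nat.
Hypotheses (lI : l \in I) (al : ~~ (a %| l)%N).
Hypothesis lmin : {in I, forall q, ~~ (a %| q)%N -> (l <= q)%N}.

Let altl : (a < l)%N.
Proof.
have := amin lI; rewrite leq_eqVlt => /orP[/eqP al'|//].
by move: al; rewrite -al' dvdnn.
Qed.

Let l3 : (3 * l < p)%N. Proof. by case: (mI lI). Qed.

(** Winding number 0 makes [q] a divisor of [l] smaller than [l]; by minimality of [l] it is a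
    multiple of [a], and then so is [l]. *)
Lemma winding_l_gt0 q n : q \in I -> q != l -> winding p l q (J l q) n -> (0 < n)%N.
Proof.
move=> qI ql; have [j0 _ _] := rI lI qI ltac:(by rewrite eq_sym).
case: n => // -[] jl; last by move: jl j0 altl; clear; lia.
rewrite mul0n add0n in jl; exfalso.
have qltl : (q < l)%N by move/eqP: ql; move: jl j0; clear; nia.
move/negP: al; apply; rewrite -jl; apply: dvdn_mull.
by apply: contraLR qltl => /(lmin qI); rewrite -leqNgt.
Qed.

Let P : R := p%:R.
Let u : R := P / (P - a%:R).
Let v : R := P / (2%:R * P - a%:R).
Let w : R := P / (P - l%:R).
Let z : R := P / (2%:R * P - l%:R).

Let bA m q : q \in I -> q != a -> (0 < m)%N ->
  (forall n, winding p a q (J a q) n -> (m <= n)%N) ->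
  P * rho R p (J a q) <= q%:R * (P / (m%:R * P - a%:R)) + 3%:R * m%:R * q%:R^-1.
Proof.
move=> qI qa m0 mn; have [q0 q3 _] := mI qI.
apply: residue_bound (rI aI qI _) q0 m0 _ mn; first by rewrite eq_sym.
by move: altl l3; clear; lia.
Qed.

Let bB m q : q \in I -> q != l -> (0 < m)%N ->
  (forall n, winding p l q (J l q) n -> (m <= n)%N) ->
  P * rho R p (J l q) <= q%:R * (P / (m%:R * P - l%:R)) + 3%:R * m%:R * q%:R^-1.
Proof.
move=> qI ql m0 mn; have [q0 q3 _] := mI qI.
apply: residue_bound (rI lI qI _) q0 m0 _ mn; first by rewrite eq_sym.
by move: l3; clear; lia.
Qed.

(** A letter has winding number at least 2 in one of the two inequalities and costs at most [w + v]
    per unit either way, except [l + a], which may be tight in both and costs [u + w]. *)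
Lemma two_letter_bound q : q \in I -> q != a -> q != l ->
   v <= u -> u + z <= w + v ->
    P * rho R p (J a q) + P * rho R p (J l q) <=
    q%:R * (w + v) + 9%:R * q%:R^-1 + (if q == (l + a)%N then (l + a)%:R * (u - v) else 0).
Proof.
move=> qI qa ql vu uzwv; have [q0 _ _] := mI qI.
have Q0 : 0 < q%:R^-1 :> R by rewrite invr_gt0 ltr0n.
have Q0' : 0 <= q%:R :> R by rewrite ler0n.
have bA1 := @bA 1 q qI qa isT (fun n => @winding_min_gt0 q n qI qa).
have bB1 := @bB 1 q qI ql isT (fun n => @winding_l_gt0 q n qI ql).
rewrite mulr1n mul1r mulr1 -/u in bA1; rewrite mulr1n mul1r mulr1 -/w in bB1.
have sp0 : 0 <= (if q == (l + a)%N then (l + a)%:R * (u - v) else 0).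
  by case: ifP => // _; rewrite mulr_ge0 ?ler0n ?subr_ge0.
have far : (forall n, winding p a q (J a q) n -> (1 < n)%N) ->
    P * rho R p (J a q) + P * rho R p (J l q) <=
    q%:R * (w + v) + 9%:R * q%:R^-1 + (if q == (l + a)%N then (l + a)%:R * (u - v) else 0).
  move=> fa; have := @bA 2 q qI qa isT fa; rewrite -/v; move: bB1 sp0 Q0.
  by move: (if _ then _ else _) (q%:R^-1) => *; lra.
case: (leqP q l) => qltl.
  apply: far => n; apply: mult_far => //.
  by apply: contraT => /(lmin qI); move/eqP: ql; move: qltl; clear; lia.
have [_ _ [na jna]] : residue_dist p a q (J a q) by apply: rI; rewrite // eq_sym.
have [_ _ [nl jnl]] : residue_dist p l q (J l q) by apply: rI; rewrite // eq_sym.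
have na0 := winding_min_gt0 qI qa jna; have nl0 := winding_l_gt0 qI ql jnl.
have l2 : (2 * l < p)%N by move: l3; clear; lia.
have a2 : (2 * a < p)%N by move: l2 altl; clear; lia.
case: (ltnP 1 na) => na1.
  by apply: far => n jn; rewrite -(winding_uniq a2 jna jn).
case: (ltnP 1 nl) => nl1.
  have := @bB 2 q qI ql isT (fun n jn => leq_trans nl1 (eq_leq (winding_uniq l2 jnl jn))).
  rewrite -/z; have : q%:R * (u + z) <= q%:R * (w + v) by rewrite ler_wpM2l.
  by move: bA1 sp0; move: (if _ then _ else _) (q%:R^-1) => *; lra.
have na2 : na = 1%N by move: na0 na1; clear; lia.
have nl2 : nl = 1%N by move: nl0 nl1; clear; lia.
rewrite na2 in jna; rewrite nl2 in jnl.
have qE := near_near altl l2 qltl jna jnl.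
by rewrite -qE eqxx; move: bA1 bB1 Q0; move: (q%:R^-1) => *; lra.
Qed.

End MinNumeratorGt1.

Section RealInequalities.
Variables (R : realFieldType) (P a l : R).
Hypotheses (P0 : 120%:R <= P) (a2 : 2%:R <= a) (al : a + 1 <= l) (l3 : 3%:R * l <= P).
Let u : R := P / (P - a).
Let v : R := P / (2%:R * P - a).
Let w : R := P / (P - l).
Let z : R := P / (2%:R * P - l).

(** Both differences come from the shift [l - a]: [w - u = u w (l - a) / P] and
    [z - v = v z (l - a) / P], with [v z <= 1 <= u w]. *)
Lemma coeff_order : v <= u /\ u + z <= w + v.
Proof.
move: (P0) (a2) (al) (l3) => P0' a2' al' l3'.
have a0 : 0 < P - a by lra.
have a1 : 0 < 2%:R * P - a by lra.
have l0 : 0 < P - l by lra.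
have l1 : 0 < 2%:R * P - l by lra.
have p0 : 0 < P by lra.
have pn := lt0r_neq0 p0.
have uE : u * (P - a) = P by rewrite divfK // lt0r_neq0.
have vE : v * (2%:R * P - a) = P by rewrite divfK // lt0r_neq0.
have wE : w * (P - l) = P by rewrite divfK // lt0r_neq0.
have zE : z * (2%:R * P - l) = P by rewrite divfK // lt0r_neq0.
have u1 : 1 <= u by rewrite ler_pdivlMr //; lra.
have w1 : 1 <= w by rewrite ler_pdivlMr //; lra.
have v1 : v <= 1 by rewrite ler_pdivrMr //; lra.
have z1 : z <= 1 by rewrite ler_pdivrMr //; lra.
have v0 : 0 < v by rewrite divr_gt0.
have z0 : 0 < z by rewrite divr_gt0.
split; first by apply: le_trans u1.
have e1 : (w - u) * P = u * w * (l - a).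
  by rewrite mulrBl -[in X in X - _]uE -[in X in _ - X]wE; ring.
have e2 : (z - v) * P = v * z * (l - a).
  by rewrite mulrBl -[in X in X - _]vE -[in X in _ - X]zE; ring.
have vzuw : v * z <= u * w.
  by apply: ler_pM; rewrite ?(ltW v0) ?(ltW z0) //; [apply: le_trans u1|apply: le_trans w1].
have : (z - v) * P <= (w - u) * P.
  by rewrite e1 e2 ler_wpM2r // subr_ge0; apply: le_trans al; lra.
by rewrite ler_pM2r //; lra.
Qed.

(** [s] is the exceptional letter [l + a] if it is present, else 0. The total stays [15/100 P] below
    the required [2 P]; this margin absorbs the error terms. *)
Lemma coeff_total (s : R) : 0 <= s -> s * 3%:R <= P -> (s = 0 \/ s = l + a) ->
  l * u + a * w + (w + v) * (P - a - l) + s * (u - v) <=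
  P + P * (170%:R / 200%:R).
Proof.
move=> s0 s3 sE.
move: (P0) (a2) (al) (l3) => P0' a2' al' l3'.
have a0 : 0 < P - a by lra.
have a1 : 0 < 2%:R * P - a by lra.
have l0 : 0 < P - l by lra.
have p0 : 0 < P by lra.
have uE : u * (P - a) = P by rewrite divfK // lt0r_neq0.
have vE : v * (2%:R * P - a) = P by rewrite divfK // lt0r_neq0.
have wE : w * (P - l) = P by rewrite divfK // lt0r_neq0.
have u1 : 1 <= u by rewrite ler_pdivlMr //; lra.
have u2 : u <= 3%:R / 2%:R by rewrite ler_pdivrMr //; lra.
have v1 : 1 / 2%:R <= v by rewrite ler_pdivlMr //; lra.
have v2 : v <= 3%:R / 5%:R by rewrite ler_pdivrMr //; lra.
have -> : l * u + a * w + (w + v) * (P - a - l) + s * (u - v) =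
  w * (P - l) + l * (u - v) + v * (2%:R * P - a) - v * P + s * (u - v) by ring.
rewrite wE vE; case: sE => sE; rewrite {}sE in s0 s3 *.
  have : l * (u - v) <= P / 3%:R * 1.
    by apply: ler_pM; lra.
  by have : v * P >= 1 / 2%:R * P; [rewrite ler_pM2r|]; lra.
have v3 : v <= 6%:R / 11%:R by rewrite ler_pdivrMr //; lra.
have h1 : (l + a) * (2%:R * (u - v)) <= P / 3%:R * (2%:R * (u - v)).
  by rewrite ler_wpM2r; lra.
have h2 : (2%:R / 3%:R * P - a) * u <= 2%:R / 3%:R * P.
  have : (2%:R / 3%:R * P - a) * u = 2%:R / 3%:R * (u * (P - a)) - a * u / 3%:R by field.
  by rewrite uE => ->; rewrite gerBl; apply: divr_ge0 => //; apply: mulr_ge0; lra.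
have h3 : v * P <= 6%:R / 11%:R * P by rewrite ler_pM2r.
by move: h1 h2 h3 vE => *; lra.
Qed.
End RealInequalities.

Section MinNumeratorGt1Concl.
Variables (R : realFieldType) (p : nat) (I : seq nat) (J : nat -> nat -> nat).
Hypothesis H : spectral_system R p I J.
Variable a : nat.
Hypotheses (aI : a \in I) (amin : {in I, forall q, (a <= q)%N}) (a1 : (1 < a)%N).
Hypothesis p120 : (120 <= p)%N.

Theorem min_numerator_gt1 : False.
Proof.
have [uI _ mI rI sI] := H.
have [l /andP[lI al] lmin] := ex_minimal (has_nonmult H aI amin a1 p120).
have la : l != a by apply: contraNneq al => ->.
have altl : (a < l)%N by have := amin lI; move/eqP: la; clear; lia.
have [_ l3 _] := mI l lI.
have P0 : 120%:R <= p%:R :> R by rewrite ler_nat.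
have A2 : 2%:R <= a%:R :> R by rewrite ler_nat.
have LA : a%:R + 1 <= l%:R :> R by rewrite natr1 ler_nat.
have L3 : 3%:R * l%:R <= p%:R :> R by rewrite -natrM ler_nat ltnW.
have [vu uzwv] := coeff_order P0 A2 LA L3.
pose s := if (l + a)%N \in I then (l + a)%:R else 0 : R.
have tot : _ := coeff_total P0 A2 LA L3 (s := s).
have letters q := two_letter_bound H aI amin a1 lI al lmin (q := q).
set P : R := p%:R in P0 L3 vu uzwv tot letters.
set u := P / (P - a%:R) in vu uzwv tot letters.
set v := P / (2%:R * P - a%:R) in vu uzwv tot letters.
set w := P / (P - l%:R) in vu uzwv tot letters.
set z := P / (2%:R * P - l%:R) in uzwv letters.
have {}tot : l%:R * u + a%:R * w + (w + v) * (P - a%:R - l%:R) + s * (u - v) <=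
    P + P * (170%:R / 200%:R).
  apply: tot; rewrite /s; case: ifP => laI //.
  - by rewrite /P -natrM ler_nat mulnC ltnW //; case: (mI _ laI).
  - by rewrite mul0r /P ler0n.
  - by right; rewrite natrD.
  - by left.
have mass : \sum_(q <- I | (q != a) && (q != l)) q%:R <= P - a%:R - l%:R.
  have := H => -[_ + _ _ _]; rewrite -(ler_nat R) natr_sum -/P.
  rewrite (big_seqD1 _ uI aI) //= (big_seqD1 _ uI lI) //=; lra.
have S4 : \sum_(q <- I | (q != a) && (q != l)) 1 / q%:R <=
    tail_gap R 3 + (P - a%:R - l%:R) / 625%:R.
  apply: le_trans (@sum_inv_le R 3 (fun q => (q != a) && (q != l)) I uI _) _; last first.
    by rewrite lerD2l ler_pM2r ?invr_gt0 ?ltr0n //; exact: mass.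
  (* Reciprocals are summed from 4 on: if [a = 2], the letter 3 is not a multiple of [a], so it
     could only be [l]. *)
  move=> q qI /andP[qa ql]; have := amin qI.
  move: qa ql altl a1 => /eqP qa /eqP ql ltal gt1 le_aq.
  case: (eqVneq a 2%N) => [a2|/eqP a2]; last by move: a2 gt1 le_aq ltal ql qa a1; clear; lia.
  case: (eqVneq q 3%N) => [q3|/eqP q3]; last by move: q3 a2 gt1 le_aq ltal ql qa a1; clear; lia.
  have := lmin q qI; rewrite q3 a2 => /(_ isT); move: a2 q3 ltal ql; clear; lia.
have sA := sI a aI; have sB := sI l lI.
have al' : a != l by rewrite eq_sym.
have [ap lp] : (a < p)%N /\ (l < p)%N by move: altl l3; clear; lia.
have [a0 l0] : (0 < a)%N /\ (0 < l)%N by move: altl a1; clear; lia.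
have EA : P * rho R p (J a l) <= l%:R * u + 3%:R / l%:R.
  have := residue_bound R (rI _ _ aI lI al') l0 (ltn0Sn 0) ap
    (fun n => winding_min_gt0 H aI amin (n := n) lI la).
  by rewrite mulr1n mul1r mulr1.
have EB : P * rho R p (J l a) <= a%:R * w + 3%:R / a%:R.
  have := residue_bound R (rI _ _ lI aI la) a0 (ltn0Sn 0) lp
    (fun n => winding_l_gt0 H amin lI al lmin (n := n) aI al').
  by rewrite mulr1n mul1r mulr1.
have : 2%:R * P <= l%:R * u + 3%:R / l%:R + a%:R * w + 3%:R / a%:R +
   ((w + v) * (P - a%:R - l%:R) + s * (u - v) + 9%:R * (tail_gap R 3 + (P - a%:R - l%:R) / 625%:R)).
  have s0 : 0 <= s * (u - v).
    by rewrite mulr_ge0 ?subr_ge0 // /s; case: ifP.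
  have w0 : 0 <= w + v by rewrite addr_ge0 // /w /v divr_ge0; lra.
  have body : \sum_(q <- I | (q != a) && (q != l)) (P * rho R p (J a q) + P * rho R p (J l q)) <=
      (w + v) * (P - a%:R - l%:R) + 9%:R * (tail_gap R 3 + (P - a%:R - l%:R) / 625%:R) + s * (u - v).
    apply: (@le_trans _ _ (\sum_(q <- I | (q != a) && (q != l))
        (q%:R * (w + v) + 9%:R * (1 / q%:R) + (if q == (l + a)%N then s * (u - v) else 0)))).
      rewrite big_seq_cond [leRHS]big_seq_cond; apply: ler_sum => q /andP[qI /andP[qa ql]].
      apply: le_trans (letters q qI qa ql vu uzwv) _; rewrite div1r lerD2l.
      by case: eqP => // qE; rewrite /s -qE qI.
    rewrite !big_split /= -mulr_suml -mulr_sumr.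
    apply: lerD; first (apply: lerD); first by rewrite mulrC ler_wpM2l.
      by rewrite ler_wpM2l.
    exact: sum_pred1_le.
  move: body; rewrite big_split /= -[X in X + _ <= _]mulr_sumr -[X in _ + X <= _]mulr_sumr.
  have : P <= P * \sum_(q <- I | q != a) rho R p (J a q) by rewrite ler_peMr // /P ler0n.
  have : P <= P * \sum_(q <- I | q != l) rho R p (J l q) by rewrite ler_peMr // /P ler0n.
  rewrite (big_seqD1 _ uI lI la) (big_seqD1 (P := fun q => q != l) _ uI aI) 1?eq_sym //.
  under [X in _ <= P * (_ + X) -> _]eq_bigl do rewrite andbC.
  rewrite !mulrDr; lra.
have := tail_gap3 R.
have : 3%:R / l%:R <= 1 :> R by rewrite ler_pdivrMr; lra.
have : 3%:R / a%:R <= 3%:R / 2%:R :> R by rewrite ler_pdivrMr; lra.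
move: tot P0 A2 LA.
lra.
Qed.
End MinNumeratorGt1Concl.

(** * The spectral inequalities when the least numerator is 1 *)

Section PowersOfTwo.
Variable R : realFieldType.

Lemma sum_pow2_inv (P : pred nat) (I : seq nat) : uniq I ->
  {in I, forall q, P q -> (1 < q)%N /\ exists k, q = (2 ^ k)%N} ->
  \sum_(q <- I | P q) 1 / q%:R <= 1 :> R.
Proof.
move=> uI IP.
pose n := \max_(q <- I) q.
apply: (@le_trans _ _ (\sum_(q <- [seq (2 ^ k.+1)%N | k <- index_iota 0 n]) 1 / q%:R)).
  apply: ler_sum_sub => // [q qI Pq|q _]; last by rewrite divr_ge0.
  have [q1 [[|k] qk]] := IP q qI Pq; first by rewrite qk in q1.
  apply/mapP; exists k => //; rewrite mem_index_iota /=.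
  have qn : (q <= n)%N by rewrite /n (bigD1_seq q) //= leq_maxl.
  by apply: leq_trans qn; rewrite qk; apply: ltnW; apply: ltn_expl.
rewrite big_map (@telescope_sumr_eq _ 0 n (fun k => - 2%:R^-1 ^+ k)) //; last first.
  by move=> k _; rewrite natrX div1r -exprVn exprS; lra.
by rewrite expr0; have : 0 <= 2%:R^-1 ^+ n :> R; [rewrite exprn_ge0 ?invr_ge0 | lra].
Qed.

Lemma sum_pow2 (P : pred nat) (I : seq nat) n : uniq I ->
  {in I, forall q, P q -> exists2 k, q = (2 ^ k.+1)%N & (k < n)%N} ->
  \sum_(q <- I | P q) q%:R <= (2 ^ n.+1)%:R - 2%:R :> R.
Proof.
move=> uI IP.
apply: (@le_trans _ _ (\sum_(q <- [seq (2 ^ k.+1)%N | k <- index_iota 0 n]) q%:R)).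
  apply: ler_sum_sub => // q qI Pq.
  have [k qk kn] := IP q qI Pq.
  by apply/mapP; exists k; rewrite ?mem_index_iota.
rewrite big_map (@telescope_sumr_eq _ 0 n (fun k => (2 ^ k.+1)%:R)) //.
by move=> k _; rewrite (expnS 2 k.+1) natrM; lra.
Qed.

End PowersOfTwo.

Lemma pow2_or_odd_part l : (0 < l)%N -> ~ (exists k, l = (2 ^ k)%N) ->
  exists v k, [/\ l = (2 ^ v * k)%N, (2 < k)%N & odd k].
Proof.
move=> l0 nl; have [k ok lE] := pfactor_coprime (isT : prime 2) l0.
rewrite coprime2n in ok; exists (logn 2 l), k; split=> //; first by rewrite mulnC.
case: k ok lE => [|[|k]] //; last by case: k.
move=> _ lE.
by case: nl; exists (logn 2 l); rewrite {1}lE mul1n.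
Qed.

(** * Winding numbers relative to 1 and to [l] *)

Section Tight.
Variables (R : realFieldType) (p : nat) (I : seq nat) (J : nat -> nat -> nat).
Hypothesis H : spectral_system R p I J.
Hypotheses (oneI : 1%N \in I).

Let mI q : q \in I -> [/\ (0 < q)%N, (3 * q < p)%N & coprime q p].
Proof. by case: H => _ _ + _ _; apply. Qed.
Let rI l q : l \in I -> q \in I -> l != q -> residue_dist p l q (J l q).
Proof. by case: H => _ _ _ + _; apply. Qed.

(* [1 / q] modulo [p] has winding number 1: this makes [rho p (J 1 q)] as large as possible *)
Definition tight q := (J 1 q * q == p + 1)%N || (J 1 q * q + 1 == p)%N.

Lemma tightP q : tight q -> (q %| p + 1)%N \/ (q %| p - 1)%N.
Proof.
move=> /orP[] /eqP E; first by left; rewrite -E dvdn_mull.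
by right; rewrite -E addnK dvdn_mull.
Qed.

Lemma tight1 q n : q \in I -> q != 1%N -> winding p 1 q (J 1 q) n -> (0 < n)%N.
Proof.
move=> qI q1; case: n => // w; have [j0 _ _] := rI oneI qI ltac:(by rewrite eq_sym).
by have [q0 _ _] := mI qI; move/eqP: q1; move: w j0 q0; rewrite /winding; clear; nia.
Qed.

Lemma not_tight q n : q \in I -> q != 1%N -> ~~ tight q ->
  winding p 1 q (J 1 q) n -> (1 < n)%N.
Proof.
move=> qI q1 nt w; have := tight1 qI q1 w.
case: n w => [|[|n]] // [] w _; rewrite mul1n in w; case/negP: nt; apply/orP.
  by left; apply/eqP.
by right; apply/eqP.
Qed.

(** [2 j <= p] and [n p <= j q + 1] with [n >= 2] exclude [q <= 3]; if [q = 4], then [p] is odd, so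
    [4 j + 1 < 2 p]. *)
Lemma not_tight_gt4 q : q \in I -> q != 1%N -> ~~ tight q -> (4 < q)%N.
Proof.
move=> qI q1 nt; have [j0 jp [n w]] := rI oneI qI ltac:(by rewrite eq_sym).
have n2 := not_tight qI q1 nt w; have [q0 q3 qp] := mI qI.
case: (eqVneq q 4%N) => [q4|/eqP q4]; last by move: w n2 jp q4 q3; rewrite /winding; clear; nia.
have op : odd p by move: qp; rewrite q4 (_ : 4 = 2 ^ 2)%N // coprime_pexpl // coprime2n.
have pE : p = (p./2 * 2 + 1)%N by rewrite -[LHS]odd_double_half op muln2 addnC.
by move: w n2 jp; rewrite q4 /winding pE; move: (J 1 4) p./2; clear; nia.
Qed.

Variable l : nat.
Hypotheses (lI : l \in I) (l1 : (1 < l)%N).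
Let l3 : (3 * l < p)%N. Proof. by case: (mI lI). Qed.
Let p1 : (1 < p)%N. Proof. by move: l3 l1; clear; lia. Qed.

Lemma above_l_gt0 q n : q \in I -> (l < q)%N -> winding p l q (J l q) n -> (0 < n)%N.
Proof.
move=> qI lq; have lnq : l != q by move: lq; clear; lia.
have [j0 _ _] := rI lI qI lnq.
by case: n => // w; move: w j0 lq l1; rewrite /winding; clear; nia.
Qed.

(** [q] divides [l + n] or [l - n] and exceeds [l]; for [n < l] this leaves only [q = l + n]. *)
Lemma tight_above q n : q \in I -> (l < q)%N -> tight q -> winding p l q (J l q) n ->
  (l <= n)%N \/ q = (l + n)%N.
Proof.
move=> qI lq tq w; have n0 := above_l_gt0 qI lq w.
case: (leqP l n) => [|nl]; [by left|right].
case: (winding_dvdn p1 (tightP tq) w); rewrite muln1 => /dvdnP[[|[|k]]].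
- by move: n0; clear; lia.
- by rewrite mul1n => ->.
- by move: nl lq; clear; nia.
- by move: nl; clear; lia.
- by move: nl lq n0; clear; lia.
- by move: nl lq n0; clear; nia.
Qed.

(** A power of 2 not dividing [l] is a multiple of [2 ^ v]; as it divides [l + n] or [l - n], [n] is
    one too. *)
Lemma tight_below v k q n : l = (2 ^ v * k)%N -> odd k -> q \in I -> (q < l)%N -> tight q ->
  (exists i, q = (2 ^ i)%N) -> ~~ (q %| l)%N -> winding p l q (J l q) n -> (2 ^ v <= n)%N.
Proof.
move=> lE ok qI ql tq [i qi] nd w.
have n0 : (0 < n)%N.
  case: n w => // -[] w; last by move: w l1; clear; lia.
  by case/negP: nd; rewrite -[l]add0n -[0%N](mul0n p) -w dvdn_mull.
have vi : (v <= i)%N.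
  by rewrite leqNgt; apply: contra nd => iv; rewrite qi lE dvdn_mulr // dvdn_exp2l // ltnW.
have vq : (2 ^ v %| q)%N by rewrite qi dvdn_exp2l.
have vl : (2 ^ v %| l)%N by rewrite lE dvdn_mulr.
apply: dvdn_leq => //; case: (winding_dvdn p1 (tightP tq) w); rewrite muln1 => d.
  by have := dvdn_trans vq d; rewrite dvdn_addr.
have := dvdn_trans vq d; rewrite -[(_ %| `|_|)%N]/((2 ^ v)%:Z %| l%:Z - n%:Z)%Z.
by rewrite rpredBl.
Qed.

(** Write [s] and [t] for the distances: [s l] and [t q] are within 1 of [p], and [s >= t + 1];
    compare [(t + 1) q l] with [s l q]. For [q = l + N] this bounds [l ^ 2] by about [N p], which
    limits the surcharges when [l] is large. *)
Lemma tight_pair q : q \in I -> (l < q)%N -> tight l -> tight q ->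
  ((l - 2) * q <= (q - l) * (p + 1))%N.
Proof.
move=> qI lq tl tq; have [_ q3 _] := mI qI; move: tl tq l3 q3 lq l1.
rewrite /tight; move: (J 1 l) (J 1 q); clear.
move=> s t tl tq l3 q3 lq l1.
have {}tl : (p - 1 <= s * l <= p + 1)%N by move: tl; clear; lia.
have {}tq : (p - 1 <= t * q <= p + 1)%N by move: tq; clear; lia.
have ts : (t < s)%N.
  rewrite ltnNge; apply/negP => st.
  have : (s * l.+1 <= t * q)%N by apply: leq_mul.
  rewrite mulnS; move: tl tq => /andP[tl _] /andP[_ tq] st'.
  have s2 : (s <= 2)%N by move: tl tq st' l3 l1; clear; lia.
  have : (s * l <= 2 * l)%N by rewrite leq_mul2r s2 orbT.
  move: tl l3 l1; clear; lia.
have h1 : (t.+1 * q * l <= s * l * q)%N by rewrite mulnAC !leq_mul2r ts !orbT.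
have h2 : (s * l * q <= (p + 1) * q)%N.
  by rewrite leq_mul2r; apply/orP; right; move: tl; clear; lia.
have h3 : ((p - 1) * l <= t * q * l)%N.
  by rewrite leq_mul2r; apply/orP; right; move: tq; clear; lia.
have h4 : (q * l + (p - 1) * l <= (p + 1) * q)%N.
  by apply: leq_trans h2; apply: leq_trans h1; rewrite mulSn mulnDl leq_add2l.
have h5 : (l * (p + 1) <= q * (p + 1))%N by rewrite leq_mul2r ltnW // orbT.
move: h4 h5 lq l1; rewrite !mulnBl mul1n; clear; lia.
Qed.

End Tight.

(** * Cost of one letter when the least numerator is 1 *)

Section LetterBounds.
Variables (R : realFieldType) (p : nat) (I : seq nat) (J : nat -> nat -> nat).
Hypothesis H : spectral_system R p I J.
Hypotheses (oneI : 1%N \in I).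
Variable l : nat.
Hypotheses (lI : l \in I) (l2 : (2 < l)%N).

Let mI q : q \in I -> [/\ (0 < q)%N, (3 * q < p)%N & coprime q p].
Proof. by case: H => _ _ + _ _; apply. Qed.
Let rI x q : x \in I -> q \in I -> x != q -> residue_dist p x q (J x q).
Proof. by case: H => _ _ _ + _; apply. Qed.
Let l3 : (3 * l < p)%N. Proof. by case: (mI lI). Qed.
Let l1 : (1 < l)%N. Proof. exact: ltnW. Qed.

Let P : R := p%:R.
Definition slack q : R := 4%:R * (P * rho R p (J 1 q)) - 4%:R * (q%:R * (P / (P - 1))).
(* The combination [4 F_1 + F_l] of the two spectral inequalities is compared with the budget
   [4 q p / (p - 1)] of each letter, whose total is at most [4 p] *)
Definition excess q : R := slack q + P * rho R p (J l q).

Let P9 : 9%:R <= P. Proof. by rewrite ler_nat; move: l3 l2; clear; lia. Qed.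
Let L3 : 3%:R * l%:R <= P. Proof. by rewrite -natrM ler_nat ltnW. Qed.
Let L0 : 3%:R <= l%:R :> R. Proof. by rewrite ler_nat. Qed.

Lemma slack_le q : q \in I -> q != 1%N -> slack q <= 12%:R / q%:R.
Proof.
move=> qI q1; have [q0 _ _] := mI qI.
have p1 : (1 < p)%N by move: l3 l2; clear; lia.
have := residue_bound R (rI oneI qI ltac:(by rewrite eq_sym)) q0 (ltn0Sn 0) p1
  (fun n => tight1 H oneI (n := n) qI q1).
rewrite mul1r mulr1 -/P /slack => h.
have -> : 12%:R / q%:R = 4%:R * (3%:R / q%:R) :> R by rewrite mulrA -natrM.
by move: h; move: (P / (P - 1)) (3%:R / q%:R) => x y h; lra.
Qed.

(** Winding number at least 2 halves the cost and leaves half of the budget [4 q] unspent. *)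
Lemma slack_far q : q \in I -> q != 1%N -> ~~ tight p J q ->
  slack q <= 24%:R / q%:R - 2%:R * q%:R.
Proof.
move=> qI q1 nt; have [q0 _ _] := mI qI.
have p1 : (1 < p)%N by move: l3 l2; clear; lia.
have := residue_bound R (rI oneI qI ltac:(by rewrite eq_sym)) q0 (ltn0Sn 1) p1
  (fun n => not_tight H oneI (n := n) qI q1 nt).
rewrite -/P /slack => h.
have -> : 24%:R / q%:R = 4%:R * (3%:R * 2%:R / q%:R) :> R by rewrite -!natrM mulrA -natrM.
have h1 : 2%:R * (P / (2%:R * P - 1)) + 1 <= 2%:R * (P / (P - 1)).
  move: P9 => P9'; have a1 : 0 < 2%:R * P - 1 by lra.
  have a2 : 0 < P - 1 by lra.
  have : P / (2%:R * P - 1) <= 1 / 2%:R + 1 / (P - 1).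
    rewrite ler_pdivrMr //.
    have -> : (1 / 2%:R + 1 / (P - 1)) * (2%:R * P - 1) =
        P - 1 / 2%:R + (2%:R * P - 1) / (P - 1) by field; rewrite lt0r_neq0.
    have : 1 <= (2%:R * P - 1) / (P - 1) by rewrite ler_pdivlMr //; lra.
    by move=> *; lra.
  have -> : P / (P - 1) = 1 + 1 / (P - 1) by field; rewrite lt0r_neq0.
  move=> *; lra.
have Q0 : 0 <= q%:R :> R by rewrite ler0n.
by have := ler_wpM2l Q0 h1; move: h; move: (P / (2%:R * P - 1)) (P / (P - 1)) (3%:R * 2%:R / q%:R) => x y z h *; lra.
Qed.

(** A tight letter [q < l + m] may have winding number [q - l < m]; this is its cost beyond the rate
    [3 / (3 m - 1)] of winding number [m]. The rates come from [p / (n p - l)] with [l <= p / 3]. *)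
Definition surcharge m q : R :=
  if tight p J q && (q < l + m)%N then (3%:R / (3%:R * (q - l)%:R - 1) - 3%:R / (3%:R * m%:R - 1)) * q%:R
  else 0.

Let coef_le n : (0 < n)%N -> P / (n%:R * P - l%:R) <= 3%:R / (3%:R * n%:R - 1).
Proof.
move=> n0; have N1 : 1 <= n%:R :> R by rewrite ler1n.
move: P9 L3 => P9' L3'; have h : P <= n%:R * P by rewrite ler_peMl //; lra.
have a1 : 0 < n%:R * P - l%:R by lra.
have a2 : 0 < 3%:R * n%:R - 1 :> R by lra.
rewrite ler_pdivrMr // mulrAC ler_pdivlMr //; lra.
Qed.

Let bB n q : q \in I -> q != l -> (0 < n)%N ->
  (forall n', winding p l q (J l q) n' -> (n <= n')%N) ->
  P * rho R p (J l q) <= q%:R * (3%:R / (3%:R * n%:R - 1)) + 3%:R * n%:R / q%:R.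
Proof.
move=> qI ql n0 nn; have [q0 _ _] := mI qI.
have lp : (l < p)%N by move: l3; clear; lia.
apply: le_trans (residue_bound R (rI lI qI ltac:(by rewrite eq_sym)) q0 n0 lp nn) _.
by rewrite lerD2r ler_wpM2l ?ler0n // coef_le.
Qed.

(** A letter that is not tight saves [2 q] in the inequality of 1, more than the [3 q / 2] it may
    cost in that of [l]; a tight one has winding number at least [m] or pays the surcharge. *)
Lemma excess_above m q : (2 < m)%N -> (m <= 5)%N -> (m <= l)%N -> q \in I -> (l < q)%N ->
  excess q <= 3%:R / (3%:R * m%:R - 1) * q%:R + (12%:R + 3%:R * m%:R) * (1 / q%:R) + surcharge m q.
Proof.
move=> m2 m5 ml qI lq; have [q0 _ _] := mI qI.
have q1 : q != 1%N by move: lq l1; clear; lia.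
have ql : q != l by move: lq; clear; lia.
have Q0 : 0 < q%:R^-1 :> R by rewrite invr_gt0 ltr0n.
have M3 : 3%:R <= m%:R :> R by rewrite ler_nat.
have M5 : m%:R <= 5%:R :> R by rewrite ler_nat.
have Q4 : 4%:R <= q%:R :> R by rewrite ler_nat; move: lq l2; clear; lia.
rewrite div1r.
have rm : 3%:R / 14%:R <= 3%:R / (3%:R * m%:R - 1) :> R.
  by rewrite ler_wpM2l // lef_pV2 ?posrE //; lra.
case: (boolP (tight p J q)) => tq; last first.
  rewrite /surcharge (negbTE tq) addr0 /excess.
  have := slack_far qI q1 tq.
  have := @bB 1 q qI ql isT (fun n => above_l_gt0 H lI l1 qI lq (n := n)).
  rewrite (_ : 3%:R / (3%:R * 1%:R - 1) = 3%:R / 2%:R :> R) => [b s|]; last by congr (_ / _); lra.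
  have c1 : 24%:R * q%:R^-1 <= 24%:R / 16%:R * q%:R :> R.
    by rewrite ler_pdivrMr ?ltr0n //; nra.
  have : 3%:R / 14%:R * q%:R <= 3%:R / (3%:R * m%:R - 1) * q%:R :> R by rewrite ler_wpM2r.
  have : 9%:R * q%:R^-1 <= 3%:R * m%:R * q%:R^-1 :> R by rewrite ler_wpM2r ?(ltW Q0) //; lra.
  move: b s c1 Q0 Q4; move: (q%:R^-1) (3%:R / (_ - 1) * _) => x y; lra.
have := slack_le qI q1; rewrite /excess => s.
case: (ltnP q (l + m)) => qlm.
  rewrite /surcharge tq qlm /=.
  have ql0 : (0 < q - l)%N by rewrite subn_gt0.
  have nn n : winding p l q (J l q) n -> (q - l <= n)%N.
    move=> w; case: (tight_above H lI l1 qI lq tq w); move: qlm ml; clear; lia.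
  have := @bB (q - l) q qI ql ql0 nn.
  have : (q - l)%:R <= m%:R :> R by rewrite ler_nat; move: qlm; clear; lia.
  move=> h b.
  have : (q - l)%:R * q%:R^-1 <= m%:R * q%:R^-1 :> R by rewrite ler_wpM2r ?(ltW Q0).
  move: s b; move: (_ / (_ - 1)) (_ / (_ - 1)) (q%:R^-1) => x y z; lra.
rewrite /surcharge ltnNge qlm andbF addr0.
have nn n : winding p l q (J l q) n -> (m <= n)%N.
  move=> w; case: (tight_above H lI l1 qI lq tq w); move: qlm ml; clear; lia.
have := @bB m q qI ql ltac:(by apply: ltn_trans m2) nn.
move: s; move: (_ / (_ - 1)) (q%:R^-1) => x y; lra.
Qed.

(** [q] divides [n p], hence [n]; so [j] differs by [l / q] from a multiple of [p], and [2 j <= p]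
    makes that multiple 0. *)
Lemma residue_of_divisor q : q \in I -> q != l -> (q %| l)%N -> (J l q * q = l)%N.
Proof.
move=> qI ql /dvdnP[x lx]; have [q0 q3 qp] := mI qI.
have [j0 jp [n w]] := rI lI qI ltac:(by rewrite eq_sym).
have : (q %| n * p)%N.
  case: w => w; first by rewrite -(dvdn_addl (n * p) (_ : q %| l)%N) -?w ?lx dvdn_mull.
  by rewrite -w dvdn_add // ?lx dvdn_mull.
rewrite Gauss_dvdl // => /dvdnP[y ny].
have xp : (3 * x < p)%N by move: lx l3 q0; clear; nia.
case: (posnP y) => y0.
  by rewrite ny y0 in w; move: w; rewrite /winding; move: l1; clear; lia.
have : (J l q = y * p + x \/ J l q + x = y * p)%N.
  by case: w => w; [left|right]; apply/eqP; rewrite -(eqn_pmul2r q0) ?mulnDl -lx w ny mulnAC.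
by move: jp xp j0 y0; clear; nia.
Qed.

Lemma excess_divisor q : q \in I -> q != 1%N -> q != l -> (q %| l)%N ->
  excess q <= q%:R * (P / l%:R) + 13%:R * (1 / q%:R).
Proof.
move=> qI q1 ql qdl; have [q0 _ _] := mI qI; have := slack_le qI q1.
have [j0 _ _] := rI lI qI ltac:(by rewrite eq_sym).
have := rho_bound0 R q0 l3 (residue_of_divisor qI ql qdl) j0.
rewrite /excess div1r.
move: (q%:R^-1) (q%:R * _) => x y; lra.
Qed.

Lemma rho_one_le : P * rho R p (J l 1) <= P / l%:R + 1.
Proof.
have l1' : 1%N != l by move: l1; clear; lia.
have [j0 _ _] := rI lI oneI ltac:(by rewrite eq_sym).
have := rho_bound0 R (ltn0Sn 0) l3 (residue_of_divisor oneI l1' (dvd1n l)) j0.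
by rewrite !mul1r invr1.
Qed.

Lemma excess_nondivisor v k m q : l = (2 ^ v * k)%N -> odd k -> (0 < m)%N -> (m <= 2 ^ v)%N ->
  q \in I -> (q < l)%N -> (exists i, q = (2 ^ i)%N) -> ~~ (q %| l)%N ->
  excess q <= (12%:R + 3%:R * m%:R) * (1 / q%:R) + q%:R * (3%:R / (3%:R * m%:R - 1)).
Proof.
move=> lE ok m0 mv qI ql qi nd; have [q0 _ _] := mI qI.
have q1 : q != 1%N by apply: contraNneq nd => ->.
have qnl : q != l by move: ql; clear; lia.
have Q0 : 0 < q%:R^-1 :> R by rewrite invr_gt0 ltr0n.
have M1 : 1 <= m%:R :> R by rewrite ler1n.
have Q0' : 0 <= q%:R :> R by rewrite ler0n.
rewrite div1r.
case: (boolP (tight p J q)) => tq.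
  have nn n : winding p l q (J l q) n -> (m <= n)%N.
    by move=> w; apply: leq_trans mv _; apply: (tight_below H lI l1 lE ok qI ql tq qi nd w).
  have := bB qI qnl m0 nn; have := slack_le qI q1; rewrite /excess.
  move: (_ / (_ - 1)) (q%:R^-1) => x y; lra.
have nn n : winding p l q (J l q) n -> (1 <= n)%N.
  case: n => // -[] w; last by move: w l1; clear; lia.
  by case/negP: nd; rewrite -[l]add0n -[0%N](mul0n p) -w dvdn_mull.
have := @bB 1 q qI qnl isT nn; have := slack_far qI q1 tq; rewrite /excess.
have -> : 3%:R / (3%:R * 1%:R - 1) = 3%:R / 2%:R :> R by congr (_ / _); lra.
(* After the cost [3 q / 2] a saving of [q / 2] is left; for [q >= 5] it covers [12 / q]. *)
have Q5 : 5%:R <= q%:R :> R by rewrite ler_nat (not_tight_gt4 H oneI qI q1 tq).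
have c1 : 24%:R * q%:R^-1 <= q%:R :> R.
  by rewrite ler_pdivrMr ?ltr0n //; nra.
have : 0 <= q%:R * (3%:R / (3%:R * m%:R - 1)) :> R by rewrite mulr_ge0 // divr_ge0 //; lra.
have : 3%:R * q%:R^-1 <= 3%:R * m%:R * q%:R^-1 :> R by rewrite ler_wpM2r ?(ltW Q0) //; lra.
move: c1; move: (q%:R * _ ) (q%:R^-1) => y x; lra.
Qed.

End LetterBounds.

(** * The weighted sum of the two inequalities over all letters *)

Section Totals.
Variables (R : realFieldType) (p : nat) (I : seq nat) (J : nat -> nat -> nat).
Hypothesis H : spectral_system R p I J.
Hypotheses (oneI : 1%N \in I).
Variable l : nat.
Hypotheses (lI : l \in I) (l2 : (2 < l)%N).

Let uI : uniq I. Proof. by case: H. Qed.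
Let mI q : q \in I -> [/\ (0 < q)%N, (3 * q < p)%N & coprime q p].
Proof. by case: H => _ _ + _ _; apply. Qed.
Let sI x : x \in I -> 1 <= \sum_(q <- I | q != x) rho R p (J x q).
Proof. by case: H => _ _ _ _; apply. Qed.
Let massI : \sum_(q <- I) q%:R <= p%:R :> R.
Proof. by case: H => _ + _ _ _; rewrite -natr_sum ler_nat. Qed.
Let l3 : (3 * l < p)%N. Proof. by case: (mI lI). Qed.
Let l1 : (1 < l)%N. Proof. exact: ltnW. Qed.
Let oneNl : 1%N != l. Proof. by move: l1; clear; lia. Qed.

Let P : R := p%:R.
Let P9 : 9%:R <= P. Proof. by rewrite ler_nat; move: l3 l2; clear; lia. Qed.

(** The letters other than 1 have mass at most [p - 1], so their budgets total at most [4 p], and 4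
    times the inequality of 1 says that the slacks have a nonnegative sum. The inequality of [l] is
    added to this. *)
Lemma two_letter_sum : P <= P * rho R p (J l 1) + slack R p J l +
  \sum_(q <- I | (q != 1%N) && (q != l)) excess R p J l q.
Proof.
move: P9 => P9'; have P1 : 0 < P - 1 by lra.
have F1 : P <= P * \sum_(q <- I | q != 1%N) rho R p (J 1 q) by rewrite ler_peMr ?sI //; lra.
have Fl : P <= P * \sum_(q <- I | q != l) rho R p (J l q) by rewrite ler_peMr ?sI //; lra.
have M : \sum_(q <- I | q != 1%N) 4%:R * (q%:R * (P / (P - 1))) <= 4%:R * P.
  rewrite -mulr_sumr -mulr_suml ler_pM2l //.
  have : \sum_(q <- I | q != 1%N) q%:R <= P - 1.
    by have := massI; rewrite (big_seqD1 _ uI oneI) //= -/P; lra.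
  have c0 : 0 <= P / (P - 1) by rewrite divr_ge0; lra.
  by move/(ler_wpM2r c0); rewrite [leRHS]mulrCA divff ?mulr1 ?lt0r_neq0.
have S1 : P <= \sum_(q <- I | q != 1%N) slack R p J q + P.
  move: F1 M; rewrite /slack sumrB -/P -[X in _ <= X - _ + _]mulr_sumr -[X in _ <= _ * X - _ + _]mulr_sumr; lra.
move: S1 Fl.
rewrite (big_seqD1 _ uI lI) 1?eq_sym // (big_seqD1 (P := fun q => q != l) _ uI oneI) //.
under [X in _ -> _ <= _ * (_ + X) -> _]eq_bigl do rewrite andbC.
have -> : \sum_(q <- I | (q != 1%N) && (q != l)) excess R p J l q =
    \sum_(q <- I | (q != 1%N) && (q != l)) slack R p J q +
    P * \sum_(q <- I | (q != 1%N) && (q != l)) rho R p (J l q).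
  by rewrite mulr_sumr -big_split.
by rewrite mulrDr; move: (P * _) (P * \sum_(_ <- _ | _) _) => x y; lra.
Qed.

Let below := fun q => (q != 1%N) && (q < l)%N.
Let above := fun q => (l < q)%N.

Lemma mass_split :
  1 + l%:R + \sum_(q <- I | below q) q%:R + \sum_(q <- I | above q) q%:R <= P.
Proof.
apply: le_trans massI; rewrite [leRHS](big_seqD1 _ uI oneI) //= [X in _ <= _ + X](big_seqD1 _ uI lI) 1?eq_sym //.
rewrite [X in _ <= _ + (_ + X)](bigID (fun q => (q < l)%N)) /= -!addrA lerD2l lerD2l lerD //.
  rewrite le_eqVlt; apply/orP; left; apply/eqP; apply: eq_bigl => q; rewrite /below; move: l1; clear; lia.
by rewrite le_eqVlt; apply/orP; left; apply/eqP; apply: eq_bigl => q; rewrite /above; move: l1; clear; lia.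
Qed.

Lemma excess_split : \sum_(q <- I | (q != 1%N) && (q != l)) excess R p J l q =
  \sum_(q <- I | below q) excess R p J l q + \sum_(q <- I | above q) excess R p J l q.
Proof.
rewrite (bigID (fun q => (q < l)%N) (fun q => (q != 1%N) && (q != l))) /=; congr (_ + _).
  by apply: eq_bigl => q; rewrite /below; move: l1; clear; lia.
by apply: eq_bigl => q; rewrite /above; move: l1; clear; lia.
Qed.

Definition special N := tight p J (l + N) && ((l + N)%N \in I).

Definition surplus m : R := \sum_(1 <= N < m) if special N then
  (3%:R / (3%:R * N%:R - 1) - 3%:R / (3%:R * m%:R - 1)) * (l + N)%:R else 0.

Let coef_ge0 N m : (0 < N)%N -> (N < m)%N ->
  0 <= 3%:R / (3%:R * N%:R - 1) - 3%:R / (3%:R * m%:R - 1) :> R.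
Proof.
move=> N0 Nm; have N1 : 1 <= N%:R :> R by rewrite ler1n.
have NM : N%:R <= m%:R :> R by rewrite ler_nat ltnW.
by rewrite subr_ge0 ler_wpM2l // lef_pV2 ?posrE //; lra.
Qed.

Lemma sum_surcharge m : \sum_(q <- I | above q) surcharge R p J l m q <= surplus m.
Proof.
apply: (@le_trans _ _ (\sum_(q <- I | above q) \sum_(1 <= N < m)
   (if q == (l + N)%N then if special N then
  (3%:R / (3%:R * N%:R - 1) - 3%:R / (3%:R * m%:R - 1)) * (l + N)%:R else 0 else 0))).
  rewrite big_seq_cond [leRHS]big_seq_cond; apply: ler_sum => q /andP[qI lq].
  rewrite /surcharge; case: ifP => [/andP[tq qm]|_].
    rewrite (bigD1_seq (q - l)%N) ?iota_uniq ?mem_index_iota //=; last first.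
      by move: qm lq; rewrite /above; clear; lia.
    have qE : q = (l + (q - l))%N by move: lq; rewrite /above; clear; lia.
    rewrite -qE eqxx {1}/special -qE tq qI lerDl.
    rewrite big_seq_cond sumr_ge0 // => N; rewrite mem_index_iota => /andP[/andP[N0 Nm] _].
    by case: ifP => // _; case: ifP => // _; rewrite mulr_ge0 ?coef_ge0.
  rewrite big_seq_cond sumr_ge0 // => N; rewrite mem_index_iota => /andP[/andP[N0 Nm] _].
  by case: ifP => // _; case: ifP => // _; rewrite mulr_ge0 ?coef_ge0.
rewrite exchange_big /= /surplus big_seq_cond [leRHS]big_seq_cond.
apply: ler_sum => N; rewrite mem_index_iota => /andP[/andP[N0 Nm] _].
apply: sum_pred1_le => //.
by case: ifP => // _; rewrite mulr_ge0 ?coef_ge0.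
Qed.

(** [M] is the mass of the letters above [l]. An upper bound on it is enough, since the right-hand
    side increases with [M]; [P / l + 1] pays for the letter 1. *)
Lemma master m : (2 < m)%N -> (m <= 5)%N -> (m <= l)%N ->
  exists2 M : R, P - 1 - l%:R - \sum_(q <- I | below q) q%:R >= M &
  P <= P / l%:R + 1 + slack R p J l + \sum_(q <- I | below q) excess R p J l q +
    (3%:R / (3%:R * m%:R - 1) * M + (12%:R + 3%:R * m%:R) * (tail_gap R l + M / 625%:R) + surplus m).
Proof.
move=> m2 m5 ml; exists (\sum_(q <- I | above q) q%:R).
  by have := mass_split; move: (\sum_(_ <- _ | _) _) (\sum_(_ <- _ | _) _) => x y; lra.
apply: le_trans two_letter_sum _; rewrite excess_split.
have := rho_one_le H oneI lI l2; rewrite -/P.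
suff : \sum_(q <- I | above q) excess R p J l q <=
  3%:R / (3%:R * m%:R - 1) * (\sum_(q <- I | above q) q%:R) +
  (12%:R + 3%:R * m%:R) * (tail_gap R l + (\sum_(q <- I | above q) q%:R) / 625%:R) + surplus m.
  by move: (\sum_(q <- I | above q) excess _ _ _ _ _) (\sum_(q <- I | below q) _) => x y; lra.
apply: (@le_trans _ _ (\sum_(q <- I | above q)
   (3%:R / (3%:R * m%:R - 1) * q%:R + (12%:R + 3%:R * m%:R) * (1 / q%:R) + surcharge R p J l m q))).
  rewrite big_seq_cond [leRHS]big_seq_cond; apply: ler_sum => q /andP[qI lq].
  exact (excess_above H oneI lI l2 m2 m5 ml qI lq).
rewrite !big_split /= -[X in X + _ + _ <= _]mulr_sumr -[X in _ + X + _ <= _]mulr_sumr; apply: lerD; last exact: sum_surcharge.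
rewrite lerD2l ler_wpM2l //; first by rewrite addr_ge0 // mulr_ge0.
by apply: (@sum_inv_le R l above I uI).
Qed.

End Totals.

Section TailGapValues.
Variable R : realFieldType.

Lemma tail_gap5 : tail_gap R 5 <= 104%:R / 100%:R.
Proof. by rewrite /tail_gap unlock /=; lra. Qed.
Lemma tail_gap6 : tail_gap R 6 <= 89%:R / 100%:R.
Proof. by rewrite /tail_gap unlock /=; lra. Qed.
Lemma tail_gap10 : tail_gap R 10 <= 46%:R / 100%:R.
Proof. by rewrite /tail_gap unlock /=; lra. Qed.
Lemma tail_gap12 : tail_gap R 12 <= 32%:R / 100%:R.
Proof. by rewrite /tail_gap unlock /=; lra. Qed.
Lemma tail_gap24 : tail_gap R 24 <= 0.
Proof. by rewrite /tail_gap unlock /=; lra. Qed.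
End TailGapValues.

(** * Numerical contradictions for the three shapes of [l] *)

Section Endgame.
Variable R : realFieldType.
Implicit Types (P L y x M tg s e c Q : R).

(* convexity of [y = P / L] between the endpoints [L = 5] and [c L = Q] *)
Lemma quotient_chord P L y c Q : 0 <= P -> P <= Q -> y * L = P -> 5%:R <= L -> c * L <= Q ->
  5%:R * y <= Q + 5%:R * c - c * L.
Proof.
move=> P0 PQ yL L5 cL; have L0 : 0 < L by lra.
rewrite -(ler_pM2r L0) -mulrA yL.
have : 0 <= (L - 5%:R) * (Q - c * L) by rewrite mulr_ge0; lra.
lra.
Qed.

(** [x] is the mass of the powers of 2 below [l], [tg] the tail gap, [s] the surplus and [e] the
    slack of [l]. As real unknowns they leave linear arithmetic once the products involving [L] are
    bounded. *)
Lemma endgame_odd P L y x M tg s e : 360%:R <= P -> 3%:R * L <= P -> y * L = P -> 0 <= x ->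
  M <= P - 1 - L - x -> 3%:R <= L ->
  P <= y + 1 + e + (15%:R + 3%:R / 2%:R * x) +
    (3%:R / 8%:R * M + 21%:R * (tg + M / 625%:R) + s) ->
  x <= 2%:R * L - 4%:R ->
  (L = 3%:R /\ tg <= 1474%:R / 1000%:R \/ 5%:R <= L /\ tg <= 104%:R / 100%:R) ->
  s <= 9%:R / 8%:R * (L + 1) + 9%:R / 40%:R * (L + 2%:R) ->
  (e <= 8%:R - 2%:R * L \/
   [/\ e <= 4%:R, s <= 0 \/ (L - 2%:R) * (L + 2%:R) <= 2%:R * (P + 1) &
       x = 0 \/ 4%:R * L <= P + 1]) -> False.
Proof.
move=> P360 LP yL x0 MP L3 main xL Lc sL ec.
case: Lc => -[Lc tgc].
  have y3 : 3%:R * y = P by rewrite -yL Lc; ring.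
  have e4 : e <= 4%:R by case: ec => [|[]]; rewrite Lc; lra.
  rewrite Lc in xL sL MP; lra.
have P0 : 0 <= P by lra.
have y1 := quotient_chord P0 (lexx P) yL Lc LP.
case: ec => [e2|[e4 sc xc]]; first lra.
case: sc => [s0|sc].
  case: xc => [xE|xc]; first by rewrite xE in main MP; lra.
  have PQ : P <= P + 1 by lra.
  have y2 := quotient_chord P0 PQ yL Lc xc; lra.
(* Tangent to [L ^ 2] at 27: for [P = 360] the bound [L ^ 2 <= 2 P + 6] is 726, close to
   [27 ^ 2]. *)
have : 0 <= (L - 27%:R) ^+ 2 by apply: sqr_ge0.
rewrite expr2 => sq; lra.
Qed.

(** The divisors of [l] cost [(2 L / k - 2) y], which is at most [2 P / 5 - 2 y] for [k >= 5]. *)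
Lemma endgame_even P L y x M tg s e : 360%:R <= P -> 3%:R * L <= P -> y * L = P -> 0 <= x ->
  M <= P - 1 - L - x -> 10%:R <= L ->
  P <= y + 1 + e + (18%:R + (2%:R / 5%:R * P - 2%:R * y) + 3%:R / 5%:R * x) +
    (3%:R / 8%:R * M + 21%:R * (tg + M / 625%:R) + s) ->
  x <= 2%:R * L - 4%:R -> tg <= 46%:R / 100%:R ->
  s <= 9%:R / 8%:R * (L + 1) + 9%:R / 40%:R * (L + 2%:R) ->
  (e <= 24%:R / 10%:R - 2%:R * L \/
   e <= 12%:R / 10%:R /\ (s <= 0 \/ (L - 2%:R) * (L + 2%:R) <= 2%:R * (P + 1))) -> False.
Proof.
move=> P360 LP yL x0 MP L3 main xL tgc sL ec.
have y0 : 0 <= y by nra.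
case: ec => [e2|[e4 [s0|sc]]]; try lra.
have : 0 <= (L - 27%:R) ^+ 2 by apply: sqr_ge0.
rewrite expr2 => sq; lra.
Qed.

(** For [k = 3] the divisors of [l] cost up to [2 P / 3 - 2 y]. The letters above [l] are therefore
    charged only [3 / 14], the rate of [m = 5], at the price of four terms in the surplus. *)
Lemma endgame_three P L y x M tg s e : 360%:R <= P -> 3%:R * L <= P -> y * L = P -> 0 <= x ->
  M <= P - 1 - L - x ->
  P <= y + 1 + e + (13%:R + 39%:R / 10%:R + (2%:R / 3%:R * P - 2%:R * y)) +
    (3%:R / 14%:R * M + 27%:R * (tg + M / 625%:R) + s) ->
  [\/ L = 6%:R /\ tg <= 89%:R / 100%:R, L = 12%:R /\ tg <= 32%:R / 100%:R,
      L = 24%:R /\ tg <= 0 | 48%:R <= L /\ tg <= 0] ->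
  s <= 9%:R / 7%:R * (L + 1) + 27%:R / 70%:R * (L + 2%:R) + 9%:R / 56%:R * (L + 3%:R)
     + 9%:R / 154%:R * (L + 4%:R) ->
  (e <= 4%:R - 2%:R * L \/
   e <= 2%:R /\ [\/ s <= 0, (L - 2%:R) * (L + 1) <= P + 1 |
     s <= 27%:R / 70%:R * (L + 2%:R) + 9%:R / 56%:R * (L + 3%:R) + 9%:R / 154%:R * (L + 4%:R) /\
     (L - 2%:R) * (L + 4%:R) <= 4%:R * (P + 1)]) -> False.
Proof.
move=> P360 LP yL x0 MP main Lc sL ec.
have e2 : e <= 2%:R by case: ec => [|[]] // h; case: Lc => -[]; lra.
case: Lc => -[Lc tgc].
- have y6 : 6%:R * y = P by rewrite -yL Lc; ring.
  rewrite Lc in sL MP; lra.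
- have y6 : 12%:R * y = P by rewrite -yL Lc; ring.
  rewrite Lc in sL MP; lra.
- have y6 : 24%:R * y = P by rewrite -yL Lc; ring.
  by case: ec => [|[_ []]]; rewrite Lc in sL MP *; lra.
have y0 : 0 <= y by nra.
have L48 : 48%:R * L <= L * L by rewrite ler_wpM2r; lra.
by case: ec => [|[_ []]]; lra.
Qed.
End Endgame.

(** * The three shapes of [l], for [p >= 360] *)

Section MinNumerator1.
Variables (R : realFieldType) (p : nat) (I : seq nat) (J : nat -> nat -> nat).
Hypothesis H : spectral_system R p I J.
Hypotheses (oneI : 1%N \in I) (p360 : (360 <= p)%N).

Let uI : uniq I. Proof. by case: H. Qed.
Let mI q : q \in I -> [/\ (0 < q)%N, (3 * q < p)%N & coprime q p].
Proof. by case: H => _ _ + _ _; apply. Qed.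
Let P : R := p%:R.
Let P360 : 360%:R <= P. Proof. by rewrite ler_nat. Qed.

Lemma pow2_below (l q : nat) : (q < l)%N -> (exists i, q = (2 ^ i)%N) -> q != 1%N ->
  exists2 i, q = (2 ^ i.+1)%N & (i < trunc_log 2 l.-1)%N.
Proof.
move=> ql [[|i] qi] q1; first by rewrite qi in q1.
exists i => //; apply: trunc_log_max => //; rewrite -qi; move: ql; clear; lia.
Qed.

Lemma sum_pow2_below l (S : pred nat) : (0 < l.-1)%N ->
  {in I, forall q, S q -> [/\ (q < l)%N, exists i, q = (2 ^ i)%N & q != 1%N]} ->
  \sum_(q <- I | S q) q%:R <= 2%:R * l%:R - 4%:R :> R.
Proof.
move=> l0 IS.
apply: (@le_trans _ _ ((2 ^ (trunc_log 2 l.-1).+1)%:R - 2%:R)).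
  by apply: sum_pow2 => // q qI Sq; have [ql qi q1] := IS q qI Sq; apply: pow2_below.
have /andP[tl _] := trunc_log_bounds (isT : (1 < 2)%N) l0.
have : (2 ^ (trunc_log 2 l.-1).+1)%:R <= 2%:R * (l%:R - 1) :> R.
  rewrite expnS natrM ler_pM2l // (_ : l%:R - 1 = l.-1%:R) ?ler_nat //.
  by rewrite -subn1 natrB //; move: l0; clear; lia.
lra.
Qed.

(** Powers of 2 below [p / 3] have total mass at most about [2 p / 3], too little for the inequality
    of 1. *)
Lemma has_nonpow2 : has (fun q => q != 2 ^ trunc_log 2 q)%N I.
Proof.
apply/negP => /negP; rewrite -all_predC => /allP /= pw.
have pw2 q : q \in I -> exists i, q = (2 ^ i)%N.
  by move=> /pw; rewrite negbK => /eqP ->; exists (trunc_log 2 q).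
have [l [l0 lE ql]] : exists l, [/\ (0 < l.-1)%N, (3 * l <= p + 2)%N & forall q, (3 * q < p)%N -> (q < l)%N].
  by exists (p.-1 %/ 3).+1; split; move: p360; clear; lia.
have S2 : \sum_(q <- I | q != 1%N) q%:R <= 2%:R * l%:R - 4%:R :> R.
  apply: sum_pow2_below l0 _ => q qI q1; have [_ q3 _] := mI qI.
  by split=> //; [apply: ql|apply: pw2].
have S1 : \sum_(q <- I | q != 1%N) 1 / q%:R <= 1 :> R.
  apply: sum_pow2_inv => // q qI q1; split; last exact: pw2.
  by have [q0 _ _] := mI qI; move/eqP: q1; move: q0; clear; lia.
have [_ _ _ rI sI] := H.
have F1 : P <= P * \sum_(q <- I | q != 1%N) rho R p (J 1 q) by rewrite ler_peMr ?sI ?ler0n.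
have : P <= \sum_(q <- I | q != 1%N) (q%:R * (P / (P - 1)) + 3%:R * (1 / q%:R)).
  apply: le_trans F1 _; rewrite mulr_sumr big_seq_cond [leRHS]big_seq_cond.
  apply: ler_sum => q /andP[qI q1]; have [q0 _ _] := mI qI.
  have p1 : (1 < p)%N by move: p360; clear; lia.
  have := residue_bound R (rI _ _ oneI qI ltac:(by rewrite eq_sym)) q0 (ltn0Sn 0) p1
    (fun n => tight1 H oneI (n := n) qI q1).
  by rewrite !mul1r mulr1.
rewrite big_split /= -[X in _ <= X + _]mulr_suml -[X in _ <= _ + X]mulr_sumr.
move: (P360) => P0; have c : P / (P - 1) <= 101%:R / 100%:R by rewrite ler_pdivrMr; lra.
have L0 : 3%:R * l%:R <= P + 2%:R :> R by rewrite -natrM -natrD ler_nat.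
have : (\sum_(q <- I | q != 1%N) q%:R) * (P / (P - 1)) <= (\sum_(q <- I | q != 1%N) q%:R) * (101%:R / 100%:R).
  by rewrite ler_wpM2l // sumr_ge0.
move: c S1 S2 L0; move: (_ / (P - 1)) (\sum_(_ <- _ | _) 1 / _) (\sum_(_ <- _ | _) _) => c x y *; lra.
Qed.

Variable l : nat.
Hypotheses (lI : l \in I) (l2 : (2 < l)%N)
  (lmin : {in I, forall q, (q < l)%N -> exists i, q = (2 ^ i)%N}).
Variables v k : nat.
Hypotheses (lE : l = (2 ^ v * k)%N) (k2 : (2 < k)%N) (ok : odd k).

Let L : R := l%:R.
Let y : R := P / L.
Let below := fun q => (q != 1%N) && (q < l)%N.
Let x : R := \sum_(q <- I | below q) q%:R.
Let l3 : (3 * l < p)%N. Proof. by case: (mI lI). Qed.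
Let L3 : 3%:R * L <= P. Proof. by rewrite -natrM ler_nat ltnW. Qed.
Let L0 : 3%:R <= L. Proof. by rewrite ler_nat. Qed.
Let yL : y * L = P. Proof. by rewrite divfK // lt0r_neq0 // ltr0n; move: l2; clear; lia. Qed.
Let x0 : 0 <= x. Proof. exact: sumr_ge0. Qed.
Let xL : x <= 2%:R * L - 4%:R.
Proof.
apply: sum_pow2_below => [|q qI /andP[q1 ql]]; first by move: l2; clear; lia.
by split=> //; apply: lmin.
Qed.
Let inv_below : \sum_(q <- I | below q) 1 / q%:R <= 1 :> R.
Proof.
apply: sum_pow2_inv => // q qI /andP[q1 ql]; split; last exact: lmin.
by have [q0 _ _] := mI qI; move/eqP: q1; move: q0; clear; lia.
Qed.

Let div_below : \sum_(q <- I | below q && (q %| l)%N) q%:R <= 2%:R * L / k%:R - 2%:R.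
Proof.
have -> : 2%:R * L / k%:R = (2 ^ v.+1)%:R :> R.
  rewrite /L lE expnS !natrM mulrA mulfK // pnatr_eq0; move: k2; clear; lia.
apply: sum_pow2 => // q qI /andP[/andP[q1 ql] qdl].
have [[|i] qi] := lmin qI ql; first by rewrite qi in q1.
exists i => //; move: qdl; rewrite qi lE Gauss_dvdl ?coprimeXl ?coprime2n //.
by rewrite dvdn_Pexp2l.
Qed.

Let slack_tight : slack R p J l <= 12%:R / L.
Proof. by apply: (slack_le H oneI lI l2 lI); move: l2; clear; lia. Qed.
Let slack_loose : ~~ tight p J l -> slack R p J l <= 24%:R / L - 2%:R * L.
Proof. by apply: (slack_far H oneI lI l2 lI); move: l2; clear; lia. Qed.

Let special_pair N : (0 < N)%N -> tight p J l -> special p I J l N ->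
  (L - 2%:R) * (L + N%:R) <= N%:R * (P + 1).
Proof.
move=> N0 tl /andP[tN NI]; have lN : (l < l + N)%N by move: N0; clear; lia.
have := tight_pair H lI ltac:(by apply: ltnW) NI lN tl tN.
rewrite -(ler_nat R) addKn !natrM natrB ?natrD //; exact: ltnW.
Qed.

Let coefs3 : surplus R p I J l 3 =
  (if special p I J l 1 then 9%:R / 8%:R * (L + 1) else 0) +
  (if special p I J l 2 then 9%:R / 40%:R * (L + 2%:R) else 0).
Proof.
rewrite /surplus 2?big_ltn // big_geq // addr0.
by congr (_ + _); case: ifP => // _; rewrite natrD -/L; congr (_ * _); field.
Qed.

Let surplus3_le : surplus R p I J l 3 <= 9%:R / 8%:R * (L + 1) + 9%:R / 40%:R * (L + 2%:R).
Proof. by rewrite coefs3; move: (L0) => L0'; case: ifP => _; case: ifP => _; lra. Qed.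

Let surplus3_tight : tight p J l ->
  surplus R p I J l 3 <= 0 \/ (L - 2%:R) * (L + 2%:R) <= 2%:R * (P + 1).
Proof.
move=> tl; rewrite coefs3.
case: ifP => [s1|_]; first by right; have := special_pair (ltn0Sn 0) tl s1; move: L0 P360 L3 => ? ? ?; lra.
case: ifP => [s1|_]; first by right; have := special_pair (ltn0Sn 1) tl s1; lra.
by left; lra.
Qed.

Lemma min_numerator1_odd : v = 0%N -> False.
Proof.
move=> v0; have lk : l = k by rewrite lE v0 mul1n.
have [M MP main] := master H oneI lI l2 (isT : (2 < 3)%N) (isT : (3 <= 5)%N) l2.
apply: (endgame_odd (x := x) (M := M) (tg := tail_gap R l) (s := surplus R p I J l 3)
  (e := slack R p J l) P360 L3 yL x0 MP L0 _ xL _ surplus3_le).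
- apply: le_trans main _.
  have -> : 3%:R / (3%:R * 3%:R - 1) = 3%:R / 8%:R :> R by congr (_ / _); lra.
  have -> : 12%:R + 3%:R * 3%:R = 21%:R :> R by lra.
  rewrite lerD2r lerD2l.
  apply: (@le_trans _ _ (\sum_(q <- I | below q) (15%:R * (1 / q%:R) + 3%:R / 2%:R * q%:R))); last first.
    rewrite big_split /= -[X in X + _ <= _]mulr_sumr -[X in _ + X <= _]mulr_sumr.
    by rewrite lerD2r -[leRHS]mulr1 ler_pM2l.
  rewrite big_seq_cond [leRHS]big_seq_cond; apply: ler_sum => q /andP[qI /andP[q1 ql]].
  have := excess_nondivisor H oneI lI l2 (m := 1) lE ok isT _ qI ql (lmin qI ql) _.
  have -> : 3%:R / (3%:R * 1%:R - 1) = 3%:R / 2%:R :> R by congr (_ / _); lra.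
  have -> : 12%:R + 3%:R * 1%:R = 15%:R :> R by lra.
  rewrite [_ * (3%:R / _)]mulrC; apply; first by rewrite expn_gt0.
  have [[|i] qi] := lmin qI ql; first by rewrite qi in q1.
  apply/negP => /dvdn_odd; rewrite lk ok => /(_ isT).
  by rewrite qi expnS mul2n odd_double.
- case: (ltnP l 4) => l4; [left|right].
    have lt3 : l = 3%N by move: l2 l4; clear; lia.
    by rewrite /L lt3; split=> //; exact: tail_gap3.
  have l5 : (5 <= l)%N.
    by have := ok; rewrite -lk; move: l4; clear; case: l => [|[|[|[|[|n]]]]].
  by rewrite ler_nat l5; split=> //; apply: le_trans (tail_gap_le _ l5) (tail_gap5 R).
case: (boolP (tight p J l)) => tl; last first.
  left; apply: le_trans (slack_loose tl) _; rewrite lerD2r ler_pdivrMr; move: (L0) => ?; lra.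
right; split; [|exact: surplus3_tight|].
  by apply: le_trans slack_tight _; rewrite ler_pdivrMr; move: (L0) => ?; lra.
(* If a power of 2 above 1 is a numerator, [p] is odd; as [l] is odd and tight, [2 l] divides
   [p + 1] or [p - 1], and [3 l < p] excludes quotient 1, so [4 l <= p + 1]. *)
case: (boolP (has (fun q => below q) I)) => [/hasP[q qI /andP[q1 ql]]|].
  right; have [_ _ qp] := mI qI.
  have [[|i] qi] := lmin qI ql; first by rewrite qi in q1.
  have op : odd p by move: qp; rewrite qi coprime_pexpl // coprime2n.
  have : (4 * l <= p + 1)%N.
    have [d|d] := tightP tl.
      have : (2 * l %| p + 1)%N by rewrite Gauss_dvd ?coprime2n ?lk ?ok // -lk d andbT dvdn2 oddD op.
      case/dvdnP => [[|[|t]]]; move: l3 l2; clear; [lia|lia|].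
      by move=> l3 l2 ->; rewrite mulnA leq_mul2r; apply/orP; right; lia.
    have : (2 * l %| p - 1)%N.
      rewrite Gauss_dvd ?coprime2n ?lk ?ok // -lk d andbT dvdn2 oddB ?op //.
      by move: p360; clear; lia.
    case/dvdnP => [[|[|t]]]; move: l3 l2; clear; [lia|lia|].
    by move=> l3 l2 e; have : (2 * (2 * l) <= p - 1)%N by [rewrite e leq_mul2r orbT]; lia.
  by rewrite -(ler_nat R) natrM natrD.
rewrite -all_predC => /allP nb; left; rewrite /x big_seq_cond big1 // => q /andP[qI bq].
by have := nb q qI; rewrite /= bq.
Qed.

Let div_sum : \sum_(q <- I | below q) (if (q %| l)%N then q%:R * y else 0) <= (2%:R * L / k%:R - 2%:R) * y.
Proof.
rewrite -big_mkcondr /= -mulr_suml ler_wpM2r ?div_below //.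
by rewrite /y /P /L divr_ge0.
Qed.

Lemma min_numerator1_even : (0 < v)%N -> (4 < k)%N -> False.
Proof.
move=> v0 k5; have v2 : (2 <= 2 ^ v)%N by rewrite -{1}[2%N]expn1 leq_exp2l.
have l10 : (10 <= l)%N by rewrite lE; apply: (@leq_mul 2 5).
have L10 : 10%:R <= L by rewrite ler_nat.
have [M MP main] := master H oneI lI l2 (isT : (2 < 3)%N) (isT : (3 <= 5)%N) l2.
apply: (endgame_even (x := x) (M := M) (tg := tail_gap R l) (s := surplus R p I J l 3)
  (e := slack R p J l) P360 L3 yL x0 MP L10 _ xL _ surplus3_le).
- apply: le_trans main _.
  have -> : 3%:R / (3%:R * 3%:R - 1) = 3%:R / 8%:R :> R by congr (_ / _); lra.
  have -> : 12%:R + 3%:R * 3%:R = 21%:R :> R by lra.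
  rewrite lerD2r lerD2l.
  apply: (@le_trans _ _ (\sum_(q <- I | below q) (18%:R * (1 / q%:R) +
      (if (q %| l)%N then q%:R * y else 0) + 3%:R / 5%:R * q%:R))); last first.
    rewrite !big_split /= -[X in X + _ + _ <= _]mulr_sumr -[X in _ + _ + X <= _]mulr_sumr.
    rewrite lerD2r lerD //; first by rewrite -[leRHS]mulr1 ler_pM2l.
    apply: le_trans div_sum _.
    have -> : (2%:R * L / k%:R - 2%:R) * y = 2%:R * P / k%:R - 2%:R * y.
      by rewrite -yL; ring.
    rewrite lerD2r ler_pdivrMr ?ltr0n; last by move: k2; clear; lia.
    have : 5%:R * P <= k%:R * P by rewrite ler_wpM2r ?ler_nat // /P ler0n.
    by move=> ?; lra.
  rewrite big_seq_cond [leRHS]big_seq_cond; apply: ler_sum => q /andP[qI /andP[q1 ql]].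
  have qi := lmin qI ql; have [q0 _ _] := mI qI.
  have Q0 : 0 <= 1 / q%:R :> R by rewrite divr_ge0.
  have Q0' : 0 <= q%:R :> R by rewrite ler0n.
  case: ifP => qdl.
    have qnl : q != l by move: ql; clear; lia.
    have := excess_divisor H oneI lI l2 qI q1 qnl qdl; rewrite -/P -/L -/y.
    move: (q%:R * y) => z; lra.
  have := excess_nondivisor H oneI lI l2 (m := 2) lE ok isT v2 qI ql qi (negbT qdl).
  have -> : 3%:R / (3%:R * 2%:R - 1) = 3%:R / 5%:R :> R by congr (_ / _); lra.
  have -> : 12%:R + 3%:R * 2%:R = 18%:R :> R by lra.
  by rewrite addr0 [_ * (3%:R / _)]mulrC.
- exact: le_trans (tail_gap_le _ l10) (tail_gap10 R).
have L0' : 0 < L by lra.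
case: (boolP (tight p J l)) => tl; last first.
  left; apply: le_trans (slack_loose tl) _; rewrite lerD2r ler_pdivrMr //; lra.
right; split; [|exact: surplus3_tight].
by apply: le_trans slack_tight _; rewrite ler_pdivrMr //; lra.
Qed.

Let coefs5 : surplus R p I J l 5 =
  (if special p I J l 1 then 9%:R / 7%:R * (L + 1) else 0) +
  ((if special p I J l 2 then 27%:R / 70%:R * (L + 2%:R) else 0) +
  ((if special p I J l 3 then 9%:R / 56%:R * (L + 3%:R) else 0) +
  (if special p I J l 4 then 9%:R / 154%:R * (L + 4%:R) else 0))).
Proof.
rewrite /surplus 4?big_ltn // big_geq // addr0.
by congr (_ + (_ + (_ + _))); case: ifP => // _; rewrite natrD -/L; congr (_ * _); field.
Qed.

Lemma min_numerator1_three : (0 < v)%N -> k = 3%N -> False.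
Proof.
move=> v0 k3; have v2 : (2 <= 2 ^ v)%N by rewrite -{1}[2%N]expn1 leq_exp2l.
have lE3 : l = (2 ^ v * 3)%N by rewrite lE k3.
have l5 : (5 <= l)%N by move: lE3 v2; clear; lia.
have L6 : 6%:R <= L by rewrite ler_nat; move: lE3 v2; clear; lia.
have L0' : 0 < L by lra.
have [M MP main] := master H oneI lI l2 (isT : (2 < 5)%N) (isT : (5 <= 5)%N) l5.
apply: (endgame_three (x := x) (M := M) (tg := tail_gap R l) (s := surplus R p I J l 5)
  (e := slack R p J l) P360 L3 yL x0 MP _).
- apply: le_trans main _.
  have -> : 3%:R / (3%:R * 5%:R - 1) = 3%:R / 14%:R :> R by congr (_ / _); lra.
  have -> : 12%:R + 3%:R * 5%:R = 27%:R :> R by lra.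
  rewrite lerD2r lerD2l.
  (* The only power of 2 below [3 * 2 ^ v] that does not divide it is [2 ^ (v + 1)]. With
     [m = 2 ^ v >= 2] it costs at most [12 / q + 3 / 2 + 12 / 5], whence [39 / 10]. *)
  apply: (@le_trans _ _ (\sum_(q <- I | below q) (13%:R * (1 / q%:R) +
      (if q == (2 ^ v.+1)%N then 39%:R / 10%:R else 0) + (if (q %| l)%N then q%:R * y else 0)))); last first.
    rewrite !big_split /= -[X in X + _ + _ <= _]mulr_sumr.
    apply: lerD; first apply: lerD; first by rewrite -[leRHS]mulr1 ler_pM2l.
      by apply: sum_pred1_le => //; lra.
    apply: le_trans div_sum _.
    by rewrite -yL k3; lra.
  rewrite big_seq_cond [leRHS]big_seq_cond; apply: ler_sum => q /andP[qI /andP[q1 ql]].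
  have qi := lmin qI ql; have [q0 _ _] := mI qI.
  have Q0 : 0 <= 1 / q%:R :> R by rewrite divr_ge0.
  case: ifP => [/eqP qv|qv]; case: ifP => qdl.
  + have qnl : q != l by move: ql; clear; lia.
    have := excess_divisor H oneI lI l2 qI q1 qnl qdl; rewrite -/P -/L -/y.
    move: (q%:R * y) => z; lra.
  + have := excess_nondivisor H oneI lI l2 (m := 2 ^ v) lE ok (expn_gt0 2 v) (leqnn _) qI ql qi (negbT qdl).
    have qE : q%:R = 2%:R * (2 ^ v)%:R :> R by rewrite qv expnS natrM.
    have : 2%:R <= (2 ^ v)%:R :> R by rewrite ler_nat.
    rewrite qE addr0; move: ((2 ^ v)%:R) => u u2.
    have -> : (12%:R + 3%:R * u) * (1 / (2%:R * u)) = 12%:R * (1 / (2%:R * u)) + 3%:R / 2%:R.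
      by field; rewrite lt0r_neq0 //; lra.
    have : 2%:R * u * (3%:R / (3%:R * u - 1)) <= 24%:R / 10%:R.
      by rewrite mulrA ler_pdivrMr; lra.
    have : 0 <= 1 / (2%:R * u) by rewrite divr_ge0 //; lra.
    move: (1 / _) (_ * (_ / (_ - 1))) => *; lra.
  + have qnl : q != l by move: ql; clear; lia.
    have := excess_divisor H oneI lI l2 qI q1 qnl qdl; rewrite -/P -/L -/y.
    move: (q%:R * y) => z; lra.
  case/negP: qv; case: qi => i qi; move: ql qdl; rewrite qi lE3.
  rewrite eqn_exp2l // eqn_leq => iv qdl; apply/andP; split.
    rewrite leqNgt; apply: contraL iv => vi; rewrite -leqNgt.
    by apply: leq_trans (leq_pexp2l (isT : (0 < 2)%N) vi); rewrite !expnS; clear; lia.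
  by rewrite ltnNge; apply: contraFN qdl => iv'; rewrite dvdn_mulr // dvdn_exp2l.
- case: v lE3 v0 => [|[|[|[|w]]]] // lE3 _.
  + by apply: Or41; rewrite /L lE3; split=> //; exact: tail_gap6.
  + by apply: Or42; rewrite /L lE3; split=> //; exact: tail_gap12.
  + by apply: Or43; rewrite /L lE3; split=> //; exact: tail_gap24.
  have l48 : (48 <= l)%N.
    by rewrite lE3 !expnS !mulnA; move: (expn_gt0 2 w); move: (2 ^ w)%N; clear; lia.
  apply: Or44; split; first by rewrite ler_nat.
  by apply: le_trans (tail_gap24 R); apply: tail_gap_le; apply: leq_trans l48.
- by rewrite coefs5; do 4 case: ifP => _; lra.
case: (boolP (tight p J l)) => tl; last first.
  left; apply: le_trans (slack_loose tl) _; rewrite lerD2r ler_pdivrMr //; lra.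
right; split; first by apply: le_trans slack_tight _; rewrite ler_pdivrMr //; lra.
rewrite coefs5; case: ifP => [s1|_].
  by apply: Or32; have := special_pair (ltn0Sn 0) tl s1; rewrite mul1r.
(* All pairs are weakened to [N = 4]; the two inequalities differ by [(4 - N) (P + 3 - L)]. *)
have far N : (0 < N <= 4)%N -> special p I J l N -> (L - 2%:R) * (L + 4%:R) <= 4%:R * (P + 1).
  move=> /andP[N0 N4] sN; have := special_pair N0 tl sN.
  have : N%:R <= 4%:R :> R by rewrite ler_nat.
  move: (P) (L) (N%:R : R) L3 P360 L0 => P' L' n h1 h2 h3 n4 sp.
  have : 0 <= (4%:R - n) * (P' + 3%:R - L') by apply: mulr_ge0; lra.
  lra.
case s2: (special _ _ _ _ 2); [|case s3: (special _ _ _ _ 3); [|case s4: (special _ _ _ _ 4)]].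
- apply: Or33; split; last exact: far s2.
  by rewrite add0r -addrA lerD2l; do 2 case: ifP => _; lra.
- apply: Or33; split; last exact: far s3.
  by case: ifP => _; lra.
- apply: Or33; split; last exact: far s4; lra.
by apply: Or31; lra.
Qed.

End MinNumerator1.

Theorem min_numerator1 (R : realFieldType) p I (J : nat -> nat -> nat) :
  spectral_system R p I J -> 1%N \in I -> (360 <= p)%N -> False.
Proof.
move=> H oneI p360.
have [l /andP[lI nl] lmin] := ex_minimal (has_nonpow2 H oneI p360).
have [_ _ mI _ _] := H; have [l0 _ _] := mI l lI.
have np : ~ exists k, l = (2 ^ k)%N.
  by case=> k lk; case/eqP: nl; rewrite lk trunc_expnK.
have [v [k [lE k2 ok]]] := pow2_or_odd_part l0 np.
have l2 : (2 < l)%N by apply: leq_trans k2 _; rewrite lE leq_pmull ?expn_gt0.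
have below : {in I, forall q, (q < l)%N -> exists i, q = (2 ^ i)%N}.
  move=> q qI ql; exists (trunc_log 2 q); apply/eqP.
  by apply: contraLR ql => /(lmin q qI); rewrite -leqNgt.
have [v0|v0] := posnP v.
  exact (min_numerator1_odd H oneI p360 lI l2 below lE ok v0).
have [k3|k3] := eqVneq k 3%N.
  exact (min_numerator1_three H oneI p360 lI l2 below lE k2 ok v0 k3).
apply: (min_numerator1_even H oneI p360 lI l2 below lE k2 ok v0).
by move: k2 ok k3; clear; case: k => [|[|[|[|[|k]]]]].
Qed.

(** * Search for small denominators *)

Section Search.
Local Open Scope N_scope.

Definition scale : N := 1000000.

Definition rho_up (p j : N) : N := 10 * scale * p * p / (j * (10 * p * p - 17 * j * j)) + 1.

Inductive tree := Leaf | Node (l : tree) (c : N) (r : tree).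

Fixpoint tabulate (f : positive -> N) (n : nat) : tree :=
  match n with
  | O => Leaf
  | S m => Node (tabulate (fun i => f (xO i)) m) (f xH) (tabulate (fun i => f (xI i)) m)
  end.

(** The default [f i] at a [Leaf] makes the result right for every index; depth 8 in [rho_tree]
    stores all distances that occur for [p < 360]. *)
Fixpoint lookup (f : positive -> N) (t : tree) (i : positive) : N :=
  match t, i with
  | Leaf, _ => f i
  | Node _ c _, xH => c
  | Node l _ _, xO j => lookup (fun i => f (xO i)) l j
  | Node _ _ r, xI j => lookup (fun i => f (xI i)) r j
  end.

(* a numerator [q], with its inverse modulo [p] *)
Definition letter : Type := N * N.

Section Refute.
Variables (p : N) (val : N -> N).

Definition coef (l x : letter) : N :=
  if l.1 =? x.1 then 0 else
  let r := (l.1 * x.2) mod p in val (N.min r (p - r)).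

Definition weight (T U : N) (a l x : letter) : N := T * coef a x + U * coef l x.

Definition total (f : letter -> N) (s : seq letter) : N := foldl (fun acc x => acc + f x) 0 s.

(* Weak duality: the undecided letters are relaxed to a fractional knapsack of capacity [mass],
   with dual price [mu / p] per unit; the spectral inequalities of [a] and [l] are combined with
   weights [T] and [U] *)
Definition refute (T U mu : N) (a l : letter) (ins und : seq letter) (mass : N) : bool :=
  let m := mu / p in
  total (weight T U a l) ins + total (fun x => weight T U a l x - m * x.1) und + m * mass
    <? (T + U) * scale.

(** Any dual price is sound. In units of [scale / p] the trial values are 0.72 and 0.95, against
    about 1 per unit of mass of a letter of winding number 1. *)
Definition refute1 a und mass :=
  refute 1 0 720000 a a [:: a] und mass || refute 1 0 950000 a a [:: a] und mass.

Definition refute2 a l ins und mass :=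
  refute 2 1 2350000 a l ins und mass || refute 1 1 1600000 a l ins und mass.

Definition prune (a : letter) (ins und : seq letter) (mass : N) : bool :=
  if ins is [:: _] then refute1 a und mass
  else has (fun l => if l.1 =? a.1 then false else refute2 a l ins und mass) ins.

Fixpoint dfs (a : letter) (ins und : seq letter) (mass : N) : bool :=
  if prune a ins und mass then true else
  match und with
  | nil => has (fun l => refute 0 1 0 l l ins [::] 0) ins
  | x :: und' => (if x.1 <=? mass then dfs a (x :: ins) und' (mass - x.1) else true)
                 && dfs a ins und' mass
  end.

Fixpoint search (c : seq letter) : bool :=
  if c is x :: c' then dfs x [:: x] c' (p - x.1) && search c' else true.

Definition is_pow2 (q : N) : bool := N.land q (q - 1) =? 0.

Fixpoint sweep (one : letter) (chain c : seq letter) : bool :=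
  match c with
  | nil => refute1 one chain (p - 1)
  | x :: c' =>
      if is_pow2 x.1 then sweep one (x :: chain) c'
      else (if refute2 one x [:: one; x] (catrev chain c') (p - 1 - x.1)
            then sweep one chain c' else false)
  end.
End Refute.

Definition rho_tree (p : N) : tree := tabulate (fun i => rho_up p (Npos i)) 8.

Definition rho_lookup (p : N) (t : tree) (j : N) : N :=
  if j is Npos i then lookup (fun i => rho_up p (Npos i)) t i else rho_up p 0.

(** No correctness proof is required: [valid] checks every inverse that it returns. *)
Fixpoint euclid (fuel : nat) (p r0 r1 s0 s1 : N) : N :=
  if fuel is S f then
    if r1 =? 0 then s0 else
    let (a, b) := N.div_eucl r0 r1 in
    euclid f p r1 b s1 ((s0 + (p - (a * s1) mod p)) mod p)
  else s0.

Fixpoint letters (p : N) (n : nat) (q : N) : seq letter :=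
  if n is S m then
    let c := letters p m (q + 1) in
    if N.gcd q p =? 1 then (q, euclid 20 p p q 0 1) :: c else c
  else [::].

Definition valid (p : N) (c : seq letter) : bool := all (fun x => (x.1 * x.2) mod p =? 1) c.

Definition check_small (p : N) : bool :=
  let c := letters p (N.to_nat ((p - 1) / 3)) 1 in
  let t := rho_tree p in
  valid p c && search p (rho_lookup p t) c.

Definition check_one (p : N) : bool :=
  let c := letters p (N.to_nat ((p - 1) / 3)) 1 in
  if c is one :: c' then
    valid p c &&
    (if refute1 p (rho_up p) one c' (p - 1) then true
     else let t := rho_tree p in sweep p (rho_lookup p t) one [::] c')
  else true.

Fixpoint check_range (chk : N -> bool) (n : nat) (p : N) : bool :=
  if n is S m then chk p && check_range chk m (p + 1) else true.

End Search.

(** * Soundness of the search *)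

Lemma lookup_tabulate f n i : lookup f (tabulate f n) i = f i.
Proof. by elim: n f i => [|n IH] f [i|i|] //=; rewrite IH. Qed.

Lemma rho_lookupE p j : rho_lookup p (rho_tree p) j = rho_up p j.
Proof. by case: j => // i; rewrite /rho_lookup /rho_tree lookup_tabulate. Qed.

Lemma to_nat_mod a b : (0 < N.to_nat b)%N ->
  N.to_nat (a mod b)%num = (N.to_nat a %% N.to_nat b)%N.
Proof.
move=> b0; have bn : b <> 0%num by move: b0; clear; lia.
have := N.mod_lt a _ bn; have := N.div_mod a _ bn.
move: (a / b)%num (a mod b)%num => d m -> mb.
have -> : N.to_nat (b * d + m) = (N.to_nat d * N.to_nat b + N.to_nat m)%N by lia.
by rewrite modnMDl modn_small //; lia.
Qed.

Section CastN.
Variable R : realFieldType.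
Definition nr (x : N) : R := (N.to_nat x)%:R.

Lemma nr_ge0 x : 0 <= nr x. Proof. exact: ler0n. Qed.
Lemma nrD x y : nr (x + y) = nr x + nr y.
Proof. by rewrite /nr -natrD; congr (_%:R); lia. Qed.
Lemma nrM x y : nr (x * y) = nr x * nr y.
Proof. by rewrite /nr -natrM; congr (_%:R); lia. Qed.
Lemma nr_le x y : N.le x y -> nr x <= nr y.
Proof. by move=> xy; rewrite /nr ler_nat; lia. Qed.
Lemma nr_lt x y : N.lt x y -> nr x < nr y.
Proof. by move=> xy; rewrite /nr ltr_nat; lia. Qed.
Lemma nrB x y : nr x - nr y <= nr (x - y).
Proof. by rewrite /nr lerBlDr -natrD ler_nat; lia. Qed.

Lemma nr_total f s : nr (total f s) = \sum_(x <- s) nr (f x).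
Proof.
have foldE acc : nr (foldl (fun acc x => N.add acc (f x)) acc s) = nr acc + \sum_(x <- s) nr (f x).
  elim: s acc => [|x s IH] acc /=; first by rewrite big_nil addr0.
  by rewrite IH nrD big_cons addrA.
by rewrite /total foldE add0r.
Qed.

Lemma rho_up_sound p j : (0 < N.to_nat j)%N -> (2 * N.to_nat j <= N.to_nat p)%N ->
  nr scale * rho R (N.to_nat p) (N.to_nat j) <= nr (rho_up p j).
Proof.
move=> j0 jp; rewrite /rho_up; set X := (10 * _ * _ * _)%num; set Y := (j * _)%num.
have J0 : 0 < nr j by rewrite /nr ltr0n.
have JP : 2%:R * nr j <= nr p by rewrite /nr -natrM ler_nat.
have P0 : 0 < nr p by lra.
have JJ : 4%:R * (nr j * nr j) <= nr p * nr p by nra.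
have PP : 0 < nr p * nr p by rewrite mulr_gt0.
have le : N.le (17 * j * j) (10 * p * p) by nia.
have YE : nr Y = nr j * (10%:R * nr p * nr p - 17%:R * nr j * nr j).
  rewrite nrM; congr (_ * _); apply/eqP; rewrite -subr_eq opprK; apply/eqP.
  have -> : 17%:R * nr j * nr j = nr (17 * j * j) by rewrite !nrM.
  have -> : 10%:R * nr p * nr p = nr (10 * p * p) by rewrite !nrM.
  by rewrite -nrD; congr nr; lia.
have Y0 : 0 < nr Y by rewrite YE mulr_gt0 //; lra.
have XE : nr X = 10%:R * nr scale * nr p * nr p by rewrite !nrM.
have -> : nr scale * rho R (N.to_nat p) (N.to_nat j) = nr X / nr Y.
  rewrite XE YE /rho -/(nr p) -/(nr j); field.
  by rewrite !lt0r_neq0 //; lra.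
rewrite ler_pdivrMr // -nrM; apply: nr_le.
have Yn : Y <> 0%num by move=> Y0'; rewrite Y0' /nr ltxx in Y0.
have := N.mul_succ_div_gt X Y Yn; lia.
Qed.
End CastN.

(** Modulo [p], [j q] is [l] up to sign, hence [j] is [l r] up to sign, and [2 j <= p] selects the
    representative. *)
Lemma residue_distE p q r l j : (0 < p)%N -> (q * r = 1 %[mod p])%N -> residue_dist p l q j ->
  j = minn ((l * r) %% p) (p - (l * r) %% p).
Proof.
move=> p0 qr [j0 jp [n w]]; have r'p : ((l * r) %% p < p)%N by rewrite ltn_mod.
have jE : (j * q * r = j %[mod p])%N by rewrite -mulnA -modnMmr qr modnMmr muln1.
case: w => w.
  have -> : ((l * r) %% p = j)%N; last by move: j0 jp; clear; lia.
  by rewrite -(modnMDl (n * r)%N) mulnAC -mulnDl -w jE modn_small //; move: j0 jp; clear; lia.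
have : (j + (l * r) %% p = 0 %[mod p])%N.
  by rewrite modnDmr -modnDml -jE modnDml -mulnDl w mulnAC modnMl mod0n.
rewrite mod0n => /eqP/dvdnP[[|[|k]]]; move: j0 jp r'p; move: ((l * r) %% p)%N; clear; [lia|lia|nia].
Qed.

Section Soundness.
Variables (R : realFieldType) (p : N) (I : seq nat) (J : nat -> nat -> nat).
Hypothesis H : spectral_system R (N.to_nat p) I J.
Variable val : N -> N.
Hypothesis valE : val =1 rho_up p.
Implicit Types (a l x : letter) (ins und c : seq letter) (mass T U mu : N).

Let uI : uniq I. Proof. by case: H. Qed.
Let mI q : q \in I -> [/\ (0 < q)%N, (3 * q < N.to_nat p)%N & coprime q (N.to_nat p)].
Proof. by case: H => _ _ + _ _; apply. Qed.
Let sI k : k \in I -> 1 <= \sum_(q <- I | q != k) rho R (N.to_nat p) (J k q).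
Proof. by case: H => _ _ _ _; apply. Qed.
Let massI : (\sum_(q <- I) q <= N.to_nat p)%N. Proof. by case: H. Qed.

Definition key x : nat := N.to_nat x.1.

Let rh (k q : nat) : R := if k == q then 0 else nr R scale * rho R (N.to_nat p) (J k q).

Let rh_ge0 k q : k \in I -> q \in I -> 0 <= rh k q.
Proof.
move=> kI qI; rewrite /rh; case: eqVneq => // kq.
by have [_ _ _ rI _] := H; have [j0 jp _] := rI _ _ kI qI kq; rewrite mulr_ge0 ?nr_ge0 // rho_ge0.
Qed.

Let sum_rh k : k \in I -> nr R scale <= \sum_(q <- I) rh k q.
Proof.
move=> kI; rewrite (bigID (fun q => q != k)) /= [X in _ + X]big1 ?addr0; last first.
  by move=> q; rewrite negbK /rh => /eqP ->; rewrite eqxx.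
have -> : \sum_(q <- I | q != k) rh k q =
    \sum_(q <- I | q != k) nr R scale * rho R (N.to_nat p) (J k q).
  by apply: eq_bigr => q ql; rewrite /rh eq_sym (negbTE ql).
by rewrite -mulr_sumr ler_peMr ?nr_ge0 ?sI.
Qed.

Lemma coef_sound l x : key l \in I -> key x \in I -> ((x.1 * x.2) mod p = 1)%num ->
  rh (key l) (key x) <= nr R (coef p val l x).
Proof.
move=> lI xI xr; rewrite /rh /coef.
case: (N.eqb_spec l.1 x.1) => [e|lx]; first by rewrite /key e eqxx nr_ge0.
have lx' : key l != key x by apply/eqP; rewrite /key; lia.
rewrite (negbTE lx') valE; have [_ _ _ rI _] := H; have rd := rI _ _ lI xI lx'.
have [_ x3 _] := mI xI; have p0 : (0 < N.to_nat p)%N by move: x3; clear; lia.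
set j := N.min _ _.
have JE : J (key l) (key x) = N.to_nat j.
  rewrite (residue_distE (r := N.to_nat x.2) p0 _ rd) /j /key.
    rewrite N2Nat.inj_min N2Nat.inj_sub to_nat_mod // N2Nat.inj_mul.
    by move: (_ %% _)%N; clear; lia.
  have <- : N.to_nat (x.1 * x.2) = (N.to_nat x.1 * N.to_nat x.2)%N by clear; lia.
  by rewrite -to_nat_mod // xr modn_small //; move: xI x3 (mI xI); rewrite /key => _ x3 [x0 _ _]; move: x3 x0; clear; lia.
by rewrite JE; apply: rho_up_sound; rewrite -JE; case: rd.
Qed.

Let W T U (k k' q : nat) : R := nr R T * rh k q + nr R U * rh k' q.

Definition letter_ok x := ((x.1 * x.2) mod p = 1)%num.

Let weight_sound T U a l x : key a \in I -> key l \in I -> key x \in I -> letter_ok x ->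
  W T U (key a) (key l) (key x) <= nr R (weight p val T U a l x).
Proof.
move=> aI lI xI xr; rewrite /weight nrD !nrM.
by apply: lerD; apply: ler_wpM2l; rewrite ?nr_ge0 ?coef_sound.
Qed.

(* the system may still contain the letters of [und], of total mass at most [mass], besides [ins] *)
Definition state ins und mass : Prop :=
  [/\ {subset I <= map key (ins ++ und)}, {subset map key ins <= I},
     {in ins ++ und, forall x, letter_ok x} &
     (\sum_(q <- I | q \notin map key ins) q <= N.to_nat mass)%N].

(** The weight of an undecided letter is at most its price plus the positive part of the difference,
    computed by the truncated subtraction of [N]; all prices together are at most that of [mass]. *)
Lemma refute_sound T U mu a l ins und mass : state ins und mass ->
  key a \in I -> key l \in I -> ~~ refute p val T U mu a l ins und mass.
Proof.
move=> [Isub insI ok massle] aI lI; apply/negP; rewrite /refute.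
set m := (mu / p)%num => /N.ltb_lt /(nr_lt R); rewrite !nrD !nrM nr_total nr_total nrD.
apply/negP; rewrite -leNgt.
pose w := W T U (key a) (key l).
have w0 q : q \in I -> 0 <= w q.
  by move=> qI; rewrite addr_ge0 // mulr_ge0 ?nr_ge0 ?rh_ge0.
apply: (@le_trans _ _ (\sum_(q <- I) w q)).
  by rewrite big_split /= -!mulr_sumr mulrDl lerD // ler_wpM2l ?nr_ge0 ?sum_rh.
rewrite (bigID (fun q => q \in map key ins)) /= -addrA; apply: lerD.
  apply: (@le_trans _ _ (\sum_(q <- [seq key x | x <- ins]) (if q \in I then w q else 0))).
    apply: (@le_trans _ _ (\sum_(q <- I | q \in map key ins) (if q \in I then w q else 0))).
      by rewrite big_seq_cond [leRHS]big_seq_cond; apply: ler_sum => q /andP[->].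
    by apply: ler_sum_sub => // q _; case: ifP => // /w0.
  rewrite big_map big_seq_cond [leRHS]big_seq_cond; apply: ler_sum => x /andP[xi _].
  have xI : key x \in I by rewrite insI ?map_f.
  by rewrite xI; apply: weight_sound => //; apply: ok; rewrite mem_cat xi.
pose g q := if q \in I then Num.max 0 (w q - nr R m * q%:R) else 0.
have split q : q \in I -> w q <= g q + nr R m * q%:R.
  by move=> qI; rewrite /g qI -lerBlDr le_max lexx orbT.
apply: (@le_trans _ _ (\sum_(q <- I | q \notin map key ins) (g q + nr R m * q%:R))).
  by rewrite big_seq_cond [leRHS]big_seq_cond; apply: ler_sum => q /andP[/split].
rewrite big_split /= -[X in _ + X <= _]mulr_sumr; apply: lerD; last first.
  by rewrite ler_wpM2l ?nr_ge0 // -natr_sum /nr ler_nat.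
apply: (@le_trans _ _ (\sum_(q <- map key und) g q)).
  apply: ler_sum_sub => // [q qI qi|q _].
    by have := Isub q qI; rewrite map_cat mem_cat (negbTE qi).
  by rewrite /g; case: ifP => // _; rewrite le_max lexx.
rewrite big_map big_seq_cond [leRHS]big_seq_cond; apply: ler_sum => x /andP[xu _].
rewrite /g; case: ifP => [xI|_]; last exact: nr_ge0.
rewrite ge_max nr_ge0 /=; apply: le_trans (nrB _ _ _); rewrite nrM lerD2r.
by apply: weight_sound => //; apply: ok; rewrite mem_cat xu orbT.
Qed.

Lemma state_skip x ins und mass : (key x \notin I) || (key x \in map key ins) ->
  state ins (x :: und) mass -> state ins und mass.
Proof.
move=> xI [Isub insI ok massle]; split=> // [q qI|y yiu].
  have := Isub q qI; rewrite !map_cat !mem_cat inE /= => /or3P[->//|/eqP qx|->]; last by rewrite orbT.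
  by case/orP: xI => [/negP[]|xi]; [rewrite -qx|rewrite qx xi].
by apply: ok; move: yiu; rewrite !mem_cat inE => /orP[]->; rewrite ?orbT.
Qed.

Lemma state_take x ins und mass : key x \in I -> key x \notin map key ins ->
  state ins (x :: und) mass ->
  N.le x.1 mass /\ state (x :: ins) und (mass - x.1)%num.
Proof.
move=> xI xi [Isub insI ok massle].
have sumE : (\sum_(q <- I | q \notin map key ins) q =
    key x + \sum_(q <- I | q \notin map key (x :: ins)) q)%N.
  rewrite big_mkcond (bigD1_seq (key x)) //= xi; congr addn.
  rewrite big_mkcond [RHS]big_mkcond; apply: eq_bigr => q _.
  by rewrite inE negb_or; case: (q != _); case: (q \notin _).
rewrite sumE in massle; split; first by move: massle; rewrite /key; clear; lia.
split=> [q /Isub|q|y yi|].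
- by rewrite /= !map_cat /= !mem_cat !inE mem_cat orbCA.
- by rewrite inE => /orP[/eqP ->|/insI].
- by apply: ok; move: yi; rewrite /= !mem_cat !inE mem_cat orbCA.
by move: massle; rewrite {1}/key; move: (\sum_(_ <- _ | _) _)%N; clear; lia.
Qed.

Lemma refute1_sound a und mass : state [:: a] und mass -> ~~ refute1 p val a und mass.
Proof.
move=> st; have aI : key a \in I by case: st => _ + _ _; apply; rewrite mem_head.
by rewrite negb_or !refute_sound.
Qed.

Lemma refute2_sound a l ins und mass : state ins und mass -> key a \in I -> key l \in I ->
  ~~ refute2 p val a l ins und mass.
Proof. by move=> st aI lI; rewrite negb_or !refute_sound. Qed.

Lemma dfs_sound a ins und mass : state ins und mass -> a \in ins -> ~~ dfs p val a ins und mass.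
Proof.
elim: und ins mass => [|x und IH] ins mass st ai; have [_ insI _ _] := st.
all: have aI : key a \in I by rewrite insI ?map_f.
all: have npr und' : state ins und' mass -> ~~ prune p val a ins und' mass.
1,3: rewrite /prune; case: ins st ai insI => [|b [|b' ins]] // st' ai' insI st;
  first (by move: ai'; rewrite inE => /eqP ->; apply: refute1_sound);
  apply/hasPn => l li; case: ifP => // _; apply: refute2_sound st aI _; exact/insI/map_f.
- rewrite /= (negbTE (npr _ st)); apply/hasPn => l li.
  have lI : key l \in I by rewrite insI ?map_f.
  apply: (@refute_sound 0%num 1%num 0%num l l ins [::] 0%num _ lI lI).
  have [Isub _ ok _] := st; split=> //; rewrite cats0 in Isub.
  by rewrite big_seq_cond big1 // => q /andP[/Isub ->].
rewrite /= (negbTE (npr _ st)).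
case: (boolP ((key x \notin I) || (key x \in map key ins))) => [sk|].
  by rewrite negb_and (IH _ _ (state_skip sk st)) ?orbT.
rewrite negb_or negbK => /andP[xI xk].
have [/N.leb_le -> st'] := state_take xI xk st.
by rewrite negb_and (IH _ _ st') // inE ai orbT.
Qed.

Lemma search_sound c : {subset I <= map key c} -> {in c, forall x, letter_ok x} ->
  search p val c -> I = [::].
Proof.
elim: c => [|x c IH] Isub ok /=; first by case: I Isub => // q I' /(_ q (mem_head _ _)).
case: (boolP (key x \in I)) => [xI|xI /andP[_]].
  suff /dfs_sound/(_ (mem_head _ _))/negbTE-> : state [:: x] c (p - x.1)%num by [].
  split=> // [q|]; first by rewrite inE => /eqP ->.
  have <- : (\sum_(q <- I | q != key x) q = \sum_(q <- I | q \notin map key [:: x]) q)%N.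
    by apply: eq_bigl => q; rewrite inE.
  by have := massI; rewrite (bigD1_seq (key x)) //= /key; move: (\sum_(_ <- _ | _) _)%N; clear; lia.
apply: IH => [q qI|y yc]; last by apply: ok; rewrite inE yc orbT.
by have := Isub q qI; rewrite inE => /orP[/eqP qx|//]; rewrite -qx qI in xI.
Qed.

Lemma sweep_sound one chain c : key one = 1%N -> 1%N \in I ->
  state [:: one] (catrev chain c) (p - 1)%num -> ~~ sweep p val one chain c.
Proof.
move=> one1 oneI; elim: c chain => [|x c IH] chain st /=.
  apply: refute1_sound; have [Isub insI ok m] := st; split=> // [q /Isub|y].
    by rewrite /= !inE catrevE cats0 map_rev mem_rev.
  by move=> yi; apply: ok; move: yi; rewrite /= !inE catrevE cats0 mem_rev.
case: ifP => _; first exact: IH.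
have st1 : state [:: one] (x :: catrev chain c) (p - 1)%num.
  have [Isub insI ok m] := st; split=> // [q /Isub|y yi].
    rewrite /= !inE catrevE map_cat mem_cat /= inE catrevE map_cat mem_cat.
    by case/or4P => ->; rewrite ?orbT.
  apply: ok; move: yi; rewrite /= !inE catrevE mem_cat catrevE mem_cat inE.
  by case/or4P => ->; rewrite ?orbT.
case: (boolP ((key x \notin I) || (key x \in map key [:: one]))) => [sk|].
  by case: ifP => // _; apply: IH; apply: state_skip sk st1.
rewrite negb_or negbK => /andP[xI xk].
have [_ st2] := state_take xI xk st1.
have st3 : state [:: one; x] (catrev chain c) (p - 1 - x.1)%num.
  have [Isub insI ok m] := st2; split=> // [q /Isub|q|y yi|].
  - by rewrite /= !inE orbCA.
  - by move=> qi; apply: insI; move: qi; rewrite /= !inE orbC.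
  - by apply: ok; move: yi; rewrite /= !inE orbCA.
  by apply: leq_trans m; rewrite leq_eqVlt; apply/orP; left; apply/eqP; apply: eq_bigl => q; rewrite /= !inE orbC.
have [_ insI _ _] := st3.
by rewrite (negbTE (refute2_sound st3 _ _)) // insI // !inE eqxx ?orbT.
Qed.

End Soundness.

Lemma lettersS p n q : letters p n.+1 q =
  if (N.gcd q p =? 1)%num then (q, euclid 20 p p q 0 1) :: letters p n (q + 1)
  else letters p n (q + 1).
Proof. by []. Qed.

Lemma mem_letters p n q k : (N.to_nat q <= k)%N -> (k < N.to_nat q + n)%N ->
  coprime k (N.to_nat p) -> k \in map key (letters p n q).
Proof.
elim: n q => [|n IH] q qk kn kp; first by move: qk kn; clear; lia.
rewrite lettersS; case: (eqVneq k (N.to_nat q)) => [kq|/eqP kq]; last first.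
  have : k \in map key (letters p n (q + 1)) by apply: IH => //; move: qk kn kq; clear; lia.
  by case: ifP => // _ ki; rewrite inE ki orbT.
have -> : N.gcd q p = 1%num.
  have [[x qx] [y py]] := (N.gcd_divide_l q p, N.gcd_divide_r q p).
  move: (N.gcd q p) qx py => g qx py.
  have : (N.to_nat g %| gcdn k (N.to_nat p))%N.
    rewrite dvdn_gcd kq; apply/andP; split; apply/dvdnP.
      by exists (N.to_nat x); rewrite qx; clear; lia.
    by exists (N.to_nat y); rewrite py; clear; lia.
  by move: kp; rewrite /coprime => /eqP ->; rewrite dvdn1 => /eqP; clear; lia.
by rewrite N.eqb_refl inE /key kq eqxx.
Qed.

Lemma check_range_sound chk n p k : check_range chk n p -> (N.to_nat p <= k)%N ->
  (k < N.to_nat p + n)%N -> chk (N.of_nat k).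
Proof.
elim: n p => [|n IH] p /=; first by move=> _; clear; lia.
move=> /andP[cp cr] pk kn; case: (eqVneq k (N.to_nat p)) => [->|/eqP kp].
  by rewrite N2Nat.id.
by apply: IH cr _ _; move: pk kn kp; clear; lia.
Qed.

Section CheckSound.
Variables (R : realFieldType) (p : N) (I : seq nat) (J : nat -> nat -> nat).
Hypothesis H : spectral_system R (N.to_nat p) I J.

Let c := letters p (N.to_nat ((p - 1) / 3)) 1.

Let letters_cover : {subset I <= map key c}.
Proof.
move=> q qI; have [_ _ /(_ q qI)[q0 q3 qp] _ _] := H.
apply: mem_letters qp; first by move: q0; clear; lia.
by have := N.mul_succ_div_gt (p - 1) 3 (fun e => ltac:(discriminate e)); move: q3; move: (_ / _)%num; clear; lia.
Qed.

Let valid_ok s : valid p s -> {in s, forall x, letter_ok p x}.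
Proof. by move=> /allP h x /h /N.eqb_eq. Qed.

Lemma check_small_sound : check_small p -> I = [::].
Proof.
rewrite /check_small -/c => /andP[/valid_ok ok se].
by apply: (search_sound H (rho_lookupE p) letters_cover ok se).
Qed.

Lemma check_one_sound : check_one p -> 1%N \in I -> False.
Proof.
rewrite /check_one -/c => chk oneI; have := letters_cover oneI.
case cE: c chk => [//|one c'] /andP[/valid_ok ok]; have lc := letters_cover; rewrite cE in lc.
have one1 : key one = 1%N.
  have n0 : (0 < N.to_nat ((p - 1) / 3))%N by move: cE; rewrite /c; case: (N.to_nat _).
  have [n nE] : exists n, N.to_nat ((p - 1) / 3) = n.+1 by exists (N.to_nat ((p - 1) / 3)).-1; lia.
  have g1 : N.gcd 1 p = 1%num.
    have [x] := N.gcd_divide_l 1 p; move: (N.gcd 1 p) => g; clear => xg.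
    have /eqP : (N.to_nat x * N.to_nat g)%N = 1%N by lia.
    by rewrite muln_eq1 => /andP[_ /eqP]; clear; lia.
  move: cE; rewrite /c nE lettersS g1 N.eqb_refl; move: (euclid _ _ _ _ _ _) (letters _ _ _).
  by clear => e s [<- _].
have st : state p I [:: one] c' (p - 1)%num.
  split=> // [q|]; first by rewrite inE => /eqP ->; rewrite one1.
  have [uI massI _ _ _] := H; move: massI; rewrite (bigD1_seq 1%N) //=.
  have -> : (\sum_(q <- I | q != 1) q = \sum_(q <- I | q \notin map key [:: one]) q)%N.
    by apply: eq_bigl => q; rewrite inE one1.
  by move: (\sum_(_ <- _ | _) _)%N; clear; lia.
case: ifP => [|_]; first by rewrite (negbTE (refute1_sound H _ st)).
by rewrite (negbTE (sweep_sound H (rho_lookupE p) one1 oneI _)).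
Qed.
End CheckSound.

(** The range starts at 4, the least [p] with [3 q < p] for some [q > 0], and ends at 119. *)
Lemma check_small_range : check_range check_small 116 4.
Proof. by vm_cast_no_check (erefl true). Qed.

Lemma check_one_range : check_range check_one 240 120.
Proof. by vm_cast_no_check (erefl true). Qed.

Theorem no_spectral_system (R : realFieldType) p I (J : nat -> nat -> nat) :
  spectral_system R p I J -> I = [::].
Proof.
move=> H; case: (eqVneq I [::]) => // In; exfalso.
have [_ _ mI _ _] := H.
have [a /andP[aI _] amin] : exists2 a, (a \in I) && predT a & {in I, forall q, predT q -> (a <= q)%N}.
  by apply: ex_minimal; case: I In {H mI}.
have [a0 a3 _] := mI a aI.
have pN : N.to_nat (N.of_nat p) = p by rewrite Nat2N.id.
case: (ltnP p 120) => p120.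
  case/eqP: In; rewrite -pN in H; apply: (check_small_sound H).
  by apply: (check_range_sound check_small_range); move: a0 a3 p120; clear; lia.
case: (ltnP 1 a) => a1.
  by apply: (min_numerator_gt1 H aI _ a1 p120) => q qI; apply: amin.
have oneI : 1%N \in I by have <- : a = 1%N by [move: a0 a1; clear; lia].
case: (ltnP p 360) => p360; last exact: (min_numerator1 H oneI p360).
rewrite -pN in H; apply: (check_one_sound H _ oneI).
by apply: (check_range_sound check_one_range); move: p120 p360; clear; lia.
Qed.

(** * Fourier coefficients of rational classes *)

Definition in_sturm (p q d k : nat) : bool := ((k * q + d) %% p < q)%N.

Lemma in_sturm_mod p q d k : in_sturm p q d (k %% p) = in_sturm p q d k.
Proof. by rewrite /in_sturm -(modnDml (k %% p * q)) modnMml modnDml. Qed.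

Section OneLetter.
Variable F : fieldType.
Variables p q d r : nat.
Hypotheses (p0 : (0 < p)%N) (qp : (q <= p)%N) (qr : (q * r = 1 %[mod p])%N).
Variable z : F.
Hypothesis zp : z ^+ p = 1.

(** With [u = k q + d] modulo [p], [k = (u + d') r]: the sum over the class becomes a geometric sum
    of ratio [z ^ r] over [q] consecutive values of [u]. *)
Lemma sum_sturm : exists e, \sum_(0 <= k < p | in_sturm p q d k) z ^+ k =
  (z ^+ r) ^+ e * \sum_(0 <= u < q) (z ^+ r) ^+ u.
Proof.
have dp : (d %% p < p)%N by rewrite ltn_mod.
pose d' := (p - d %% p)%N; exists d'; rewrite mulr_sumr.
pose g (k : 'I_p) : 'I_p := Ordinal (ltn_pmod (k * q + d) p0).
have gk (k : 'I_p) : ((g k + d') * r = k %[mod p])%N.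
  have h : (g k + d' = k * q %[mod p])%N.
    rewrite /g /= modnDml -addnA -modnDmr.
    have -> : ((d + d') %% p = 0)%N; last by rewrite addn0.
    by rewrite -modnDml /d' subnKC ?modnn // ltnW.
  by rewrite -modnMml h modnMml -mulnA -modnMmr qr modnMmr muln1.
have g_inj : injective g.
  move=> k k' e; apply: val_inj; rewrite /= -(modn_small (ltn_ord k)) -(modn_small (ltn_ord k')).
  by rewrite -gk -(gk k') e.
rewrite big_mkord (eq_bigl (fun k : 'I_p => (g k < q)%N)) //.
rewrite (eq_bigr (fun k : 'I_p => (z ^+ r) ^+ d' * (z ^+ r) ^+ g k)); last first.
  by move=> k _; rewrite -exprD -exprM [(r * _)%N]mulnC [(d' + _)%N]addnC -[RHS](expr_mod _ zp) gk expr_mod.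
rewrite -(reindex_inj (F := fun u : 'I_p => (z ^+ r) ^+ d' * (z ^+ r) ^+ u) g_inj (P := fun u : 'I_p => (u < q)%N)) /=.
by rewrite big_mkord (big_ord_widen p (fun u => (z ^+ r) ^+ d' * (z ^+ r) ^+ u) qp).
Qed.
End OneLetter.

Section Period.
Variables (F : numFieldType) (T : finType) (p q d : T -> nat).
Hypotheses (p0 : forall i, (0 < p i)%N).
Hypothesis cover : forall k : nat, (\sum_i in_sturm (p i) (q i) (d i) k = 1)%N.

Let N := (\prod_i p i)%N.
Let N0 : (0 < N)%N. Proof. exact: prodn_gt0. Qed.
Let pN i : (p i * (N %/ p i) = N)%N.
Proof. by rewrite mulnC divnK // /N (bigD1 i) //= dvdn_mulr. Qed.

Lemma sum_period (z : F) i :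
  \sum_(0 <= k < N | in_sturm (p i) (q i) (d i) k) z ^+ k =
  (\sum_(0 <= k < p i | in_sturm (p i) (q i) (d i) k) z ^+ k) *
  \sum_(0 <= a < N %/ p i) (z ^+ p i) ^+ a.
Proof.
rewrite -{1}(pN i) mulnC big_mkcond big_nat_mul mulr_sumr; apply: eq_bigr => a _.
rewrite mulrC -{1}[(a * p i)%N]add0n mulSn [(p i + _)%N]addnC big_addn addnC addnK mulr_sumr.
rewrite [RHS]big_mkcond; apply: eq_bigr => k _.
rewrite -(in_sturm_mod _ _ _ (k + _)) addnC modnMDl in_sturm_mod.
by case: ifP => // _; rewrite exprD -exprM mulnC.
Qed.

(** Over the common period [N] all classes together give the sum of the [z ^ k], which is 0. A class
    with [p i] other than [P] contributes a vanishing geometric sum of ratio [z ^ p i]; the rest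
    share the factor [N / P]. *)
Lemma sum_max_period (z : F) P : (0 < P)%N -> z != 1 -> z ^+ P = 1 ->
  (forall i, z ^+ p i = 1 -> p i = P) -> (exists i, p i = P) ->
  \sum_(i | p i == P) \sum_(0 <= k < P | in_sturm (p i) (q i) (d i) k) z ^+ k = 0.
Proof.
move=> P0 z1 zP zp [i0 pi0].
have geom (y : F) m : y != 1 -> y ^+ m = 1 -> \sum_(0 <= a < m) y ^+ a = 0.
  move=> y1 ym; apply/eqP; rewrite big_mkord; have := subrX1 y m; rewrite ym subrr.
  by move/esym/eqP; rewrite mulf_eq0 subr_eq0 (negbTE y1).
have zN : z ^+ N = 1 by rewrite -(pN i0) pi0 exprM zP expr1n.
have : \sum_i \sum_(0 <= k < N | in_sturm (p i) (q i) (d i) k) z ^+ k = 0.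
  under eq_bigr do rewrite big_mkcond.
  rewrite exchange_big /= -[RHS](geom z N z1 zN); apply: eq_bigr => k _.
  rewrite -big_mkcond /= sumr_const -sum1_card big_mkcond /=.
  rewrite (eq_bigr (fun i => nat_of_bool (in_sturm (p i) (q i) (d i) k))) ?cover //.
under eq_bigr do rewrite sum_period.
rewrite (bigID (fun i => p i == P)) /= [X in _ + X]big1 ?addr0; last first.
  move=> i ip; rewrite (geom (z ^+ p i)) ?mulr0 //.
    by apply: contraNneq ip => /zp ->.
  by rewrite -exprM pN.
rewrite (eq_bigr (fun i => (\sum_(0 <= k < P | in_sturm (p i) (q i) (d i) k) z ^+ k) * (N %/ P)%:R)).
  rewrite -mulr_suml => /eqP; rewrite mulf_eq0 => /orP[/eqP|]; first by [].
  rewrite pnatr_eq0 -pi0 => /eqP N'; have := N0; have := pN i0.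
  by rewrite N' muln0 => <-.
move=> i /eqP ip; rewrite ip zP; congr (_ * _).
by under eq_bigr do rewrite expr1n; rewrite big_mkord sumr_const card_ord.
Qed.

End Period.

From mathcomp Require Import all_classical all_reals topology normedtype derive trigo.
Import numFieldNormedType.Exports.

(** * Elementary estimates of the sine ratio *)

Section Trig.
Local Open Scope classical_set_scope.
Local Open Scope ring_scope.
Variable R : realType.
Implicit Types x : R.

Lemma ge0_derive_le (f df : R -> R) x : 0 <= x -> (forall y : R, is_derive y 1 f (df y)) ->
  (forall y, 0 <= y -> 0 <= df y) -> f 0 <= f x.
Proof.
move=> x0 fdf df0.
have cf : {within `[0, x], continuous f}.
  apply: continuous_subspaceT => y; apply/differentiable_continuous/derivable1_diffP.
  by have [] := fdf y.
have [c /andP[c0 _]] := MVT_segment x0 (fun y _ => fdf y) cf.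
by rewrite -subr_ge0 => ->; rewrite mulr_ge0 ?df0 // subr0.
Qed.

Lemma sin_le_id x : 0 <= x -> sin x <= x.
Proof.
move=> x0; have := @ge0_derive_le (fun y => y - sin y) (fun y => 1 - cos y) x x0.
rewrite sin0 subr0 subr_ge0; by apply=> y *; rewrite subr_ge0 cos_le1.
Qed.

Lemma cos_ge_quad x : 0 <= x -> 1 - x ^+ 2 / 2%:R <= cos x.
Proof.
move=> x0; have := @ge0_derive_le (fun y => cos y + y ^+ 2 / 2%:R) (fun y => y - sin y) x x0.
rewrite cos0 expr0n mul0r addr0 lerBlDr; apply=> y *; last by rewrite subr_ge0 sin_le_id.
by apply: is_derive_eq; rewrite /GRing.scale /=; field.
Qed.

Lemma sin_ge_cub x : 0 <= x -> x - x ^+ 3 / 6%:R <= sin x.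
Proof.
move=> x0; have := @ge0_derive_le (fun y => sin y - y + y ^+ 3 / 6%:R)
  (fun y => cos y - (1 - y ^+ 2 / 2%:R)) x x0.
rewrite sin0 expr0n mul0r !addr0 subr0 addrAC subr_ge0 lerBlDr; apply=> y *; last by rewrite subr_ge0 cos_ge_quad.
by apply: is_derive_eq; rewrite /GRing.scale /=; field.
Qed.

(** At [x = pi / 4], [sin x ^ 2 = 1 / 2] while [sin x >= x - x ^ 3 / 6]; so [t = x ^ 2] satisfies
    [t (1 - t / 6) ^ 2 <= 1 / 2], which fails for [t] between [51 / 80] and 1. *)
Lemma pi_sq_le : pi ^+ 2 <= 102%:R / 10%:R :> R.
Proof.
have [x piE] : exists x : R, pi = 4%:R * x by exists (pi / 4%:R); field.
have x0 : 0 <= x by have := pi_ge0 R; lra.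
have x1 : x <= 1 by have := pihalf_lt2 R; lra.
have s2 : sin x ^+ 2 = 1 / 2%:R.
  have := cos_pihalf R; have -> : pi / 2 = x *+ 2 :> R by rewrite piE -mulr_natr; field.
  by rewrite cos_mulr2n cos2sin2; move: (sin x ^+ 2) => y; lra.
have g0 : 0 <= x - x ^+ 3 / 6%:R.
  by rewrite subr_ge0 ler_pdivrMr // exprS; nra.
have : (x - x ^+ 3 / 6%:R) ^+ 2 <= 1 / 2%:R.
  by rewrite -s2 ler_pXn2r ?nnegrE ?sin_ge_cub // (le_trans g0) ?sin_ge_cub.
have -> : (x - x ^+ 3 / 6%:R) ^+ 2 = x ^+ 2 * (1 - x ^+ 2 / 6%:R) ^+ 2 by field.
rewrite piE exprMn; have : x ^+ 2 <= 1 by rewrite expr_le1.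
have : 0 <= x ^+ 2 by rewrite exprn_ge0.
move: (x ^+ 2) => t t0 t1; rewrite !expr2 => h.
rewrite leNgt; apply/negP => tb.
have t2 : 51%:R / 80%:R < t by lra.
have : 0 <= (t - 51%:R / 80%:R) * (1 - t) by rewrite mulr_ge0; lra.
have : 0 <= t * t * t by rewrite !mulr_ge0.
lra.
Qed.

(** Induction in steps of 2: [sin ((k + 2) t) - sin (k t) = 2 cos ((k + 1) t) sin t], and the
    quadratic bound of the cosine yields exactly the increment of [j - t ^ 2 (j ^ 3 - j) / 6]. *)
Lemma sin_mult_ge (t : R) (j : nat) : 0 <= t -> 0 <= sin t ->
  j%:R * (1 - t ^+ 2 * (j%:R ^+ 2 - 1) / 6%:R) * sin t <= sin (j%:R * t).
Proof.
move=> t0 s0; suff : forall m, (m <= 1)%N -> 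
  forall n, (n + n + m)%:R * (1 - t ^+ 2 * ((n + n + m)%:R ^+ 2 - 1) / 6%:R) * sin t <= sin ((n + n + m)%:R * t).
  by move=> /(_ (odd j) (leq_b1 _) j./2); rewrite addnn addnC odd_double_half.
move=> m m1; elim=> [|n IH].
  case: m m1 => [|[|]] // _; rewrite !add0n; first by rewrite !mul0r sin0.
  by rewrite expr1n subrr mulr0 mul0r subr0 !mul1r.
have -> : (n.+1 + n.+1 + m = (n + n + m).+2)%N by rewrite addnS.
move: (n + n + m)%N IH => k IH.
have -> : sin (k.+2%:R * t) = sin (k%:R * t) + 2%:R * cos (k.+1%:R * t) * sin t.
  have -> : k.+2%:R * t = k.+1%:R * t + t by rewrite -natr1 mulrDl mul1r.
  have -> : k%:R * t = k.+1%:R * t - t by rewrite -[k.+1]addn1 natrD mulrDl mul1r addrK.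
  by rewrite sinB sinD; ring.
have /(cos_ge_quad) := mulr_ge0 (ler0n R k.+1) t0.
rewrite -(ler_pM2r (ltr0Sn R 1)) => /(ler_wpM2r s0).
rewrite -[k.+2]addn2 -[k.+1]addn1 !natrD; move: IH.
move: (sin (k%:R * t)) (cos _) (sin t) => a b s; move: (k%:R) => x.
by rewrite !expr2; lra.
Qed.

Lemma sin_ratio_le (p j : nat) : (0 < j)%N -> (2 * j <= p)%N ->
  0 < sin (j%:R * (pi / p%:R)) :> R /\
  sin (pi / p%:R : R) / sin (j%:R * (pi / p%:R)) <=
    1 / (j%:R * (1 - 17%:R / 10%:R * (j%:R / p%:R) ^+ 2)).
Proof.
move=> j0 jp; have p2 : 2%:R <= p%:R :> R by rewrite ler_nat; lia.
have j1 : 1 <= j%:R :> R by rewrite ler1n.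
have J2 : 2%:R * j%:R <= p%:R :> R by rewrite -natrM ler_nat.
have pi0 := pi_gt0 R; have P0 : 0 < p%:R :> R by lra.
set t := pi / p%:R; have t0 : 0 < t by rewrite divr_gt0.
have tP : t * p%:R = pi by rewrite divfK // lt0r_neq0.
have st : 0 < sin t.
  by apply: sin_gt0_pi; rewrite t0 -tP ltr_pMr //; lra.
have u2 : (j%:R / p%:R) ^+ 2 <= 1 / 4%:R :> R.
  by rewrite expr_div_n ler_pdivrMr ?exprn_gt0 // !expr2; nra.
have b0 : 0 < 1 - 17%:R / 10%:R * (j%:R / p%:R) ^+ 2 :> R by lra.
have t2 : t ^+ 2 * (j%:R ^+ 2 - 1) / 6%:R <= 17%:R / 10%:R * (j%:R / p%:R) ^+ 2.
  have : t ^+ 2 * (j%:R ^+ 2 - 1) <= t ^+ 2 * j%:R ^+ 2.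
    by rewrite ler_wpM2l ?exprn_ge0 ?ltW //; lra.
  have -> : t ^+ 2 * j%:R ^+ 2 = pi ^+ 2 * (j%:R / p%:R) ^+ 2.
    by rewrite /t; field; rewrite lt0r_neq0.
  have := ler_wpM2r (sqr_ge0 (j%:R / p%:R)) (pi_sq_le); lra.
have s1 := sin_mult_ge j (ltW t0) (ltW st).
have s2 : j%:R * (1 - 17%:R / 10%:R * (j%:R / p%:R) ^+ 2) * sin t <= sin (j%:R * t).
  by apply: le_trans s1; rewrite ler_wpM2r ?(ltW st) // ler_wpM2l ?ler0n //; lra.
have c0 : 0 < j%:R * (1 - 17%:R / 10%:R * (j%:R / p%:R) ^+ 2) :> R by rewrite mulr_gt0 //; lra.
have s0 : 0 < sin (j%:R * t) by apply: lt_le_trans s2; rewrite mulr_gt0.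
split=> //; rewrite ler_pdivrMr // mulrAC ler_pdivlMr // mul1r mulrC //.
Qed.
End Trig.

From mathcomp Require Import complex.

(** * Roots of unity *)

Section Circle.
Variable R : realType.
Implicit Types x y : R.

Definition cis x : R[i] := Complex (cos x) (sin x).

Lemma cis0 : cis 0 = 1. Proof. by rewrite /cis cos0 sin0. Qed.

Lemma cisD x y : cis (x + y) = cis x * cis y.
Proof. by apply/eqP; rewrite eq_complex /= cosD sinD addrC eqxx /= addrC [sin x * _]mulrC eqxx. Qed.

Lemma cisX x n : cis x ^+ n = cis (n%:R * x).
Proof.
elim: n => [|n IH]; first by rewrite mul0r cis0.
by rewrite exprS IH -cisD -natr1 mulrDl mul1r addrC.
Qed.

Lemma normc_1B_cis x : Normc.normc (1 - cis (2%:R * x)) = 2%:R * `|sin x|.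
Proof.
rewrite /Normc.normc /=.
have -> : (1 - cos (2%:R * x)) ^+ 2 + (0 - sin (2%:R * x)) ^+ 2 = (2%:R * sin x) ^+ 2.
  rewrite mulr_natl sin_mulr2n cos_mulr2n cos2sin2 sub0r sqrrN.
  have : (cos x) ^+ 2 = 1 - sin x ^+ 2 by rewrite cos2sin2.
  rewrite -[(cos x * sin x) *+ 2]mulr_natr -[(1 - _) *+ 2]mulr_natr => c.
  by rewrite !exprMn c; ring.
by rewrite sqrtr_sqr normrM ger0_norm.
Qed.

Lemma ler_normc_sum (I : finType) (P : pred I) (f : I -> R[i]) :
  Normc.normc (\sum_(i | P i) f i) <= \sum_(i | P i) Normc.normc (f i).
Proof.
elim/big_ind2: _ => [|x a y b xa yb|//]; first by rewrite Normc.normc0.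
by apply: le_trans (le_normcD _ _) _; apply: lerD.
Qed.

Variable p : nat.
Hypothesis p1 : (1 < p)%N.

Definition zeta : R[i] := cis (2%:R * (pi / p%:R)).

Let p0 : 0 < p%:R :> R. Proof. by rewrite ltr0n ltnW. Qed.

Lemma zetaX n : zeta ^+ n = cis (2%:R * (n%:R * (pi / p%:R))).
Proof. by rewrite /zeta cisX mulrCA. Qed.

Lemma zeta_period : zeta ^+ p = 1.
Proof.
rewrite zetaX; have -> : p%:R * (pi / p%:R) = pi :> R by rewrite mulrC divfK // lt0r_neq0.
by rewrite /cis mulr_natl cos2pi sin2pi.
Qed.

Lemma normc_1B_zeta n j : (0 < j)%N -> (j < p)%N -> (n %% p = j)%N \/ (n %% p = p - j)%N ->
  Normc.normc (1 - zeta ^+ n) = 2%:R * sin (j%:R * (pi / p%:R)).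
Proof.
have sin0p k : (0 < k)%N -> (k < p)%N -> 0 <= sin (k%:R * (pi / p%:R)) :> R.
  move=> k0 kp; apply: sin_ge0_pi; rewrite mulr_ge0 ?divr_ge0 ?pi_ge0 ?ler0n //=.
  by rewrite mulrCA -[leRHS]mulr1 ler_pM2l ?pi_gt0 // ler_pdivrMr // mul1r ler_nat ltnW.
move=> j0 jp nj; rewrite -(expr_mod _ zeta_period) zetaX normc_1B_cis.
case: nj => ->; first by rewrite ger0_norm ?sin0p.
rewrite natrB ?(ltnW jp) // mulrBl.
have -> : p%:R * (pi / p%:R) = pi :> R by rewrite mulrC divfK // lt0r_neq0.
by rewrite sinB sinpi cospi mul0r sub0r mulN1r opprK ger0_norm ?sin0p.
Qed.

End Circle.

Definition mod_inverse (p q : nat) : nat := (egcdn q p).1.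

Definition residue (p l q : nat) : nat :=
  let a := ((l * mod_inverse p q) %% p)%N in minn a (p - a).

Lemma mod_inverseP p q : (0 < q)%N -> coprime q p -> (q * mod_inverse p q = 1 %[mod p])%N.
Proof.
move=> q0 /eqP qp; rewrite /mod_inverse; case: egcdnP => // u v e _ /=.
by rewrite mulnC e qp modnMDl.
Qed.

Lemma residueP p l q : (0 < q)%N -> coprime q p -> (0 < l)%N -> (l < p)%N -> coprime l p ->
  residue_dist p l q (residue p l q).
Proof.
move=> q0 qp l0 lp cl; rewrite /residue; set r := mod_inverse p q.
have qr := mod_inverseP q0 qp; have p0 : (0 < p)%N by apply: leq_ltn_trans lp.
set a := ((l * r) %% p)%N.
have ap : (a < p)%N by rewrite ltn_mod.
have aq : (a * q = l %[mod p])%N by rewrite modnMml -mulnA -modnMmr [(_ * q)%N]mulnC qr modnMmr muln1.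
have a0 : (0 < a)%N.
  rewrite lt0n; apply: contraTneq lp => a0; move: aq; rewrite a0 mul0n mod0n => /esym/eqP.
  by rewrite -leqNgt; apply: dvdn_leq.
have aE : (a * q = (a * q) %/ p * p + l)%N by rewrite {1}(divn_eq (a * q) p) aq (modn_small lp).
split; [by rewrite leq_min a0 subn_gt0|by move: ap; clear; lia|].
case: (leqP a (p - a)) => h.
  by exists ((a * q) %/ p)%N; left.
exists (q - (a * q) %/ p)%N; right.
rewrite mulnBl [(p * q)%N]mulnC {1}aE mulnBl.
have : (a * q <= p * q)%N by rewrite leq_mul2r ltnW // orbT.
by rewrite {1}aE; move: (_ %/ _ * p)%N; rewrite mulnC; clear; lia.
Qed.

(** * The spectral inequality and covers by rational classes *)

Section Spectrum.
Variables (R : realType) (T : finType) (p q d : T -> nat).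
Hypotheses (pq : forall i, [/\ (0 < q i)%N, (q i <= p i)%N & coprime (q i) (p i)]).
Hypothesis cover : forall k : nat, (\sum_i in_sturm (p i) (q i) (d i) k = 1)%N.
Variable P : nat.
Hypotheses (pmax : forall i, (p i <= P)%N) (P1 : (1 < P)%N).

Let p0 i : (0 < p i)%N. Proof. by have [q0 qp _] := pq i; apply: leq_trans qp. Qed.
Let PP : P%:R <> 0 :> R. Proof. by move/eqP; rewrite pnatr_eq0; move: P1; clear; lia. Qed.

(** The geometric sum of the i-th class has ratio [z ^ r] and length [q], and [z ^ (r q) = z]; so
    its modulus is [|1 - z| / |1 - w ^ (l r)|], with a numerator common to all classes. For [i0]
    itself [l r = 1]. The triangle inequality isolates [i0]. *)
Lemma spectral_inequality i0 : p i0 = P ->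
  1 <= \sum_(i | (p i == P) && (i != i0))
     sin (pi / P%:R) / sin ((residue P (q i0) (q i))%:R * (pi / P%:R)) :> R.
Proof.
move=> pi0; have [l0 lP lc] := pq i0; rewrite pi0 in lP lc.
set l := q i0 in l0 lP lc *.
have lltP : (l < P)%N.
  rewrite ltn_neqAle lP andbT; apply: contraTneq lc => ->.
  by rewrite /coprime gcdnn; move: P1; clear; lia.
pose w := zeta R P; pose z := w ^+ l; pose r i := mod_inverse P (q i).
have zP : z ^+ P = 1 by rewrite /z exprAC zeta_period // expr1n.
have s0 j : (0 < j)%N -> (2 * j <= P)%N -> 0 < sin (j%:R * (pi / P%:R)) :> R.
  by move=> j0 jP; have [] := sin_ratio_le R j0 jP.
have norm0 n : (0 < n %% P)%N -> 0 < Normc.normc (1 - w ^+ n).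
  move=> n0; have nP : (n %% P < P)%N by rewrite ltn_mod ltnW.
  pose j := minn (n %% P) (P - n %% P).
  have j0 : (0 < j)%N by rewrite leq_min n0 subn_gt0.
  rewrite (normc_1B_zeta R P1 (j := j)) //.
  - by rewrite mulr_gt0 // s0 //; rewrite /j; move: nP; clear; lia.
  - by rewrite /j; move: nP; clear; lia.
  - by rewrite /j; move: nP; move: (n %% P)%N; clear; lia.
have zn1 : z != 1.
  apply/negP => /eqP z1; have := norm0 l; rewrite -/z z1 subrr Normc.normc0 ltxx modn_small //.
  by move/(_ l0).
have zp i : z ^+ p i = 1 -> p i = P.
  move=> zpi; apply/eqP; rewrite eqn_leq pmax /=; apply: dvdn_leq => //.
  rewrite -(@Gauss_dvdr P l) 1?coprime_sym // /dvdn -leqn0 leqNgt.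
  by apply/negP => /norm0; rewrite exprM -/z zpi subrr Normc.normc0 ltxx.
have := sum_max_period p0 cover (ltnW P1) zn1 zP zp (ex_intro _ i0 pi0).
pose G i := \sum_(0 <= k < P | in_sturm (p i) (q i) (d i) k) z ^+ k.
have nG i : p i = P -> Normc.normc (G i) * Normc.normc (1 - w ^+ (l * r i)) = Normc.normc (1 - z).
  move=> piP; have [qi0 qip qic] := pq i; rewrite piP in qip qic.
  have qr := mod_inverseP qi0 qic.
  rewrite -Normc.normcM /G piP; have [e ->] := sum_sturm (d i) (ltnW P1) qip qr zP.
  have geom (y : R[i]) m : (\sum_(0 <= u < m) y ^+ u) * (1 - y) = 1 - y ^+ m.
    by rewrite big_mkord -[1 - y]opprB mulrN mulrC -subrX1 opprB.
  rewrite exprM -/z -/(r i) -mulrA geom Normc.normcM.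
  have -> : (z ^+ r i) ^+ q i = z by rewrite -exprM mulnC -(expr_mod _ zP) qr expr_mod.
  have -> : Normc.normc ((z ^+ r i) ^+ e) = 1.
    rewrite /z -!exprM zetaX /cis /Normc.normc.
    by rewrite cos2Dsin2 sqrtr1.
  by rewrite mul1r.
rewrite (bigD1 i0) ?pi0 //= => /eqP; rewrite addr_eq0 => /eqP G0.
have : Normc.normc (G i0) <= \sum_(i | (p i == P) && (i != i0)) Normc.normc (G i).
  rewrite /G pi0 G0 normcN; apply: le_trans (ler_normc_sum _ _) _.
  by apply: ler_sum => i /andP[/eqP ->].
have w0 : 0 < Normc.normc (1 - z) by apply: norm0; rewrite modn_small.
have lr1 : (l * r i0 = 1 %[mod P])%N by apply: mod_inverseP.
have w1 : 2%:R * sin (pi / P%:R) = Normc.normc (1 - w ^+ (l * r i0)).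
  rewrite (normc_1B_zeta R P1 (j := 1)) ?mul1r //.
  by left; rewrite lr1 modn_small.
have w1' : 0 < Normc.normc (1 - w ^+ (l * r i0)) by apply: norm0; rewrite lr1 modn_small.
have -> : Normc.normc (G i0) = Normc.normc (1 - z) / (2%:R * sin (pi / P%:R)).
  by rewrite w1 -(nG i0 pi0) mulfK // lt0r_neq0.
rewrite ler_pdivrMr; last by rewrite w1.
move=> h; rewrite -(ler_pM2l w0) mulr1; apply: le_trans h _.
rewrite mulr_suml mulr_sumr; apply: ler_sum => i /andP[/eqP piP ii0].
have [qi0 qip qic] := pq i; rewrite piP in qip qic.
have [j0 jP _] := residueP qi0 qic l0 lltP lc.
have jlt : (residue P l (q i) < P)%N by move: jP j0; clear; lia.
have nj : Normc.normc (1 - w ^+ (l * r i)) = 2%:R * sin ((residue P l (q i))%:R * (pi / P%:R)).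
  apply: normc_1B_zeta => //; rewrite /residue -/(r i).
  by have : ((l * r i) %% P < P)%N by [rewrite ltn_mod ltnW]; move: ((l * r i) %% P)%N; clear; lia.
rewrite -(nG i piP) nj; set s := sin ((residue _ _ _)%:R * _).
have s1 : 0 < s by apply: s0.
by rewrite le_eqVlt; apply/orP; left; apply/eqP; field; rewrite lt0r_neq0.
Qed.
End Spectrum.

Section RationalCovers.
Variables (R : realType) (T : finType) (p q d : T -> nat).
Hypothesis cover : forall k : nat, (\sum_i in_sturm (p i) (q i) (d i) k = 1)%N.
Hypothesis pq_inj : injective (fun i => (p i, q i)).

Let someT : T.
Proof.
have : (0 < \sum_i in_sturm (p i) (q i) (d i) 0)%N by rewrite cover.
by case: (pickP (@predT T)) => [i _ //|e]; rewrite big_pred0.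
Qed.

(** The Fourier coefficient at frequency 0, that is, a count over one common period. *)
Lemma sum_density : (forall i, [/\ (0 < q i)%N, (q i <= p i)%N & coprime (q i) (p i)]) ->
  \sum_i (q i)%:R / (p i)%:R = 1 :> rat.
Proof.
move=> pq; have p0 i : (0 < p i)%N by have [q0 qp _] := pq i; apply: leq_trans qp.
pose N := (\prod_i p i)%N; have N0 : (0 < N)%N by apply: prodn_gt0.
have pN i : (p i %| N)%N by rewrite /N (bigD1 i) //= dvdn_mulr.
have Nn0 : N%:R != 0 :> rat by rewrite pnatr_eq0 -lt0n.
have cnt i : \sum_(0 <= k < N | in_sturm (p i) (q i) (d i) k) (1 : rat) ^+ k =
    N%:R * ((q i)%:R / (p i)%:R).
  have [q0 qp qc] := pq i; rewrite sum_period //.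
  have [e ->] := sum_sturm (d i) (p0 i) qp (mod_inverseP q0 qc) (expr1n rat (p i)).
  have one n m : \sum_(0 <= a < n) ((1 : rat) ^+ m) ^+ a = n%:R.
    by under eq_bigr do rewrite !expr1n; rewrite big_mkord sumr_const card_ord.
  rewrite !one !expr1n mul1r -[in RHS](divnK (pN i)) natrM.
  by field; rewrite pnatr_eq0 -lt0n.
apply: (mulfI Nn0); rewrite mulr1 mulr_sumr; under eq_bigr do rewrite -cnt big_mkcond.
rewrite exchange_big /= (eq_bigr (fun=> 1)).
  by rewrite big_mkord sumr_const card_ord.
move=> k _; have := cover k => /(congr1 (fun n => n%:R : rat)); rewrite natr_sum => e; apply: etrans e.
by apply: eq_bigr => i _; case: (in_sturm _ _ _ _); rewrite // expr1n.
Qed.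

Lemma density_max_period P :
  (forall i, [/\ (0 < q i)%N, (q i <= p i)%N & coprime (q i) (p i)]) -> (0 < P)%N ->
  (\sum_(i | p i == P) q i <= P)%N.
Proof.
move=> pq P0; have := sum_density pq; rewrite (bigID (fun i => p i == P)) /= => e.
have : 0 <= \sum_(i | p i != P) (q i)%:R / (p i)%:R :> rat by apply: sumr_ge0 => i _; rewrite divr_ge0.
have -> : (\sum_(i | p i == P) q i <= P)%N = (\sum_(i | p i == P) (q i)%:R / (p i)%:R <= 1 :> rat).
  rewrite (eq_bigr (fun i => (q i)%:R / P%:R)); last by move=> i /eqP ->.
  by rewrite -mulr_suml ler_pdivrMr ?ltr0n // mul1r -natr_sum ler_nat.
by move=> h; lra.
Qed.

Theorem no_rational_cover :
  (forall i, [/\ (0 < q i)%N, (3 * q i < p i)%N & coprime (q i) (p i)]) -> False.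
Proof.
move=> pq3; have pq i : [/\ (0 < q i)%N, (q i <= p i)%N & coprime (q i) (p i)].
  by have [q0 q3 qc] := pq3 i; split=> //; move: q3; clear; lia.
have [j _ pmax] : exists2 j, true & forall i, (p i <= p j)%N.
  by case: (arg_maxnP p (isT : predT someT)) => j _ h; exists j => // i; apply: h.
set P := p j in pmax; have P1 : (1 < P)%N by have [q0 q3 _] := pq3 j; move: q0 q3; rewrite /P; clear; lia.
pose I := [seq q i | i <- index_enum T & p i == P].
have inI x : x \in I -> exists2 i, p i = P & x = q i.
  by move=> /mapP[t]; rewrite mem_filter => /andP[/eqP piP _] ->; exists t.
have sumI (V : nmodType) (f : nat -> V) (Q : pred nat) :
    \sum_(x <- I | Q x) f x = \sum_(i | (p i == P) && Q (q i)) f (q i).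
  by rewrite big_map big_filter_cond.
have uI : uniq I.
  rewrite map_inj_in_uniq ?filter_uniq ?index_enum_uniq // => i i'.
  rewrite !mem_filter => /andP[/eqP pi _] /andP[/eqP pi' _] qe.
  by apply: pq_inj; rewrite pi pi' qe.
suff /no_spectral_system I0 : spectral_system R P I (residue P).
  have : q j \in I by apply: map_f; rewrite mem_filter eqxx mem_index_enum.
  by rewrite I0.
split=> //.
- by rewrite /I big_map big_filter; apply: density_max_period => //; apply: ltnW.
- by move=> x /inI[i <- ->]; apply: pq3.
- move=> l x /inI[i piP ->] /inI[k pkP ->] lk.
  have [qi0 qi3 qic] := pq3 i; have [qk0 qk3 qkc] := pq3 k.
  rewrite piP in qi3 qic; rewrite pkP in qk3 qkc.
  by apply: residueP => //; move: qi3; clear; lia.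
move=> l /inI[i piP ->].
apply: le_trans (spectral_inequality R pq cover pmax P1 piP) _; rewrite sumI.
rewrite [leRHS](eq_bigl (fun k => (p k == P) && (k != i))); last first.
  move=> k; case: (eqVneq (p k) P) => //= pk; congr (~~ _); apply/eqP/eqP => [qk|-> //].
  by apply: pq_inj; rewrite pk piP qk.
apply: ler_sum => k /andP[/eqP pk ki].
have [qi0 qi3 qic] := pq3 i; have [qk0 qk3 qkc] := pq3 k.
rewrite piP in qi3 qic; rewrite pk in qk3 qkc.
have [] := residueP qk0 qkc qi0 _ qic; first by move: qi3; clear; lia.
by move=> j0 jP _; have [] := sin_ratio_le R j0 jP.
Qed.

(** The classical fact that an exact cover by several residue classes repeats its largest modulus:
    with distinct moduli the sum in [spectral_inequality] for the largest one is empty. *)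
Theorem exact_cover_singleton : (forall i, q i = 1%N) -> (forall i, 0 < p i)%N -> forall i j : T, i = j.
Proof.
move=> q1 p0 i j; apply/eqP; apply: contraT => ij.
have pinj k k' : p k = p k' -> k = k' by move=> e; apply: pq_inj; rewrite e !q1.
have pq k : [/\ (0 < q k)%N, (q k <= p k)%N & coprime (q k) (p k)] by rewrite q1 coprime1n.
have [m _ pmax] : exists2 m, true & forall i, (p i <= p m)%N.
  by case: (arg_maxnP p (isT : predT someT)) => m _ h; exists m => // k; apply: h.
have P1 : (1 < p m)%N.
  rewrite ltnNge; apply/negP => pm1.
  have p1 k : p k = 1%N by have := pmax k; have := p0 k; move: pm1; clear; lia.
  by move/eqP: ij; apply; apply: pinj; rewrite !p1.
have := spectral_inequality R pq cover pmax P1 erefl.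
rewrite big1 ?ler10 // => k /andP[/eqP /pinj -> ]; by rewrite eqxx.
Qed.

End RationalCovers.

(** * Counting functions and the irrational case *)

Lemma int_ind_step (V : zmodType) (f : int -> V) c : (forall k, f (k + 1) = f k + c) ->
  forall k, f k = f 0 + c *~ k.
Proof.
move=> fS; elim/int_ind => [|n IH|n IH]; first by rewrite addr0.
  by rewrite -addn1 PoszD fS IH mulrzDr addrA mulr1z.
apply: (addIr c); rewrite -fS; have -> : - n.+1%:Z + 1 = - n%:Z by lia.
rewrite IH -addrA; congr (_ + _); rewrite -[X in _ = _ + X]mulr1z -mulrzDr.
by congr (_ *~ _); lia.
Qed.

Lemma beattyP (R : realType) (a b : R) k :
  beatty a b k <-> exists n : int, k%:~R <= n%:~R * a + b < (k + 1)%:~R.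
Proof.
by split=> [[n _ /eqP]|[n h]]; [rewrite floor_eq => h; exists n|exists n => //; apply/eqP; rewrite floor_eq].
Qed.

Section Partition.
Variables (R : realType) (m : nat) (alpha beta : 'I_m -> R).
Hypothesis alpha1 : forall i, 1 < alpha i.
Hypothesis part : partitions_int (fun i => beatty (alpha i) (beta i)).
Implicit Types (i j : 'I_m) (k n c : int) (u v : R).

Let a0 i : 0 < alpha i. Proof. exact: lt_trans (alpha1 i). Qed.
Let an0 i : alpha i != 0. Proof. by rewrite lt0r_neq0. Qed.

Definition dens i : R := (alpha i)^-1.

Let th0 i : 0 < dens i. Proof. by rewrite invr_gt0. Qed.
Let th1 i : dens i < 1. Proof. by rewrite invf_lt1. Qed.

Definition point i n : R := n%:~R * alpha i + beta i.

(* number of points of the i-th progression in [[beta i, u)], up to sign *)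
Definition count_below i u : int := Num.ceil ((u - beta i) * dens i).

Lemma count_below_gt i n u : (n < count_below i u) = (point i n < u).
Proof.
by rewrite /count_below ceil_gt_int /point ltr_pdivlMr // ltrBrDr.
Qed.

Lemma le_count_below i u v : u <= v -> count_below i u <= count_below i v.
Proof. by move=> uv; apply: le_ceil; rewrite ler_pM2r // lerD2r. Qed.

Lemma count_belowD1 i k :
  count_below i (k + 1)%:~R = count_below i k%:~R + `[< beatty (alpha i) (beta i) k >]%:R.
Proof.
have le1 : count_below i k%:~R <= count_below i (k + 1)%:~R.
  by apply: le_count_below; rewrite ler_int; lia.
have le2 : count_below i (k + 1)%:~R <= count_below i k%:~R + 1.
  rewrite /count_below ceil_le_int !intrD.
  have -> : (k%:~R + 1%:~R - beta i) * dens i = (k%:~R - beta i) * dens i + dens i by ring.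
  by rewrite lerD ?ceil_ge // ltW.
case: asboolP => [/beattyP[n]|nb].
  rewrite -/(point i n) => /andP[kn nk].
  have : n < count_below i (k + 1)%:~R by rewrite count_below_gt.
  have : ~~ (n < count_below i k%:~R) by rewrite count_below_gt -leNgt.
  by move: le1 le2; move: (count_below _ _) (count_below _ _); lia.
rewrite addr0; apply/eqP; rewrite eq_le le1 andbT leNgt; apply/negP => lt.
apply: nb; apply/beattyP; exists (count_below i k%:~R); rewrite -/(point i _).
by rewrite -(count_below_gt i _ (k + 1)%:~R) lt leNgt -count_below_gt ltxx.
Qed.

(** Passing an integer raises exactly one of the counts, by 1. *)
Lemma sum_count_below : exists C : int, forall k, \sum_i count_below i k%:~R = k + C.
Proof.
exists (\sum_i count_below i 0%:~R) => k.
rewrite (int_ind_step (f := fun k => \sum_i count_below i k%:~R) (c := 1)).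
  by rewrite addrC mulrzz mul1r.
move=> k'; under eq_bigr do rewrite count_belowD1; rewrite big_split /=; congr (_ + _).
have [i [bi iu]] := part k'; rewrite (bigD1 i) //= asboolT // big1 ?addr0 // => j ji.
by rewrite asboolF // => /iu ij; rewrite ij eqxx in ji.
Qed.

(** Each count is [k * dens i] up to a bounded error, so [k] times the defect of the sum stays
    bounded for all [k]. *)
Lemma sum_dens : \sum_i dens i = 1.
Proof.
have [C sumC] := sum_count_below.
pose D : R := \sum_i (1 + `|beta i * dens i|) + `|C%:~R|.
have bound k : `|k%:~R * (1 - \sum_i dens i)| <= D.
  have -> : k%:~R * (1 - \sum_i dens i) =
     \sum_i ((count_below i k%:~R)%:~R - (k%:~R - beta i) * dens i - beta i * dens i) - C%:~R.
    rewrite !sumrB -rmorph_sum /= sumC intrD mulrBr mulr1 mulr_sumr.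
    under [X in _ = _ - X - _ - _]eq_bigr do rewrite mulrBl.
    by rewrite sumrB; ring.
  apply: le_trans (ler_normB _ _) _; rewrite lerD2r.
  apply: le_trans (ler_norm_sum _ _ _) _; apply: ler_sum => i _.
  apply: le_trans (ler_normB _ _) _; rewrite lerD2r ger0_norm ?subr_ge0 ?ceil_ge //.
  by have := ceilB1_lt ((k%:~R - beta i) * dens i); rewrite /count_below intrB; lra.
apply/eqP; rewrite eq_sym -subr_eq0; apply/negPn/negP => ne.
have D0 : 0 <= D by apply: le_trans (bound 0); rewrite normr_ge0.
pose k := Num.ceil (D / `|1 - \sum_i dens i|) + 1.
have := bound k; rewrite normrM -ler_pdivlMr ?normr_gt0 // => h.
have k0 : 0 <= k by rewrite addr_ge0 // ceil_ge0; apply: lt_le_trans (divr_ge0 D0 (normr_ge0 _)); lra.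
have := le_trans (ler_norm _) h; rewrite /k intrD.
by have := ceil_ge (D / `|1 - \sum_i dens i|); lra.
Qed.

Lemma common_point i j n n' : point i n = point j n' -> i = j.
Proof.
move=> e; have [l [_ lu]] := part (Num.floor (point i n)).
have li : l = i by apply: lu; exists n.
have lj : l = j by apply: lu; rewrite e; exists n'.
by rewrite -li.
Qed.

(* Otherwise the two progressions of floors would have to meet: their difference moves by steps of
   at most 1 from one sign to the other *)
Lemma equal_strides i j (x y : nat) g : i != j ->
  g%:~R <= x%:R * alpha i <= (g + 1)%:~R -> g%:~R <= y%:R * alpha j <= (g + 1)%:~R ->
  x%:R * alpha i = y%:R * alpha j.
Proof.
move=> ij hx hy.
pose u (t b : R) n : int := Num.floor (n%:~R * t + b).
have step t b n : g%:~R <= t <= (g + 1)%:~R -> u t b n + g <= u t b (n + 1) <= u t b n + g + 1.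
  move=> /andP[gt tg]; have := floor_itv (n%:~R * t + b); rewrite -/(u t b n) => /andP[f1 f2].
  have e : (n + 1)%:~R * t + b = n%:~R * t + b + t by rewrite intrD; ring.
  rewrite intrD in f2; rewrite intrD in tg; apply/andP; split.
    by rewrite {2}/u floor_ge_int e intrD; lra.
  by rewrite -ltzD1 {1}/u floor_lt_int e !intrD; lra.
pose D n := u (x%:R * alpha i) (beta i) n - u (y%:R * alpha j) (beta j) n.
have D1 n : D n - 1 <= D (n + 1) <= D n + 1.
  have := step _ (beta i) n hx; have := step _ (beta j) n hy; rewrite /D.
  by move: (u _ _ _) (u _ _ _) (u _ _ _) (u _ _ _); lia.
have D0 n : D n != 0.
  apply/negP => /eqP; rewrite /D /u => /subr0_eq e.
  have [l [_ lu]] := part (Num.floor (n%:~R * (x%:R * alpha i) + beta i)).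
  have li : l = i by apply: lu; exists (n * x%:Z) => //; rewrite intrM mulrA.
  have lj : l = j by apply: lu; exists (n * y%:Z) => //; rewrite e intrM mulrA.
  by case/eqP: ij; rewrite -li.
have sgn n : (0 < D n) = (0 < D 0).
  have sS k : (0 < D (k + 1)) = (0 < D k).
    by have := D1 k; have := D0 k; have := D0 (k + 1); lia.
  elim/int_ind: n => // k IH; first by rewrite -IH -addn1 PoszD sS.
  by rewrite -IH -(sS (- k.+1%:Z)); congr (0 < D _); lia.
apply/eqP; rewrite -subr_eq0; apply/negPn/negP; set e := _ - _ => ne.
have near n : `|(D n)%:~R - (n%:~R * e + (beta i - beta j))| <= 1.
  have := floor_itv (n%:~R * (x%:R * alpha i) + beta i).
  have := floor_itv (n%:~R * (y%:R * alpha j) + beta j).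
  rewrite /D /u intrB /e; move: (Num.floor _) (Num.floor _) => f1 f2; rewrite !intrD.
  by move=> /andP[h1 h2] /andP[h3 h4]; rewrite ler_norml; apply/andP; split; lra.
pose B : R := 1 + `|beta i - beta j|.
have B0 : 0 < B by rewrite ltr_pwDl.
pose n := Num.ceil (B / `|e|) + 1.
have nB : B < n%:~R * `|e|.
  rewrite -ltr_pdivrMr ?normr_gt0 // /n intrD; have := ceil_ge (B / `|e|); lra.
have big k : n%:~R * `|e| = k%:~R * e -> 0 < D k.
  move=> ke; have := near k; rewrite -ke ler_norml => /andP[h _].
  have := ler_norm (- (beta i - beta j)); rewrite normrN => h'.
  by rewrite -(ltr_int R); move: nB; rewrite /B; lra.
have small k : n%:~R * `|e| = - (k%:~R * e) -> D k < 0.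
  move=> ke; have := near k; rewrite ler_norml => /andP[_ h].
  have := ler_norm (beta i - beta j) => h'.
  by rewrite -(ltr_int R); move: nB; rewrite /B ke; lra.
case: (ger0P e) => e0.
  have := big n; have := small (- n); rewrite sgn (ger0_norm e0) rmorphN mulNr opprK.
  by move=> /(_ erefl) h1 /(_ erefl); rewrite -(sgn (-n)); move: h1; lia.
have := big (- n); have := small n; rewrite (ltr0_norm e0) rmorphN mulNr mulrN.
by move=> /(_ erefl) h1 /(_ erefl); rewrite sgn -(sgn n); move: h1; lia.
Qed.

End Partition.

(** Pigeonhole on boxes of side [1 / (q + 1)]: two multipliers whose fractional parts share a box
    differ by the required [L]. *)
Lemma dirichlet_simultaneous (R : realType) (T : finType) (th : T -> R) (e : R) : 0 < e ->
  exists2 L : nat, (0 < L)%N & exists x : T -> int, forall i, `|L%:R * th i - (x i)%:~R| < e.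
Proof.
move=> e0.
have [q qe] : exists q : nat, 1 / q.+1%:R < e.
  exists (Num.truncn (1 / e)); rewrite ltr_pdivrMr // mulrC -ltr_pdivrMr //.
  exact: truncnS_gt.
pose fr (n : nat) i : R := n%:R * th i - (Num.floor (n%:R * th i))%:~R.
have fr01 n i : 0 <= fr n i < 1.
  have /andP[h1 h2] := floor_itv (n%:R * th i); rewrite intrD in h2.
  by rewrite /fr subr_ge0 h1 ltrBlDr addrC.
pose box (n : nat) i : nat := Num.truncn (q.+1%:R * fr n i).
have boxP n i : (box n i)%:R <= q.+1%:R * fr n i < (box n i).+1%:R.
  have /andP[f0 _] := fr01 n i.
  by apply: truncn_itv; rewrite mulr_ge0.
have box_lt n i : (box n i < q.+1)%N.
  have /andP[f0 f1] := fr01 n i; have /andP[h _] := boxP n i.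
  by rewrite -(ltr_nat R); apply: le_lt_trans h _; rewrite gtr_pMr.
pose F (n : 'I_#|{ffun T -> 'I_q.+1}|.+1) : {ffun T -> 'I_q.+1} := [ffun i => Ordinal (box_lt n i)].
have [n [n' [nn Fn]]] : exists n, exists n', n != n' /\ F n = F n'.
  apply: contrapT => h; have inj : injective F.
    move=> n n' Fn; apply/eqP; apply: contrapT => /negP nn; apply: h; by exists n, n'.
  by have := leq_card F inj; rewrite card_ord ltnn.
wlog lt : n n' nn Fn / (n < n')%N => [H|].
  case: (ltngtP n n') => [lt|lt|/val_inj eq]; first exact: (H n n').
    by apply: (H n' n) => //; rewrite eq_sym.
  by rewrite eq eqxx in nn.
exists (n' - n)%N; first by rewrite subn_gt0.
exists (fun i => Num.floor (n'%:R * th i) - Num.floor (n%:R * th i)) => i.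
have bE : box n i = box n' i by have /ffunP/(_ i) := Fn; rewrite !ffunE => /(congr1 val).
have -> : (n' - n)%:R * th i - (Num.floor (n'%:R * th i) - Num.floor (n%:R * th i))%:~R = fr n' i - fr n i.
  by rewrite natrB ?(ltnW lt) // intrB /fr; ring.
apply: lt_trans qe; rewrite ltr_pdivlMr // mulrC -[q.+1%:R]ger0_norm // -normrM.
have := boxP n i; have := boxP n' i; rewrite bE => /andP[h1 h2] /andP[h3 h4].
rewrite -[(box _ _).+1%:R]natr1 in h2 h4; rewrite ltr_norml; apply/andP; split; lra.
Qed.

(** * Almost periods shifting two groups of classes in opposite directions *)

Section Flow.
Variables (R : realType) (m : nat) (alpha beta : 'I_m -> R).
Hypothesis alpha1 : forall i, 1 < alpha i.
Hypothesis part : partitions_int (fun i => beatty (alpha i) (beta i)).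
Implicit Types (i j : 'I_m) (k n c : int) (u v e : R) (A : {set 'I_m}).

Local Notation dens := (dens alpha).
Local Notation point := (point alpha beta).
Local Notation count_below := (count_below alpha beta).

Let a0 i : 0 < alpha i. Proof. exact: lt_trans (alpha1 i). Qed.
Let an0 i : alpha i != 0. Proof. by rewrite lt0r_neq0. Qed.
Let th0 i : 0 < dens i. Proof. by rewrite invr_gt0. Qed.

(* [L] is an almost period of the partition: it shifts the classes in [A] by [e], the others by [e'] *)
Definition almost_period A (L : nat) (x : 'I_m -> nat) (e e' : R) : Prop :=
  [/\ forall i, (0 < x i)%N, \sum_i (x i)%:Z = L%:Z,
      forall i, i \in A -> (x i)%:R * alpha i = L%:R + e &
      forall i, i \notin A -> (x i)%:R * alpha i = L%:R + e'].

Definition splits A (eps : R) : Prop := exists L x e e',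
  [/\ almost_period A L x e e', e * e' < 0, `|e| < eps & `|e'| < eps].

Lemma splitsC A eps : splits A eps -> splits (~: A) eps.
Proof.
move=> [L [x [e [e' [[x0 sx xA xN] ee h h']]]]]; exists L, x, e', e; split=> //; last by rewrite mulrC.
by split=> // i; rewrite finset.in_setC ?negbK; [apply: xN|apply: xA].
Qed.

Lemma splits_le A eps eps' : eps <= eps' -> splits A eps -> splits A eps'.
Proof.
move=> le [L [x [e [e' [ap ee h h']]]]]; exists L, x, e, e'; split=> //; exact: lt_le_trans le.
Qed.

(** [A] collects the classes whose stride exceeds [L]. By [equal_strides] the shifts agree on each
    side; none vanishes, since the shift of [i0] would then vanish too; and weighted by the
    densities they sum to 0, so both signs occur. *)
Lemma exists_splits i0 eps : (forall (L x : nat), (0 < L)%N -> x%:R * alpha i0 != L%:R) -> 0 < eps ->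
  exists A, splits A eps.
Proof.
move=> irr eps0; pose a := \sum_i alpha i.
have aS i : alpha i <= a by rewrite /a (bigD1 i) //= lerDl sumr_ge0 // => j _; exact: ltW.
have a1 : 0 < a := lt_le_trans (a0 i0) (aS i0).
(* [a >= alpha i] brings each shift below [eps] and [1 / 2]; the factor [m + 1] keeps the total
   error below 1, so that the integers [x i] add up to exactly [L]. *)
pose eta := Num.min eps (1 / 2%:R) / (a * (m%:R + 1)).
have M0 : 0 < m%:R + 1 :> R by rewrite ltr_wpDl.
have eta0 : 0 < eta by rewrite divr_gt0 ?mulr_gt0 // lt_min eps0 /=; lra.
have [L L0 [x xL]] := dirichlet_simultaneous dens eta0.
have xe i : `|(x i)%:~R * alpha i - L%:R| < Num.min eps (1 / 2%:R).
  have -> : (x i)%:~R * alpha i - L%:R = - alpha i * (L%:R * dens i - (x i)%:~R).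
    by rewrite /dens; field.
  rewrite normrM normrN (gtr0_norm (a0 i)); apply: (@lt_le_trans _ _ (alpha i * eta)); first by rewrite ltr_pM2l ?a0.
  rewrite /eta mulrA ler_pdivrMr ?mulr_gt0 //.
  have m0 : 0 < Num.min eps (1 / 2%:R) by rewrite lt_min eps0 /=; lra.
  rewrite mulrC ler_pM2l //; apply: le_trans (aS i) _.
  by rewrite ler_peMr ?(ltW a1) // lerDr.
have L1 : 1 <= L%:R :> R by rewrite ler1n.
have xpos i : 0 < x i.
  rewrite -(ltr_int R) -(pmulr_lgt0 _ (a0 i)).
  by have := xe i; rewrite lt_min => /andP[_]; rewrite ltr_norml; lra.
pose X i := `|x i|%N.
have XE i : (X i)%:R = (x i)%:~R :> R by rewrite pmulrn /X gtz0_abs.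
pose d i : R := (X i)%:R * alpha i - L%:R.
have dlt i : `|d i| < Num.min eps (1 / 2%:R) by rewrite /d XE.
have d1 i : `|d i| < 1.
  by have := dlt i; rewrite lt_min => /andP[_]; lra.
have deps i : `|d i| < eps by have := dlt i; rewrite lt_min => /andP[].
have dpos i j : 0 <= d i -> 0 <= d j -> d i = d j.
  move=> di dj; rewrite /d; case: (eqVneq i j) => [-> //|ij]; congr (_ - _).
  apply: (equal_strides part (g := L%:Z) ij); rewrite intrD; have := d1 i; have := d1 j;
    move: di dj; rewrite /d !ltr_norml -!pmulrn; lra.
have dneg i j : d i <= 0 -> d j <= 0 -> d i = d j.
  move=> di dj; rewrite /d; case: (eqVneq i j) => [-> //|ij]; congr (_ - _).
  apply: (equal_strides part (g := L%:Z - 1) ij); rewrite subrK intrB; have := d1 i; have := d1 j;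
    move: di dj; rewrite /d !ltr_norml -!pmulrn; lra.
have dn0 i : d i != 0.
  apply/negP => /eqP di; have /negP := irr L (X i0) L0; apply; rewrite -subr_eq0 -/(d i0).
  by case: (leP 0 (d i0)) => [h|/ltW h]; rewrite -?di; apply/eqP; [apply: dpos|apply: dneg]; rewrite ?di.
have sumX : \sum_i (X i)%:Z = L%:Z.
  have h : `|\sum_i (L%:R * dens i - (X i)%:R)| < 1.
    apply: (@le_lt_trans _ _ (\sum_(i < m) eta)).
      by apply: le_trans (ler_norm_sum _ _ _) _; apply: ler_sum => i _; rewrite XE ltW.
    rewrite sumr_const card_ord -mulr_natr /eta mulrAC ltr_pdivrMr ?mulr_gt0 //.
    have : Num.min eps (1 / 2%:R) <= 1 / 2%:R by rewrite ge_min lexx orbT.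
    have m0 : 0 <= m%:R :> R by [].
    move=> half; have : Num.min eps (1 / 2%:R) * m%:R <= 1 / 2%:R * m%:R by rewrite ler_wpM2r.
    have : 1 * (m%:R + 1) < a * (m%:R + 1) by rewrite ltr_pM2r // (lt_le_trans (alpha1 i0)).
    move=> *; lra.
  rewrite sumrB -mulr_sumr (sum_dens alpha1 part) mulr1 in h.
  have : `|(L%:Z - \sum_i (X i)%:Z)%:~R| < 1 :> R by rewrite intrB rmorph_sum /= .
  by rewrite -intr_norm ltrz1; move: (\sum_i _); lia.
exists [set i | 0 < d i].
have same i j : i \in [set i | 0 < d i] -> j \in [set i | 0 < d i] -> d i = d j.
  by rewrite !inE => /ltW h /ltW h'; apply: dpos.
have same' i j : i \notin [set i | 0 < d i] -> j \notin [set i | 0 < d i] -> d i = d j.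
  by rewrite !inE -!leNgt; apply: dneg.
have sum0 : \sum_i d i * dens i = 0.
  have -> : \sum_i d i * dens i = \sum_i (X i)%:R - L%:R * \sum_i dens i.
    by rewrite mulr_sumr -sumrB; apply: eq_bigr => i _; rewrite /d /dens; field.
  rewrite (sum_dens alpha1 part) mulr1; have := congr1 (fun z : int => z%:~R : R) sumX.
  by rewrite rmorph_sum /= => ->; rewrite subrr.
have [i1 i1P] : exists i, i \in [set i | 0 < d i].
  apply: contrapT => none; suff : \sum_i d i * dens i < 0 by rewrite sum0 ltxx.
  have neg i : d i * dens i < 0.
    by rewrite nmulr_rlt0 // ltNge le_eqVlt eq_sym (negbTE (dn0 i)) /=; apply/negP => di; apply: none; exists i; rewrite inE.
  have : \sum_(i | i != i0) d i * dens i <= 0 by rewrite sumr_le0 // => i _; exact: ltW.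
  by move=> s0; have := neg i0; rewrite (bigD1 i0) //=; lra.
have [i2 i2N] : exists i, i \notin [set i | 0 < d i].
  apply: contrapT => none; suff : 0 < \sum_i d i * dens i by rewrite sum0 ltxx.
  have pos i : 0 < d i * dens i.
    by rewrite mulr_gt0 //; apply: contrapT => /negP di; apply: none; exists i; rewrite inE.
  have : 0 <= \sum_(i | i != i0) d i * dens i by rewrite sumr_ge0 // => i _; exact: ltW.
  by move=> s0; have := pos i0; rewrite (bigD1 i0) //=; lra.
exists L, X, (d i1), (d i2); split=> //.
- split=> // [i|i iA|i iN]; first by rewrite absz_gt0 gt_eqF.
  + by rewrite -(same i i1) // /d addrC subrK.
  + by rewrite -(same' i i2) // /d addrC subrK.
rewrite inE in i1P; rewrite inE -leNgt in i2N.
by rewrite pmulr_rlt0 // lt_neqAle i2N dn0.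
Qed.
End Flow.

Lemma exists_pos_min (R : realType) (T : finType) (Q : T -> R -> Prop) :
  (forall i e e', e <= e' -> Q i e' -> Q i e) -> (forall i, exists2 e, 0 < e & Q i e) ->
  exists2 e, 0 < e & forall i, Q i e.
Proof.
move=> Qle Qe.
have [i|f fP] := @choice T R (fun i e => 0 < e /\ Q i e); first by have [e] := Qe i; exists e.
exists (\big[Num.min/1]_i f i); first by apply: lt_bigmin => // i _; have [] := fP i.
by move=> i; have [_] := fP i; apply: Qle; apply: bigmin_le_cond.
Qed.

(** * Simultaneous crossings of the integers *)

Section Crossing.
Variables (R : realType) (m : nat) (alpha beta : 'I_m -> R).
Hypothesis alpha1 : forall i, 1 < alpha i.
Hypothesis part : partitions_int (fun i => beatty (alpha i) (beta i)).
Implicit Types (i j : 'I_m) (k n c : int) (u v e : R) (A : {set 'I_m}).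

Local Notation dens := (dens alpha).
Local Notation point := (point alpha beta).
Local Notation count_below := (count_below alpha beta).
Local Notation splits := (splits alpha).
Local Notation almost_period := (almost_period alpha).

Let a0 i : 0 < alpha i. Proof. exact: lt_trans (alpha1 i). Qed.
Let an0 i : alpha i != 0. Proof. by rewrite lt0r_neq0. Qed.
Let th0 i : 0 < dens i. Proof. by rewrite invr_gt0. Qed.

Definition mass A : R := \sum_(i in A) dens i.

(** Going back by [c] almost periods takes [k + c L] to [k - c e] or [k - c e'] and lowers the i-th
    count by [c * x i]; these sum to [c L], which cancels. [C] is common to all almost periods. *)
Lemma flow : exists C : int, forall A L x e e', almost_period A L x e e' -> forall k c,
  \sum_(i in A) count_below i (k%:~R - c%:~R * e) +
  \sum_(i in ~: A) count_below i (k%:~R - c%:~R * e') = k + C.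
Proof.
have [C CP] := sum_count_below alpha1 part; exists C => A L x e e' [x0 sx xA xN] k c.
have shift i d : (x i)%:R * alpha i = L%:R + d ->
    count_below i (k + c * L%:Z)%:~R = count_below i (k%:~R - c%:~R * d) + c * (x i)%:Z.
  move=> xd; rewrite /count_below -[in RHS](@intrKceil R (c * (x i)%:Z)) -ceilDrz ?intr_int //.
  congr Num.ceil; rewrite intrD !intrM -!pmulrn.
  have -> : (x i)%:R = (L%:R + d) * dens i by rewrite -xd /dens mulfK.
  by ring.
have := CP (k + c * L%:Z); rewrite (bigID (mem A)) /=.
rewrite (eq_bigr _ (fun i iA => shift i e (xA i iA))) big_split /=.
rewrite [X in _ + X = _](eq_bigr _ (fun i iN => shift i e' (xN i iN))) big_split /=.
have -> : \sum_(i in ~: A) count_below i (k%:~R - c%:~R * e') =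
    \sum_(i | i \notin A) count_below i (k%:~R - c%:~R * e').
  by apply: eq_bigl => i; rewrite finset.in_setC.
have : \sum_(i in A) c * (x i)%:Z + \sum_(i | i \notin A) c * (x i)%:Z = c * L%:Z.
  by rewrite -sx mulr_sumr [RHS](bigID (mem A)).
by move=> E; rewrite addrACA E => E'; apply: (addIr (c * L%:Z)); rewrite E'; ring.
Qed.

Lemma split_masses A L x e e' : almost_period A L x e e' -> e * mass A + e' * mass (~: A) = 0.
Proof.
move=> [_ sx xA xN]; rewrite /mass !mulr_sumr.
have dE i d : (x i)%:R * alpha i = L%:R + d -> d * dens i = (x i)%:R - L%:R * dens i.
  by move=> xd; rewrite -[d](addKr L%:R) -xd /dens; field.
rewrite (eq_bigr _ (fun i iA => dE i e (xA i iA))).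
rewrite [X in _ + X](eq_bigr (fun i => (x i)%:R - L%:R * dens i)); last first.
  by move=> i; rewrite finset.in_setC => iN; apply: dE; apply: xN.
have -> : \sum_(i in ~: A) ((x i)%:R - L%:R * dens i) = \sum_(i | i \notin A) ((x i)%:R - L%:R * dens i).
  by apply: eq_bigl => i; rewrite finset.in_setC.
rewrite -(bigID (mem A) predT) /= sumrB -mulr_sumr (sum_dens alpha1 part) mulr1.
have := congr1 (fun z : int => z%:~R : R) sx; rewrite rmorph_sum /= => ->.
exact: subrr.
Qed.

Lemma mass_gt0 A eps : 0 < eps -> splits A eps -> 0 < mass A /\ 0 < mass (~: A).
Proof.
move=> eps0 [L [x [e [e' [ap ee _ _]]]]].
have h := split_masses ap; have mA : 0 <= mass A by apply: sumr_ge0 => i _; exact: ltW.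
have mN : 0 <= mass (~: A) by apply: sumr_ge0 => i _; exact: ltW.
have mS : mass A + mass (~: A) = 1.
  rewrite -(sum_dens alpha1 part) [RHS](bigID (mem A)) /=; congr (_ + _).
  by apply: eq_bigl => i; rewrite finset.in_setC.
have e0 : e != 0 by apply: contraTneq ee => ->; rewrite mul0r ltxx.
have e'0 : e' != 0 by apply: contraTneq ee => ->; rewrite mulr0 ltxx.
split; rewrite lt_neqAle ?mA ?mN andbT eq_sym; apply/negP => /eqP z; rewrite z in h mS.
  by move: h; rewrite mulr0 add0r (_ : mass (~: A) = 1) ?mulr1; [move/eqP: e'0|lra].
by move: h; rewrite mulr0 addr0 (_ : mass A = 1) ?mulr1; [move/eqP: e0|lra].
Qed.

Lemma count_below_locally_constant j w : (forall n, point j n != w) ->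
  exists2 eta, 0 < eta & forall u, `|u - w| < eta -> count_below j u = count_below j w.
Proof.
move=> nw; set c := count_below j w.
have lo : point j (c - 1) < w by rewrite -count_below_gt // /c; lia.
have hi : w < point j c.
  by rewrite lt_neqAle eq_sym nw leNgt -count_below_gt // ltxx.
exists (Num.min (w - point j (c - 1)) (point j c - w)); first by rewrite lt_min !subr_gt0 lo hi.
move=> u; rewrite lt_min !ltr_norml => /andP[/andP[u1 _] /andP[_ u2]].
have lo' : c - 1 < count_below j u by rewrite count_below_gt //; lra.
have hi' : ~~ (c < count_below j u) by rewrite count_below_gt // -leNgt; lra.
by move: lo' hi'; lia.
Qed.

(* As the flow moves the points of [A] past the integer [k], the points outside [A] must cross [k]
   at the same instants in the other direction *)
Lemma crossing A : (forall eps, 0 < eps -> splits A eps) -> forall i n k, i \in A ->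
  exists j n', j \notin A /\ point j n' = k%:~R + mass A / mass (~: A) * (k%:~R - point i n).
Proof.
move=> sp i n k iA; set tau := mass A / _; set z := point i n; set w := _ + _.
apply: contrapT => none.
have [C CP] := flow.
have [eta eta0 etaP] : exists2 eta, 0 < eta & forall j, j \notin A ->
    forall u, `|u - w| < eta -> count_below j u = count_below j w.
  apply: (@exists_pos_min _ _ (fun j eta => j \notin A -> forall u, `|u - w| < eta -> count_below j u = count_below j w)).
    by move=> j e e' le Q jA u ue; apply: Q => //; apply: lt_le_trans le.
  move=> j; case: (boolP (j \in A)) => jA; first by exists 1.
  have [|eta eta0 h] := @count_below_locally_constant j w.
    by move=> n'; apply/negP => /eqP e; apply: none; exists j, n'.
  by exists eta.
have [mA mN] := mass_gt0 ltr01 (sp _ ltr01).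
have tau0 : 0 < tau by rewrite divr_gt0.
have [L [x [e [e' [ap ee _ he']]]]] := sp _ eta0.
(* In terms of [d = |e|] the complement drifts by [tau * d] the other way; the sign of [e] is
   absorbed into [c]. *)
have [d [d0 dE fl]] : exists d, [/\ 0 < d, tau * d < eta & forall c,
    \sum_(i in A) count_below i (k%:~R - c%:~R * d) +
    \sum_(i in ~: A) count_below i (k%:~R + c%:~R * (tau * d)) = k + C].
  have e'E : e' = - (tau * e).
    have := split_masses ap; rewrite /tau => h.
    apply: (mulIf (lt0r_neq0 mN)).
    have -> : - (mass A / mass (~: A) * e) * mass (~: A) = - (e * mass A) by field; rewrite lt0r_neq0.
    lra.
  have e0 : e != 0 by apply: contraTneq ee => ->; rewrite mul0r ltxx.
  exists `|e|; rewrite normr_gt0 e0 -(gtr0_norm tau0) -normrM -normrN -e'E; split=> // c.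
  rewrite e'E normrN normrM (gtr0_norm tau0) -?e'E.
  case: (ger0P e) => _.
    have -> : k%:~R + c%:~R * (tau * e) = k%:~R - c%:~R * e' by rewrite e'E; ring.
    exact: (CP _ _ _ _ _ ap).
  have -> : k%:~R - c%:~R * - e = k%:~R - (- c)%:~R * e by rewrite rmorphN; ring.
  have -> : k%:~R + c%:~R * (tau * - e) = k%:~R - (- c)%:~R * e' by rewrite e'E rmorphN; ring.
  exact: (CP _ _ _ _ _ ap).
(* The step during which the point [z] passes [k]: it is below [k - c d] but not below
   [k - (c + 1) d]. *)
pose c := Num.ceil ((k%:~R - z) / d) - 1.
have c1 : c%:~R * d < k%:~R - z by rewrite -ltr_pdivlMr // ceilB1_lt.
have c2 : k%:~R - z <= (c + 1)%:~R * d by rewrite -ler_pdivrMr // subrK ceil_ge.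
have eqN : \sum_(i in ~: A) count_below i (k%:~R + c%:~R * (tau * d)) =
    \sum_(i in ~: A) count_below i (k%:~R + (c + 1)%:~R * (tau * d)).
  apply: eq_bigr => j; rewrite finset.in_setC => jN.
  have near c' : `|c'%:~R * d - (k%:~R - z)| <= d ->
      count_below j (k%:~R + c'%:~R * (tau * d)) = count_below j w.
    move=> h; apply: etaP => //; apply: le_lt_trans dE.
    have -> : k%:~R + c'%:~R * (tau * d) - w = tau * (c'%:~R * d - (k%:~R - z)) by rewrite /w; ring.
    by rewrite normrM (gtr0_norm tau0) ler_pM2l.
  rewrite intrD in c2.
  have h1 : `|c%:~R * d - (k%:~R - z)| <= d by rewrite ler_norml; apply/andP; split; lra.
  have h2 : `|(c + 1)%:~R * d - (k%:~R - z)| <= d.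
    by rewrite intrD ler_norml; apply/andP; split; lra.
  by rewrite !near.
have := fl c; have := fl (c + 1); rewrite eqN => <- /addIr.
have drop j : j \in A -> count_below j (k%:~R - (c + 1)%:~R * d) <= count_below j (k%:~R - c%:~R * d).
  by move=> _; apply: (le_count_below _ alpha1); rewrite intrD; lra.
have lt : count_below i (k%:~R - (c + 1)%:~R * d) < count_below i (k%:~R - c%:~R * d).
  apply: (@le_lt_trans _ _ n).
    by rewrite leNgt count_below_gt // -leNgt -/z; lra.
  by rewrite count_below_gt // -/z; lra.
rewrite (bigD1 i) //= [RHS](bigD1 i) //= => E.
have : \sum_(j in A | j != i) count_below j (k%:~R - (c + 1)%:~R * d) <=
    \sum_(j in A | j != i) count_below j (k%:~R - c%:~R * d).
  by apply: ler_sum => j /andP[jA _]; apply: drop.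
by move: E lt; move: (\sum_(_ in _ | _) _) (\sum_(_ in _ | _) _) => s t; lia.
Qed.

End Crossing.

(* [k] ranges over the residue class of [k0] modulo [X / gcd(x, X)] *)
Lemma class_sturm (X x k0 k : nat) : (0 < X)%N -> (0 < x)%N ->
  in_sturm (X %/ gcdn x X) 1 (k0 * (X %/ gcdn x X).-1) k <->
  exists n : int, (k%:Z - k0%:Z) * x%:Z = n * X%:Z.
Proof.
move=> X0 x0; set g := gcdn x X; set p := (X %/ g)%N.
have g0 : (0 < g)%N by rewrite gcdn_gt0 x0.
have Xp : X = (p * g)%N by rewrite divnK // dvdn_gcdr.
have [y xy] : exists y, x = (y * g)%N by exists (x %/ g)%N; rewrite divnK // dvdn_gcdl.
have p0 : (0 < p)%N by move: X0; rewrite Xp muln_gt0 => /andP[].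
have py : coprime p y.
  by rewrite coprime_sym /coprime -(eqn_pmul2r g0) mul1n muln_gcdl -xy -Xp.
set K := (k * 1 + k0 * p.-1)%N.
have KE : (K%:Z = k%:Z - k0%:Z + k0%:Z * p%:Z) by rewrite /K; move: p0; case: (p) => // p' _; rewrite muln1 /=; lia.
have -> : in_sturm p 1 (k0 * p.-1) k = (X %| K * x)%N.
  by rewrite /in_sturm -/K ltnS leqn0 xy mulnA Xp dvdn_pmul2r // Gauss_dvdl.
split=> [/dvdnP[n e]|[n e]].
  exists (n%:Z - k0%:Z * y%:Z).
  have : K%:Z * x%:Z = n%:Z * X%:Z by rewrite -!PoszM e.
  rewrite KE Xp xy !PoszM => e'.
  have -> : (k%:Z - k0%:Z) * (y%:Z * g%:Z) = (k%:Z - k0%:Z + k0%:Z * p%:Z) * (y%:Z * g%:Z) - k0%:Z * p%:Z * (y%:Z * g%:Z) by ring.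
  by rewrite e'; ring.
have : (X%:Z %| (K * x)%:Z)%Z.
  apply/dvdzP; exists (n + k0%:Z * y%:Z); rewrite PoszM KE mulrDl e Xp xy !PoszM; ring.
by [].
Qed.

(** * Residue classes cut out by the crossings *)

Section Classes.
Variables (R : realType) (m : nat) (alpha beta : 'I_m -> R).
Hypothesis alpha1 : forall i, 1 < alpha i.
Hypothesis alpha_inj : injective alpha.
Hypothesis part : partitions_int (fun i => beatty (alpha i) (beta i)).

Local Notation dens := (dens alpha).
Local Notation point := (point alpha beta).
Local Notation splits := (splits alpha).
Local Notation mass := (mass alpha).

Let a0 i : 0 < alpha i. Proof. exact: lt_trans (alpha1 i). Qed.
Let an0 i : alpha i != 0. Proof. by rewrite lt0r_neq0. Qed.

(* The crossing points of a point of [A] form an arithmetic progression of step [1 / mass (~: A)],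
   so the classes outside [A] cut the integers into residue classes *)
Lemma split_class_unique (A : {set 'I_m}) : (forall eps : R, 0 < eps -> splits A eps) ->
  forall i j j', i \in A -> j \notin A -> j' \notin A -> j = j'.
Proof.
move=> sp i j j' iA jN j'N.
have cr := crossing alpha1 part sp.
have [mA mN] := mass_gt0 alpha1 part ltr01 (sp _ ltr01).
have [L [x [e [e' [ap _ _ _]]]]] := sp _ ltr01.
have [x0 sx _ xN] := ap; set Y := L%:R + e' in xN.
have Y0 : 0 < Y by rewrite -(xN j jN) mulr_gt0 // ltr0n.
pose X := (\sum_(j in ~: A) x j)%N.
have X0 : (0 < X)%N by rewrite /X (bigD1 j) ?finset.in_setC //= addn_gt0 x0.
have XR : 0 < X%:R :> R by rewrite ltr0n.
have mNE : mass (~: A) = X%:R / Y.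
  rewrite /mass /X natr_sum mulr_suml; apply: eq_bigr => l; rewrite finset.in_setC => lN.
  by rewrite /dens -(xN l lN); field; rewrite pnatr_eq0 -lt0n x0 an0.
have mS : mass A + mass (~: A) = 1.
  rewrite -(sum_dens alpha1 part) [RHS](bigID (mem A)) /=; congr (_ + _).
  by apply: eq_bigl => l; rewrite finset.in_setC.
(* The crossing points advance by [Y / X] per integer and the points of a class [l] outside [A] by
   [Y / x l], so the integers hit by [l] form a residue class modulo [X / gcd (x l, X)]. *)
have sE : 1 + mass A / mass (~: A) = Y / X%:R.
  have -> : mass A = 1 - mass (~: A) by lra.
  by rewrite mNE; field; rewrite !lt0r_neq0.
set tau := mass A / _ in cr sE; pose z := point i 0.
pose w (k : nat) : R := k%:R + tau * (k%:R - z).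
have wB k k' : w k - w k' = (k%:R - k'%:R) * (Y / X%:R) by rewrite -sE /w; ring.
pose hit l (k : nat) := exists n, point l n = w k.
have hitP l k k0 : l \notin A -> hit l k0 -> hit l k <-> exists n : int, (k%:Z - k0%:Z) * (x l)%:Z = n * X%:Z.
  move=> lN [n0 h0].
  have eq n : (point l (n0 + n) = w k) <-> (k%:Z - k0%:Z) * (x l)%:Z = n * X%:Z.
    have -> : (point l (n0 + n) = w k) <-> (n%:~R * alpha l = w k - w k0).
      rewrite -h0 /point intrD; split=> h; first by rewrite -h; ring.
      by rewrite mulrDl h; ring.
    have xl0 : (x l)%:R != 0 :> R by rewrite pnatr_eq0 -lt0n.
    have -> : alpha l = Y / (x l)%:R by rewrite -(xN l lN) mulrC mulKf.
    rewrite wB; split=> h.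
      apply: (@intr_inj R); rewrite !intrM intrB -!pmulrn.
      have : (n%:~R * (Y / (x l)%:R)) * ((x l)%:R * X%:R / Y) = (k%:R - k0%:R) * (Y / X%:R) * ((x l)%:R * X%:R / Y) by rewrite h.
      have -> : n%:~R * (Y / (x l)%:R) * ((x l)%:R * X%:R / Y) = n%:~R * X%:R by field; rewrite lt0r_neq0 ?xl0.
      by move=> ->; field; rewrite !lt0r_neq0.
    have := congr1 (fun t : int => t%:~R : R) h; rewrite !intrM intrB -!pmulrn => h'.
    have -> : (k%:R - k0%:R) * (Y / X%:R) = ((k%:R - k0%:R) * (x l)%:R) * Y / (x l)%:R / X%:R.
      by field; rewrite xl0 lt0r_neq0.
    by rewrite h'; field; rewrite xl0 lt0r_neq0.
  split=> [[n h]|[n h]]; last by exists (n0 + n); apply/eq.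
  by exists (n - n0); apply/eq; rewrite addrC subrK.
pose B := [set l | (l \notin A) && `[< exists k, hit l k >]].
have BP l : l \in B -> l \notin A /\ exists k, hit l k by rewrite inE => /andP[lA /asboolP].
pose T := 'I_#|B|; pose f (t : T) := enum_val t.
have fB t : f t \in B by apply: enum_valP.
have [t|k0 k0P] := @choice T nat (fun t k => hit (f t) k); first by have [] := BP _ (fB t).
pose g t := gcdn (x (f t)) X; pose p t := (X %/ g t)%N; pose d t := (k0 t * (p t).-1)%N.
have g0 t : (0 < g t)%N by rewrite gcdn_gt0 X0 orbT.
have gp t : (p t * g t = X)%N by rewrite divnK // dvdn_gcdr.
have p0 t : (0 < p t)%N by move: X0; rewrite -(gp t) muln_gt0 => /andP[].
have stP t k : in_sturm (p t) 1 (d t) k <-> hit (f t) k.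
  have [fA _] := BP _ (fB t).
  by rewrite /p /d class_sturm // (hitP _ k _ fA (k0P t)).
have cover k : (\sum_(t : T) in_sturm (p t) 1 (d t) k = 1)%N.
  have [l [n [lN ln]]] := cr i 0 k%:Z iA; rewrite -pmulrn -/z -/(w k) in ln.
  have lB : l \in B by rewrite inE lN; apply/asboolP; exists k, n.
  pose t := enum_rank_in lB l; have ft : f t = l by rewrite /f enum_rankK_in.
  rewrite (bigD1 t) //= big1 => [|t' tt'].
    by have /stP -> : hit (f t) k by rewrite ft; exists n.
  apply/eqP; rewrite eqb0; apply/negP => /stP[n' h'].
  move/negP: tt'; apply; apply/eqP; apply: enum_val_inj; rewrite -/(f t) -/(f t') ft.
  by apply: (common_point part (n := n') (n' := n)); rewrite h' ln.
(* The densities of the residue classes add up to 1, so the gcds add up to [X], which is also the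
   sum of the [x l]. Hence every class outside [A] is hit and each [x l] divides [X]; distinct
   [alpha l = Y / x l] then give distinct moduli [X / x l]. *)
have sumg : (\sum_t g t = X)%N.
  have := sum_density cover (fun t => And3 (ltn0Sn 0) (p0 t) (coprime1n _)).
  have -> : \sum_t 1%:R / (p t)%:R = (\sum_t g t)%:R / X%:R :> rat.
    rewrite natr_sum mulr_suml; apply: eq_bigr => t _; rewrite -(gp t) natrM.
    by field; rewrite !pnatr_eq0 -!lt0n p0 g0.
  move/(canRL (divfK _)); rewrite pnatr_eq0 -lt0n X0 mul1r => /(_ isT)/eqP.
  by rewrite eqr_nat => /eqP.
have le_g l : l \in ~: A -> ((if l \in B then gcdn (x l) X else 0) <= x l)%N.
  by move=> _; case: ifP => // _; apply: dvdn_leq (dvdn_gcdl _ _).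
have sumB : (\sum_(l in ~: A) (if l \in B then gcdn (x l) X else 0) = X)%N.
  rewrite -big_mkcondr -[RHS]sumg /= /g /f -(big_enum_val (fun l => gcdn (x l) X)) /=.
  by apply: eq_bigl => l; rewrite finset.in_setC; case: (boolP (l \in B)) => [/BP[->]|]; rewrite ?andbF ?andbT.
have eqg l : l \notin A -> l \in B /\ gcdn (x l) X = x l.
  move=> lN; have lC : l \in ~: A by rewrite finset.in_setC.
  have : (if l \in B then gcdn (x l) X else 0%N) = x l.
    have := sumB; rewrite {2}/X (bigD1 l) //= [RHS](bigD1 l) //=.
    have : (\sum_(k in ~: A | k != l) (if k \in B then gcdn (x k) X else 0%N) <=
            \sum_(k in ~: A | k != l) x k)%N by apply: leq_sum => k /andP[kC _]; apply: le_g.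
    have := le_g l lC; move: (if _ then _ else _) (\sum_(_ in _ | _) _)%N (\sum_(_ in _ | _) _)%N => a b c.
    by lia.
  by case: ifP => // _ h; have := x0 l; rewrite -h.
have p_inj : injective (fun t => (p t, 1%N)).
  move=> t t' [pt]; apply: enum_val_inj; apply: alpha_inj.
  have [fA _] := BP _ (fB t); have [fA' _] := BP _ (fB t').
  have xx : x (f t) = x (f t').
    have := gp t; rewrite pt -[RHS](gp t') => /eqP; rewrite eqn_pmul2l ?p0 // => /eqP.
    by rewrite /g (eqg _ fA).2 (eqg _ fA').2.
  have xt0 : (x (f t))%:R != 0 :> R by rewrite pnatr_eq0 -lt0n.
  by apply: (mulfI xt0); rewrite -/(f t) -/(f t') {2}xx !xN.
have uniq := @exact_cover_singleton R T p (fun=> 1%N) d cover p_inj (fun=> erefl) p0.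
have [jB _] := eqg j jN; have [j'B _] := eqg j' j'N.
rewrite -(enum_rankK_in jB jB) -(enum_rankK_in jB j'B).
by congr enum_val; apply: uniq.
Qed.

End Classes.

(** * Rational classes in modular form, and the conclusion *)

Definition sturm_offset (R : realType) (p q : nat) (b : R) : nat :=
  `|((q%:Z - 1 - Num.floor (b * q%:R)) %% p%:Z)%Z|%N.

(** Multiplied by [q], [k <= n p / q + b < k + 1] becomes [0 <= k q + D - n p < q] with
    [D = q - 1 - floor (b q)]; such an [n] exists when the residue of [k q + D] modulo [p] is below
    [q]. *)
Lemma beatty_sturm (R : realType) (p q : nat) (b : R) (k : nat) : (0 < q)%N -> (q <= p)%N ->
  beatty (p%:R / q%:R) b k%:Z <-> in_sturm p q (sturm_offset p q b) k.
Proof.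
move=> q0 qp; have Q0 : 0 < q%:R :> R by rewrite ltr0n.
have p0 : (p%:Z != 0) by move: q0 qp; clear; lia.
set D := q%:Z - 1 - Num.floor (b * q%:R).
have eqn (n : int) : (k%:Z%:~R <= n%:~R * (p%:R / q%:R) + b < (k%:Z + 1)%:~R) =
    (0 <= k%:Z * q%:Z + D - n * p%:Z < q%:Z).
  have e : (n%:~R * (p%:R / q%:R) + b) * q%:R = (n * p%:Z)%:~R + b * q%:R :> R.
    by rewrite intrM -pmulrn; field; rewrite lt0r_neq0.
  rewrite -(ler_pM2r Q0) -(ltr_pM2r Q0 _ (k%:Z + 1)%:~R) e.
  have -> : k%:Z%:~R * q%:R = (k%:Z * q%:Z)%:~R :> R by rewrite intrM -!pmulrn.
  have -> : (k%:Z + 1)%:~R * q%:R = ((k%:Z + 1) * q%:Z)%:~R :> R by rewrite intrM -[q%:Z%:~R]pmulrn.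
  rewrite -lerBlDl -ltrBrDl -!intrB -floor_ge_int -floor_lt_int /D.
  by move: (Num.floor _) => c; apply/idP/idP; lia.
have dE : (sturm_offset p q b)%:Z = (D %% p%:Z)%Z by rewrite /sturm_offset gez0_abs // modz_ge0.
have stE : in_sturm p q (sturm_offset p q b) k = (((k%:Z * q%:Z + D) %% p%:Z)%Z < q%:Z).
  by rewrite /in_sturm -ltz_nat -modz_nat PoszD PoszM dE modzDmr.
rewrite stE beattyP; split=> [[n]|lt].
  rewrite eqn => /andP[h0 h1].
  have -> : k%:Z * q%:Z + D = n * p%:Z + (k%:Z * q%:Z + D - n * p%:Z) by ring.
  rewrite modzMDl modz_small // h0 /=; apply: lt_le_trans h1 _; by rewrite lez_nat.
exists ((k%:Z * q%:Z + D) %/ p%:Z)%Z; rewrite eqn {1 3}(divz_eq (k%:Z * q%:Z + D) p%:Z) addrC addKr.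
by rewrite lt modz_ge0.
Qed.

Lemma rational_alpha (R : realType) (a : R) (L x : nat) : 3%:R < a -> (0 < L)%N -> x%:R * a = L%:R ->
  exists pq : nat * nat, [/\ (0 < pq.2)%N, (3 * pq.2 < pq.1)%N, coprime pq.2 pq.1 & a = pq.1%:R / pq.2%:R].
Proof.
move=> a3 L0 xa; have x0 : (0 < x)%N.
  by rewrite lt0n; apply: contraTneq L0 => x0; move: xa; rewrite x0 mul0r => /esym/eqP; rewrite pnatr_eq0 -lt0n => /eqP ->.
set g := gcdn x L; have g0 : (0 < g)%N by rewrite gcdn_gt0 x0.
have xg : (x = x %/ g * g)%N by rewrite divnK // dvdn_gcdl.
have Lg : (L = L %/ g * g)%N by rewrite divnK // dvdn_gcdr.
have q0 : (0 < x %/ g)%N by rewrite divn_gt0 // dvdn_leq // dvdn_gcdl.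
have Q0 : 0 < (x %/ g)%:R :> R by rewrite ltr0n.
have aE : a = (L %/ g)%:R / (x %/ g)%:R.
  apply: (mulfI (_ : x%:R != 0)); first by rewrite pnatr_eq0 -lt0n.
  rewrite xa {1}Lg {1}xg !natrM; field; exact: lt0r_neq0.
exists (L %/ g, x %/ g)%N; split=> //=.
  by rewrite -(ltr_nat R) natrM -ltr_pdivlMr // -aE.
by rewrite /coprime -(eqn_pmul2r g0) mul1n muln_gcdl -xg -Lg.
Qed.

(* The neutral value 0 of the iterated maximum lies below every 1 / alpha i. *)
Theorem theorem1p2 (R : realType) (m : nat) (hm : (3 <= m)%N)
    (alpha beta : 'I_m -> R)
    (halpha : forall i, 1 < alpha i)
    (hdistinct : injective alpha)
    (hpart : partitions_int (fun i => beatty (alpha i) (beta i))) :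
  1 / 3 <= \big[Num.max/0]_(i < m) (1 / alpha i).
Proof.
rewrite leNgt; apply/negP => small.
have a3 i : 3%:R < alpha i.
  have a0 : 0 < alpha i := lt_trans ltr01 (halpha i).
  have : 1 / alpha i < 1 / 3 by apply: le_lt_trans small; apply: le_bigmax_cond.
  by rewrite ltr_pdivrMr // mulrAC ltr_pdivlMr // !mul1r.
have [[i0 irr]|rat] := pselect (exists i, forall L x : nat, (0 < L)%N -> x%:R * alpha i != L%:R).
  have [A sp] : exists A, forall eps, 0 < eps -> splits alpha A eps.
    (* The set from [exists_splits] may depend on [eps]. There are finitely many sets: if each
       failed for some [eps], all would fail at the least of these. *)
    apply: contrapT => none.
    have [||eps eps0 h] := @exists_pos_min R {set 'I_m} (fun A e => ~ splits alpha A e).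
    - by move=> A e e' le nsp sp; apply: nsp; apply: splits_le sp.
    - move=> A; apply: contrapT => h; apply: none; exists A => eps eps0.
      by apply: contrapT => nsp; apply: h; exists eps.
    by have [A] := exists_splits halpha hpart irr eps0; apply: h.
  have spC eps : 0 < eps -> splits alpha (~: A) eps by move=> /sp /splitsC.
  have [mA mN] := mass_gt0 halpha hpart ltr01 (sp _ ltr01).
  have nonempty B : 0 < mass alpha B -> exists i, i \in B.
    move=> mB; apply: contrapT => none; move: mB; rewrite /mass big1 ?ltxx // => i iB.
    by case: none; exists i.
  have [i iA] := nonempty _ mA; have [j jN] := nonempty _ mN.
  have A1 : (#|A| <= 1)%N.
    apply/card_le1_eqP => k l kA lA.
    by apply: (split_class_unique halpha hdistinct hpart spC jN); rewrite finset.in_setC negbK.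
  have N1 : (#|~: A| <= 1)%N.
    apply/card_le1_eqP => k l; rewrite !finset.in_setC => kA lA.
    exact: (split_class_unique halpha hdistinct hpart sp iA).
  by have := cardsC A; rewrite card_ord; move: A1 N1 hm; lia.
have [i|pq pqP] := @choice 'I_m (nat * nat) (fun i pq =>
  [/\ (0 < pq.2)%N, (3 * pq.2 < pq.1)%N, coprime pq.2 pq.1 & alpha i = pq.1%:R / pq.2%:R]).
  apply: contrapT => none; apply: rat; exists i => L x L0; apply/negP => /eqP xa.
  by apply: none; apply: rational_alpha (a3 i) L0 xa.
apply: (@no_rational_cover R 'I_m (fun i => (pq i).1) (fun i => (pq i).2)
  (fun i => sturm_offset (pq i).1 (pq i).2 (beta i))).
- move=> k; have [i [bi iu]] := hpart k%:Z.
  have stP j : beatty (alpha j) (beta j) k%:Z <->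
      in_sturm (pq j).1 (pq j).2 (sturm_offset (pq j).1 (pq j).2 (beta j)) k.
    have [q0 q3 _ ->] := pqP j; apply: beatty_sturm => //; move: q3; clear; lia.
  rewrite (bigD1 i) //= big1 => [|j ji]; first by have /stP -> := bi.
  by apply/eqP; rewrite eqb0; apply/negP => /stP /iu ij; rewrite ij eqxx in ji.
- move=> i j [pE qE]; apply: hdistinct.
  by have [_ _ _ ->] := pqP i; have [_ _ _ ->] := pqP j; rewrite pE qE.
by move=> i; have [] := pqP i.
Qed.
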